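(* In the Wyner-Ziv problem with a helper described in the context, where $Y-X-Z$ is a Markov chain, the operational achievable region equals the single-letter region: $\mathcal R^O_{Y-X-Z}(D)=\mathcal R_{Y-X-Z}(D)$.
   Context: Let $\mathcal X,\mathcal Y,\mathcal Z,\hat{\mathcal X}$ be finite alphabets, $d:\mathcal X\times\hat{\mathcal X}\to[0,\infty)$ a distortion measure, and $(X_i,Y_i,Z_i)$ i.i.d. with distribution $p(x,y,z)=p(x,y)p(z|x)$ (Markov chain $Y-X-Z$). A helper observing $Y^n$ sends a message $T_1=f_1(Y^n)\in\{1,\dots,2^{nR_1}\}$ to both the encoder and the decoder; the encoder observing $X^n$ sends $T=f(X^n,T_1)\in\{1,\dots,2^{nR}\}$ to the decoder; the decoder observes side information $Z^n$ and outputs $\hat X^n=g(T,T_1,Z^n)\in\hat{\mathcal X}^n$. A pair $(R,R_1)$ is achievable at distortion $D$ if for every $\epsilon>0$ and all sufficiently large $n$ there exist such $f_1,f,g$ with $\mathbb E\big[\frac1n\sum_{i=1}^n d(X_i,\hat X_i)\big]\le D+\epsilon$; $\mathcal R^O_{Y-X-Z}(D)$ is the closure of the set of achievable pairs. $\mathcal R_{Y-X-Z}(D)$ is the set of all pairs $(R,R_1)$ with $R_1\ge I(U;Y|Z)$ and $R\ge I(X;W|U,Z)$ for some finite-alphabet auxiliary random variables $U,W$ with joint distribution $p(x,y,z,u,w)=p(x,y)p(z|x)p(u|y)p(w|x,u)$ and a deterministic function $\hat X(U,W,Z)$ with $\mathbb E\, d(X,\hat X(U,W,Z))\le D$. *)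

(* Defs.v *)
From HB Require Import structures.
From mathcomp Require Import all_boot all_order all_algebra.
From mathcomp Require Import all_classical all_reals all_analysis.
Set Implicit Arguments. Unset Strict Implicit. Unset Printing Implicit Defensive.
Import Order.TTheory GRing.Theory Num.Theory.
Local Open Scope ring_scope.
Import numFieldTopology.Exports numFieldNormedType.Exports.
Local Open Scope classical_set_scope.

Definition is_pmf {R : realType} {T : finType} (p : T -> R) : Prop :=
  (forall t, 0 <= p t) /\ \sum_(t : T) p t = 1.

(* logarithm in base 2 (rates are in bits, messages sets have size 2^{nR}) *)
Definition log2 {R : realType} (x : R) : R := ln x / ln 2.

Definition prob {R : realType} {T : finType} (P : T -> R) (E : pred T) : R :=
  \sum_(t | E t) P t.

(* conditional mutual information I(A;B|C) (in bits) of random variables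
   fa, fb, fc defined on the finite probability space (T, P); 0 log 0 = 0. *)
Definition condMI {R : realType} {T A B C : finType} (P : T -> R)
  (fa : T -> A) (fb : T -> B) (fc : T -> C) : R :=
  \sum_(a : A) \sum_(b : B) \sum_(c : C)
    let pabc := prob P [pred t | [&& fa t == a, fb t == b & fc t == c]] in
    let pac := prob P [pred t | (fa t == a) && (fc t == c)] in
    let pbc := prob P [pred t | (fb t == b) && (fc t == c)] in
    let pc := prob P [pred t | fc t == c] in
    if 0 < pabc then pabc * log2 (pabc * pc / (pac * pbc)) else 0.

Definition source_pmf {R : realType} {X Y Z : finType}
  (pXY : X * Y -> R) (pZ : X -> Z -> R) (s : X * Y * Z) : R :=
  pXY (s.1.1, s.1.2) * pZ s.1.1 s.2.

(* expected per-letter distortion of a block code of length n with helper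
   f1 : Y^n -> [M1], encoder f : X^n x [M1] -> [M], decoder
   g : [M] x [M1] x Z^n -> Xhat^n, under the i.i.d. source. *)
Definition expected_distortion {R : realType} {X Y Z Xh : finType}
  (pXY : X * Y -> R) (pZ : X -> Z -> R) (d : X -> Xh -> R) (n M1 M : nat)
  (f1 : {ffun 'I_n -> Y} -> 'I_M1)
  (f : {ffun 'I_n -> X} -> 'I_M1 -> 'I_M)
  (g : 'I_M -> 'I_M1 -> {ffun 'I_n -> Z} -> {ffun 'I_n -> Xh}) : R :=
  \sum_(w : {ffun 'I_n -> X * Y * Z})
    (\prod_(i < n) source_pmf pXY pZ (w i)) *
    (let xs := [ffun i => (w i).1.1] in
     let ys := [ffun i => (w i).1.2] in
     let zs := [ffun i => (w i).2] in
     let t1 := f1 ys in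
     let xh := g (f xs t1) t1 zs in
     n%:R^-1 * \sum_(i < n) d (xs i) (xh i)).

Definition achievable {R : realType} {X Y Z Xh : finType}
  (pXY : X * Y -> R) (pZ : X -> Z -> R) (d : X -> Xh -> R) (D Rr R1 : R) : Prop :=
  forall eps : R, 0 < eps -> exists N : nat, forall n : nat, (N <= n)%N ->
    exists (M1 M : nat), M1%:R <= powR 2 (n%:R * R1) /\ M%:R <= powR 2 (n%:R * Rr) /\
    exists (f1 : {ffun 'I_n -> Y} -> 'I_M1)
           (f : {ffun 'I_n -> X} -> 'I_M1 -> 'I_M)
           (g : 'I_M -> 'I_M1 -> {ffun 'I_n -> Z} -> {ffun 'I_n -> Xh}),
      expected_distortion pXY pZ d f1 f g <= D + eps.

Definition op_region {R : realType} {X Y Z Xh : finType}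
  (pXY : X * Y -> R) (pZ : X -> Z -> R) (d : X -> Xh -> R) (D : R) : set (R * R) :=
  closure [set p : R * R | achievable pXY pZ d D p.1 p.2].

Definition joint5 {R : realType} {X Y Z U W : finType}
  (pXY : X * Y -> R) (pZ : X -> Z -> R) (pU : Y -> U -> R) (pW : X * U -> W -> R)
  (o : X * Y * Z * U * W) : R :=
  pXY (o.1.1.1.1, o.1.1.1.2) * pZ o.1.1.1.1 o.1.1.2 * pU o.1.1.1.2 o.1.2
  * pW (o.1.1.1.1, o.1.2) o.2.

Definition sl_region {R : realType} {X Y Z Xh : finType}
  (pXY : X * Y -> R) (pZ : X -> Z -> R) (d : X -> Xh -> R) (D : R) : set (R * R) :=
  [set p | exists (U W : finType) (pU : Y -> U -> R) (pW : X * U -> W -> R)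
             (xhat : U -> W -> Z -> Xh),
     (forall y, is_pmf (pU y)) /\ (forall xu, is_pmf (pW xu)) /\
     let P := joint5 pXY pZ pU pW in
     let vX := fun o : X * Y * Z * U * W => o.1.1.1.1 in
     let vY := fun o : X * Y * Z * U * W => o.1.1.1.2 in
     let vZ := fun o : X * Y * Z * U * W => o.1.1.2 in
     let vU := fun o : X * Y * Z * U * W => o.1.2 in
     let vW := fun o : X * Y * Z * U * W => o.2 in
     condMI P vU vY vZ <= p.2 /\
     condMI P vX vW (fun o => (vU o, vZ o)) <= p.1 /\
     \sum_(o : X * Y * Z * U * W) P o * d (vX o) (xhat (vU o) (vW o) (vZ o)) <= D].

(* Main.v *)
Require Import Defs.
From HB Require Import structures.
From mathcomp Require Import all_boot all_order all_algebra.
From mathcomp Require Import all_classical all_reals all_analysis.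
Import Order.TTheory GRing.Theory Num.Theory.
Local Open Scope ring_scope.
Import numFieldTopology.Exports numFieldNormedType.Exports.
Local Open Scope classical_set_scope.
From mathcomp Require Import lra ring.
Set Implicit Arguments. Unset Strict Implicit. Unset Printing Implicit Defensive.

(** Achievability. Two random codes are used in succession, each made of an i.i.d. codebook and an
    independent random hash whose value is the transmitted message. The helper covers [Y^n] by a
    codeword [u] and sends its hash; the decoder recovers [u] from [Z^n], and so does the encoder
    from [X^n], because [Z] is a degraded version of [X]. The encoder then covers [X^n] by a
    codeword [w] given [u] and sends its hash. Instead of typicality and the Markov lemma, a
    codeword is called good when the conditional probability of every later failure is small.
    With information densities the one-shot bound yields the rates
    [I(U;Y) - I(U;Z) = I(U;Y|Z)] and [I(X;W|U,Z)], by Chebyshev's inequality.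

    Converse. With [U_i = (T1, X^{i-1}, Z^{n\i})] and a uniform time-sharing index, telescoping
    [H(T1 | (XYZ)^{i-1}, Z^n)] and [H(T | X^{i-1}, T1, Z^n)] bounds the two rates. [T] is replaced by
    the function [z |-> Xhat_i] of the missing letter [Z_i], so the alphabet of [W] is fixed.
    Reweighting the values of [U] leaves all constraints linear, hence [|Y| + 3] values suffice by
    Caratheodory's argument, and compactness of the kernels removes the [epsilon]. *)

(** The codeword chosen by the helper is not jointly i.i.d. with the source, yet it is an input of
    the second code. Hence the one-shot bound allows arbitrary nonnegative weights: it is applied to
    each helper codeword [v] separately, weighted by the source mass on which [v] is chosen.
    Failures are then charged back to the i.i.d. law by two applications of Markov's inequality;
    each divides by [eta], which is why failures under that law are required to be at most
    [eta ^+ 3].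

    In the converse the time-shared variables can violate the chain W - (X,U) - Y: given [T1], the
    later source letters, on which [T] depends, may be correlated with [Y_i]. But the two
    informations and the distortion only see the laws of (U,Y,Z) and of (X,W,U,Z), so it is enough
    to build a law of the required product form with these two marginals. *)

Section FiniteSums.
Variable R : realType.
Implicit Types T A B : finType.

Lemma sum_fibers T A (f : T -> A) (F : A -> T -> R) :
  \sum_a \sum_(t | f t == a) F a t = \sum_t F (f t) t.
Proof.
rewrite [RHS](partition_big f predT) //=.
by apply: eq_bigr => a _; apply: eq_bigr => t /eqP ->.
Qed.

Lemma sum_pair A B (F : A * B -> R) : \sum_q F q = \sum_a \sum_b F (a, b).
Proof. by rewrite pair_bigA; apply: eq_bigr => -[]. Qed.

Lemma prob_ge0 T (P : T -> R) (E : pred T) : (forall t, 0 <= P t) -> 0 <= prob P E.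
Proof. by move=> P0; apply: sumr_ge0. Qed.

Lemma eq_prob T (P : T -> R) (E F : pred T) : E =1 F -> prob P E = prob P F.
Proof. by move=> EF; apply: eq_bigl => t; apply: EF. Qed.

Lemma probE T (P : T -> R) (E : pred T) : prob P E = \sum_t P t * (E t)%:R.
Proof. by rewrite /prob big_mkcond; apply: eq_bigr => t _ /=; case: (E t); rewrite ?mulr1 ?mulr0. Qed.

Lemma le_prob T (P : T -> R) (E F : pred T) : (forall t, 0 <= P t) ->
  (forall t, 0 < P t -> E t -> F t) -> prob P E <= prob P F.
Proof.
move=> P0 EF; rewrite !probE; apply: ler_sum => t _.
have := P0 t; rewrite le_eqVlt => /orP[/eqP<-|Pt]; first by rewrite !mul0r.
rewrite ler_pM2l // ler_nat.
by move: (EF t Pt); case: (E t) (F t) => [|] [] // /(_ isT).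
Qed.

Lemma prob_self_gt0 T A (P : T -> R) (f : T -> A) t : (forall t, 0 <= P t) ->
  0 < P t -> 0 < prob P [pred t' | f t' == f t].
Proof.
move=> P0 Pt; apply: lt_le_trans Pt _.
rewrite /prob (bigD1 t) //= lerDl; exact: sumr_ge0.
Qed.

Lemma sum_prob_fiber T A (P : T -> R) (f : T -> A) :
  \sum_a prob P [pred t | f t == a] = \sum_t P t.
Proof. exact: (sum_fibers f (fun=> P)). Qed.

Lemma sum_prob_pair T A B (P : T -> R) (f : T -> A) (g : T -> B) b :
  \sum_a prob P [pred t | (f t == a) && (g t == b)] = prob P [pred t | g t == b].
Proof.
rewrite [RHS](partition_big f predT) //=.
by apply: eq_bigr => a _; apply: eq_bigl => t /=; rewrite andbC.
Qed.

Lemma ln_le_sub1 (x : R) : 0 < x -> ln x <= x - 1.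
Proof. by move=> x0; rewrite -{1}[x](subrKC 1) le_ln1Dx // ltrBDr addrC subrr. Qed.

(** The probabilistic method: this is how every random choice is made deterministic. With [f] zero
    it merely supplies an inhabitant of an alphabet that carries a pmf. *)
Lemma exists_le_average T (w f : T -> R) :
  (forall t, 0 <= w t) -> \sum_t w t = 1 -> exists t, f t <= \sum_t w t * f t.
Proof.
move=> w0 w1; apply/not_existsP => H.
have : \sum_t w t * (\sum_t w t * f t) < \sum_t w t * f t.
  have [t0 wt0] : exists t, 0 < w t.
    apply/not_existsP => H0; suff: \sum_t w t <= 0 by rewrite w1 ler10.
    by apply: sumr_le0 => t _; rewrite leNgt; apply/negP/H0.
  rewrite (bigD1 t0) //= [ltRHS](bigD1 t0) //= ltr_leD //.
    by rewrite ltr_pM2l // ltNge; apply/negP/H.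
  by apply: ler_sum => t _; rewrite ler_wpM2l // ltW // ltNge; apply/negP/H.
by rewrite -mulr_suml w1 mul1r ltxx.
Qed.

Lemma uniform_pmf (A : finType) : (0 < #|A|)%N -> is_pmf (fun _ : A => #|A|%:R^-1 : R).
Proof.
move=> A0; split=> [_|]; first by rewrite invr_ge0 ler0n.
by rewrite sumr_const -[LHS]mulr_natl divff // pnatr_eq0 -lt0n.
Qed.

End FiniteSums.

(** * Entropy *)

Section Entropy.
Variable R : realType.
Implicit Types T A B C : finType.

Definition xlnx (x : R) : R := x * ln x.

(* Minus the Shannon entropy, in nats, of the random variable [f]. *)
Definition negent T A (P : T -> R) (f : T -> A) : R :=
  \sum_(a : A) xlnx (prob P [pred t | f t == a]).

(** Entropy as an expectation over outcomes, so that entropies of different variables can be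
    compared outcome by outcome. *)
Lemma negentE T A (P : T -> R) (f : T -> A) :
  negent P f = \sum_t P t * ln (prob P [pred t' | f t' == f t]).
Proof.
rewrite -(sum_fibers f (fun a t => P t * ln (prob P [pred t' | f t' == a]))).
by apply: eq_bigr => a _; rewrite -mulr_suml.
Qed.

Lemma negent_congr T A B (P : T -> R) (f : T -> A) (g : T -> B) :
  (forall t t', (f t == f t') = (g t == g t')) -> negent P f = negent P g.
Proof.
move=> fg; rewrite !negentE; apply: eq_bigr => t _.
by congr (_ * ln _); apply: eq_prob => t' /=; rewrite fg.
Qed.

Lemma negent_mono T A B (P : T -> R) (f : T -> A) (g : T -> B) :
  (forall t, 0 <= P t) -> (forall t t', g t = g t' -> f t = f t') ->
  negent P g <= negent P f.
Proof.
move=> P0 gf; rewrite !negentE; apply: ler_sum => t _.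
have := P0 t; rewrite le_eqVlt => /orP[/eqP<-|Pt]; first by rewrite !mul0r.
rewrite ler_pM2l // ler_ln ?posrE ?prob_self_gt0 //.
by apply: le_prob => // t' _ /eqP /gf /eqP.
Qed.

(** [ln r <= r - 1] at the ratio of [q] to the law of [f]. The total masses are left free, whence
    the correction term. *)
Lemma gibbs T A (P : T -> R) (f : T -> A) (q : A -> R) :
  (forall t, 0 <= P t) -> (forall a, 0 <= q a) -> (forall t, 0 < P t -> 0 < q (f t)) ->
  \sum_t P t * ln (q (f t)) <= negent P f + (\sum_a q a - \sum_t P t).
Proof.
move=> P0 q0 qf; rewrite negentE.
pose p a := prob P [pred t' | f t' == a].
have p0 a : 0 <= p a by apply: prob_ge0.
rewrite -[leLHS]subr0 -lerBDl subr0.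
rewrite -sumrB.
apply: (@le_trans _ _ (\sum_t (P t * (q (f t) / p (f t)) - P t))).
  apply: ler_sum => t _.
  have := P0 t; rewrite le_eqVlt => /orP[/eqP<-|Pt]; first by rewrite !mul0r subrr.
  have pt : 0 < p (f t) by apply: prob_self_gt0.
  rewrite -mulrBr -[X in _ <= _ - X]mulr1 -mulrBr ler_pM2l //.
  rewrite -ln_div ?posrE ?qf //; apply: ln_le_sub1; apply: divr_gt0 => //; exact: qf.
rewrite sumrB lerD2r -(sum_fibers f (fun a t => P t * (q a / p a))).
apply: ler_sum => a _; rewrite -mulr_suml -/(prob P [pred t | f t == a]) -/(p a).
have [->|pa] := eqVneq (p a) 0; first by rewrite mul0r.
by rewrite mulrCA divff // mulr1.
Qed.

(** Gibbs' inequality against the uniform law on [A]. *)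
Lemma negent_ge_card T A (P : T -> R) (f : T -> A) : is_pmf P ->
  - ln (#|A|%:R) <= negent P f.
Proof.
move=> [P0 P1].
have [t0 _] := exists_le_average (fun=> 0) P0 P1.
have A0 : (0 < #|A|)%N by apply/card_gt0P; exists (f t0).
have := @gibbs T A P f (fun=> #|A|%:R^-1) P0.
rewrite -mulr_suml P1 mul1r sumr_const -[#|_|%:R^-1 *+ _]mulr_natr mulVf ?pnatr_eq0 -?lt0n //.
by rewrite subrr addr0 lnV ?posrE ?ltr0n //; apply => *; rewrite ?invr_ge0 ?invr_gt0 ?ltr0n.
Qed.

(** Gibbs' inequality against p(a,c) p(b,c) / p(c), the law that makes [f] and [g] independent given
    [h] and has the same total mass as [P]. *)
Lemma negent_submod T A B C (P : T -> R) (f : T -> A) (g : T -> B) (h : T -> C) :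
  (forall t, 0 <= P t) ->
  negent P (fun t => (f t, h t)) + negent P (fun t => (g t, h t)) <=
  negent P (fun t => (f t, g t, h t)) + negent P h.
Proof.
move=> P0.
pose pac a c := prob P [pred t | (f t, h t) == (a, c)].
pose pbc b c := prob P [pred t | (g t, h t) == (b, c)].
pose pc c := prob P [pred t | h t == c].
have pac0 a c : 0 <= pac a c by apply: prob_ge0.
have pbc0 b c : 0 <= pbc b c by apply: prob_ge0.
have pc0 c : 0 <= pc c by apply: prob_ge0.
pose q (s : A * B * C) := pac s.1.1 s.2 * pbc s.1.2 s.2 / pc s.2.
have := @gibbs _ _ P (fun t => (f t, g t, h t)) q P0.
have -> : \sum_s q s = \sum_t P t.
  rewrite -(sum_prob_fiber P h) -(pair_bigA _ (fun s c => q (s, c))) /= exchange_big /=.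
  apply: eq_bigr => c _.
  rewrite -(pair_bigA _ (fun a b => q (a, b, c))) /= /q /=.
  rewrite (eq_bigr (fun a => pac a c * (\sum_b pbc b c) / pc c)); last first.
    by move=> a _; rewrite mulr_sumr mulr_suml.
  rewrite -!mulr_suml.
  have -> : \sum_a pac a c = pc c.
    by rewrite /pc -(sum_prob_pair P f h); apply: eq_bigr => a _; apply: eq_prob => t.
  have -> : \sum_a pbc a c = pc c.
    by rewrite /pc -(sum_prob_pair P g h); apply: eq_bigr => a _; apply: eq_prob => t.
  rewrite -/(pc c); have [->|nz] := eqVneq (pc c) 0; first by rewrite !mul0r.
  by rewrite mulfK.
rewrite subrr addr0 => H.
rewrite -lerBlDr; apply: le_trans (H _ _); last 2 first.
- by move=> s; rewrite /q divr_ge0 ?mulr_ge0.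
- by move=> t Pt; rewrite /q divr_gt0 ?mulr_gt0 //; apply: prob_self_gt0.
rewrite !negentE -big_split -sumrB; apply: ler_sum => t _ /=.
have := P0 t; rewrite le_eqVlt => /orP[/eqP<-|Pt]; first by rewrite !mul0r addr0 subr0.
have h1 : 0 < pac (f t) (h t) by apply: (@prob_self_gt0 _ _ _ _ (fun t => (f t, h t))).
have h2 : 0 < pbc (g t) (h t) by apply: (@prob_self_gt0 _ _ _ _ (fun t => (g t, h t))).
have h3 : 0 < pc (h t) by apply: prob_self_gt0.
by rewrite -mulrDr -mulrBr ler_pM2l // /q /= ln_div ?lnM ?posrE ?mulr_gt0.
Qed.

Lemma ln2_gt0 : 0 < ln (2 : R).
Proof. by rewrite ln_gt0 // ltr1n. Qed.

(** Null events contribute zero on both sides, so the guard in [condMI] disappears. The factor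
    [ln 2] converts bits to nats; all later work is in nats. *)
Lemma condMI_sumE T A B C (P : T -> R) (f : T -> A) (g : T -> B) (h : T -> C) :
  (forall t, 0 <= P t) ->
  ln 2 * condMI P f g h = \sum_t P t *
    ln (prob P [pred s | (f s, g s, h s) == (f t, g t, h t)] * prob P [pred s | h s == h t] /
       (prob P [pred s | (f s, h s) == (f t, h t)] * prob P [pred s | (g s, h s) == (g t, h t)])).
Proof.
move=> P0; rewrite /condMI.
rewrite (eq_bigr (fun a => \sum_b \sum_c
  prob P [pred s | (f s, g s, h s) == (a, b, c)] *
  log2 (prob P [pred s | (f s, g s, h s) == (a, b, c)] * prob P [pred s | h s == c] /
       (prob P [pred s | (f s, h s) == (a, c)] * prob P [pred s | (g s, h s) == (b, c)])))).
  rewrite pair_bigA /= pair_bigA /= mulr_sumr.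
  rewrite -(sum_fibers (fun t => (f t, g t, h t)) (fun a t => P t *
    ln (prob P [pred s | (f s, g s, h s) == a] * prob P [pred s | h s == a.2] /
       (prob P [pred s | (f s, h s) == (a.1.1, a.2)] * prob P [pred s | (g s, h s) == (a.1.2, a.2)])))).
  apply: eq_bigr => -[[a b] c] _ /=; rewrite -mulr_suml /log2 mulrCA; congr (_ * _).
  by rewrite mulrCA divff ?mulr1 // gt_eqF // ln2_gt0.
move=> a _; apply: eq_bigr => b _; apply: eq_bigr => c _.
have E1 : prob P [pred t | [&& f t == a, g t == b & h t == c]] =
   prob P [pred s | (f s, g s, h s) == (a, b, c)].
  by apply: eq_prob => t /=; rewrite !xpair_eqE andbA.
have E2 : prob P [pred t | (f t == a) && (h t == c)] = prob P [pred s | (f s, h s) == (a, c)].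
  by apply: eq_prob => t /=; rewrite !xpair_eqE.
have E3 : prob P [pred t | (g t == b) && (h t == c)] = prob P [pred s | (g s, h s) == (b, c)].
  by apply: eq_prob => t /=; rewrite !xpair_eqE.
rewrite E1 E2 E3; case: ifPn => //; rewrite -leNgt => le0.
have := prob_ge0 [pred s | (f s, g s, h s) == (a, b, c)] P0.
by rewrite le_eqVlt => /orP[/eqP <-|]; rewrite ?mul0r // ltNge le0.
Qed.

Lemma condMI_negent T A B C (P : T -> R) (f : T -> A) (g : T -> B) (h : T -> C) :
  (forall t, 0 <= P t) ->
  ln 2 * condMI P f g h =
    negent P (fun t => (f t, g t, h t)) + negent P h
    - (negent P (fun t => (f t, h t)) + negent P (fun t => (g t, h t))).
Proof.
move=> P0; rewrite condMI_sumE // !negentE -!big_split -sumrB; apply: eq_bigr => t _ /=.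
have := P0 t; rewrite le_eqVlt => /orP[/eqP<-|Pt]; first by rewrite !mul0r addr0 subr0.
have h0 := prob_self_gt0 (fun t => (f t, g t, h t)) P0 Pt.
have h1 := prob_self_gt0 (fun t => (f t, h t)) P0 Pt.
have h2 := prob_self_gt0 (fun t => (g t, h t)) P0 Pt.
have h3 := prob_self_gt0 h P0 Pt.
by rewrite ln_div ?lnM ?posrE ?mulr_gt0 // -!mulrDr -mulrBr.
Qed.

Lemma condMI_ge0 T A B C (P : T -> R) (f : T -> A) (g : T -> B) (h : T -> C) :
  (forall t, 0 <= P t) -> 0 <= condMI P f g h.
Proof.
move=> P0; rewrite -(pmulr_rge0 _ ln2_gt0) condMI_negent // subr_ge0.
exact: negent_submod.
Qed.

End Entropy.

(** * Product measures *)

Section Product.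
Variable R : realType.
Variables I O : finType.
Implicit Types (p : O -> R) (t : {ffun I -> O}).

Definition iid p t : R := \prod_i p (t i).

Lemma iid_ge0 p t : (forall o, 0 <= p o) -> 0 <= iid p t.
Proof. by move=> p0; apply: prodr_ge0. Qed.

Lemma iid_expect_prod p (F : I -> O -> R) :
  \sum_t iid p t * \prod_i F i (t i) = \prod_i \sum_o p o * F i o.
Proof. by rewrite bigA_distr_bigA /=; apply: eq_bigr => t _; rewrite -big_split. Qed.

Lemma iid_pmf p : is_pmf p -> is_pmf (iid p).
Proof.
move=> [p0 p1]; split=> [t|]; first exact: iid_ge0.
rewrite -[RHS](@big1 _ 1 *%R I (index_enum I) predT (fun=> 1)) // -[X in _ = X](eq_bigr _ (fun _ _ => p1)).
by rewrite bigA_distr_bigA.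
Qed.

Lemma iid_expect2 p (i j : I) (phi psi : O -> R) : is_pmf p -> i != j ->
  \sum_t iid p t * (phi (t i) * psi (t j)) = (\sum_o p o * phi o) * (\sum_o p o * psi o).
Proof.
move=> [p0 p1] ij.
pose F k o := if k == i then phi o else if k == j then psi o else 1.
have E k : k != i -> k != j -> \sum_o p o * F k o = 1.
  by move=> /negPf ki /negPf kj; rewrite -[RHS]p1; apply: eq_bigr => o _; rewrite /F ki kj mulr1.
transitivity (\sum_t iid p t * \prod_k F k (t k)).
  apply: eq_bigr => t _; congr (_ * _).
  rewrite (bigD1 i) //= (bigD1 j) /=; last by rewrite eq_sym.
  rewrite big1 ?mulr1 => [|k /andP[/negPf ki /negPf kj]]; last by rewrite /F ki kj.
  by rewrite /F eqxx eq_sym (negPf ij) eqxx.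
rewrite iid_expect_prod (bigD1 i) //= (bigD1 j) /=; last by rewrite eq_sym.
rewrite [X in _ * (_ * X)]big1 ?mulr1 => [|k /andP[ki kj]]; last exact: E.
by rewrite /F eqxx eq_sym (negPf ij) eqxx.
Qed.

Lemma iid_expect1 p (i : I) (phi : O -> R) : is_pmf p ->
  \sum_t iid p t * phi (t i) = \sum_o p o * phi o.
Proof.
move=> [p0 p1].
pose F k o := if k == i then phi o else 1.
transitivity (\sum_t iid p t * \prod_k F k (t k)).
  apply: eq_bigr => t _; congr (_ * _).
  rewrite (bigD1 i) //= big1 ?mulr1 => [|k /negPf ki]; last by rewrite /F ki.
  by rewrite /F eqxx.
rewrite iid_expect_prod (bigD1 i) //= [X in _ * X]big1 ?mulr1 => [|k /negPf ki].
  by rewrite /F eqxx.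
by rewrite -[RHS]p1; apply: eq_bigr => o _; rewrite /F ki mulr1.
Qed.

(** The cross terms in the second moment of the centred sum vanish by pairwise independence;
    Markov's inequality is then applied to the square, outcome by outcome. *)
Lemma iid_chebyshev p (phi : O -> R) (m delta : R) : is_pmf p -> 0 < delta ->
  (0 < #|I|)%N -> \sum_o p o * phi o = m ->
  prob (iid p) [pred t : {ffun I -> O} | #|I|%:R * delta <= `|\sum_i phi (t i) - #|I|%:R * m| ] <=
    (\sum_o p o * (phi o - m) ^+ 2) / (#|I|%:R * delta ^+ 2).
Proof.
move=> pp d0 n0 Em; set n := #|I|%:R : R.
have n0' : 0 < n by rewrite ltr0n.
pose psi o := phi o - m.
have psi0 : \sum_o p o * psi o = 0.
  rewrite /psi; under eq_bigr do rewrite mulrBr.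
  by rewrite sumrB -mulr_suml pp.2 mul1r Em subrr.
set V := \sum_o p o * (phi o - m) ^+ 2.
have VS : \sum_t iid p t * (\sum_i psi (t i)) ^+ 2 = n * V.
  transitivity (\sum_i \sum_j \sum_t iid p t * (psi (t i) * psi (t j))).
    rewrite -[RHS](eq_bigr _ (fun _ _ => exchange_big _ _ _ _ _ _)) /= exchange_big /=.
    apply: eq_bigr => t _; rewrite expr2 mulr_suml mulr_sumr; apply: eq_bigr => i _.
    by rewrite mulr_sumr mulr_sumr.
  transitivity (\sum_(i : I) V); last by rewrite sumr_const -mulr_natl.
  apply: eq_bigr => i _; rewrite (bigD1 i) //= [X in _ + X]big1 ?addr0; last first.
    by move=> j ji; rewrite eq_sym in ji; rewrite (iid_expect2 psi psi pp ji) psi0 mulr0.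
  by rewrite /V -(iid_expect1 i (fun o => psi o ^+ 2) pp); apply: eq_bigr => t _; rewrite -expr2.
rewrite ler_pdivlMr ?mulr_gt0 ?exprn_gt0 // -(ler_pM2l n0') -VS probE mulr_suml mulr_sumr.
apply: ler_sum => t _ /=.
have -> : \sum_i phi (t i) - n * m = \sum_i psi (t i).
  by rewrite /psi sumrB sumr_const -[m *+ _]mulr_natl.
have it0 := iid_ge0 t pp.1.
case: (boolP (n * delta <= _)) => h; rewrite /=; last first.
  by rewrite mulr0 mul0r mulr0 mulr_ge0 // sqr_ge0.
rewrite mulr1.
rewrite mulrCA ler_wpM2l // mulrA -expr2 -exprMn -[leRHS]real_normK ?num_real //.
by rewrite lerXn2r ?nnegrE ?normr_ge0 ?mulr_ge0 ?(ltW d0) ?(ltW n0').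
Qed.

Definition upd t (i : I) (o : O) : {ffun I -> O} := [ffun j => if j == i then o else t j].

Lemma upd_same t i o : upd t i o i = o.
Proof. by rewrite ffunE eqxx. Qed.

(* Swapping the [i]-th letter with an independent copy preserves the joint law. *)
Lemma iid_resample p i (F : {ffun I -> O} -> R) : is_pmf p ->
  \sum_t \sum_o iid p t * p o * F (upd t i o) = \sum_t iid p t * F t.
Proof.
move=> [p0 p1].
pose s (q : {ffun I -> O} * O) := (upd q.1 i q.2, q.1 i).
have sK : involutive s.
  move=> [t o]; rewrite /s /= upd_same; congr (_, _); apply/ffunP => j.
  by rewrite !ffunE; case: eqP => // ->.
transitivity (\sum_t \sum_o iid p t * p o * F t); last first.
  by apply: eq_bigr => t _; rewrite -mulr_suml -mulr_sumr p1 mulr1.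
rewrite !pair_bigA /= [RHS](reindex_inj (inv_inj sK)) /=.
apply: eq_bigr => -[t o] _ /=; congr (_ * _).
rewrite /iid (bigD1 i) //= [in RHS](bigD1 i) //= upd_same mulrAC [p o * _ * _]mulrAC.
rewrite [p o * _]mulrC; congr (_ * _).
by apply: eq_bigr => j /negPf ji; rewrite ffunE ji.
Qed.

End Product.
Arguments iid_pmf {R I O p}.

(** * One-shot random coding *)

Section Binning.
Variable R : realType.
Variables S W T : finType.
Variables (nu : S -> T -> R) (Q : W -> R) (G : S -> pred W) (B : W -> T -> bool).
Variables (L M : nat) (c : R).
Hypothesis nu0 : forall s t, 0 <= nu s t.
Hypothesis pQ : is_pmf Q.
Hypothesis M0 : (0 < M)%N.
Hypothesis QB : forall t, \sum_(w | B w t) Q w <= c.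

(** The encoder observes [s] and looks for a codeword in [G s]; the decoder observes [t] and tests
    candidates with [B]. The bound [c] limits how often a fresh codeword passes the test. *)
Definition chosen (C : {ffun 'I_L -> W}) s : option W :=
  omap C [pick l | G s (C l)].

(** Codewords are compared as values and not as indices, so repeated entries of the codebook cause
    no confusion. *)
Definition confusable (C : {ffun 'I_L -> W}) (b : {ffun W -> 'I_M}) w t : bool :=
  [exists l, [&& C l != w, b (C l) == b w & B (C l) t]].

(** Average over an i.i.d. codebook. The event that no entry suits [s] factorizes over the entries;
    the expected number of entries passing the test at [t] is at most [L * c]. The factor [1 / M]
    anticipates the collision probability of a hash that is drawn afterwards. *)
Lemma exists_codebook : exists C : {ffun 'I_L -> W},
  \sum_s \sum_t nu s t * ((chosen C s == None)%:R + M%:R^-1 * \sum_l (B (C l) t)%:R)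
  <= \sum_s \sum_t nu s t * ((1 - \sum_(w | G s w) Q w) ^+ L + L%:R * c / M%:R).
Proof.
have [C HC] := exists_le_average (fun C : {ffun 'I_L -> W} =>
  \sum_s \sum_t nu s t * ((chosen C s == None)%:R + M%:R^-1 * \sum_l (B (C l) t)%:R))
  (iid_pmf pQ).1 (iid_pmf pQ).2.
exists C; apply: le_trans HC _.
under eq_bigr do rewrite mulr_sumr; rewrite exchange_big /=; apply: ler_sum => s _.
under eq_bigr do rewrite mulr_sumr; rewrite exchange_big /=; apply: ler_sum => t _.
under eq_bigr do rewrite mulrCA; rewrite -mulr_sumr ler_wpM2l //.
under [leLHS]eq_bigr do rewrite mulrDr; rewrite big_split /= lerD //.
  have -> : 1 - \sum_(w | G s w) Q w = \sum_w Q w * (~~ G s w)%:R.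
    rewrite -[X in X - _]pQ.2 (bigID (G s)) /= addrAC subrr add0r big_mkcond.
    by apply: eq_bigr => w _; case: (G s w); rewrite /= ?mulr0 ?mulr1.
  have -> : (\sum_w Q w * (~~ G s w)%:R) ^+ L = \prod_(l < L) \sum_w Q w * (~~ G s w)%:R.
    by rewrite prodr_const card_ord.
  rewrite -(iid_expect_prod Q (fun (_ : 'I_L) w => (~~ G s w)%:R)).
  apply: ler_sum => D _; rewrite ler_wpM2l ?(iid_pmf pQ).1 //.
  rewrite /chosen; case: pickP => [l Gl|noG] /=; first by apply: prodr_ge0 => i _; rewrite ler0n.
  by rewrite big1 // => i _; rewrite noG.
under eq_bigr do rewrite mulrCA mulr_sumr; rewrite -mulr_sumr mulrC ler_pM2r ?invr_gt0 ?ltr0n //.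
rewrite exchange_big /= mulr_natl -[X in _ *+ X]card_ord -sumr_const; apply: ler_sum => l _.
rewrite (iid_expect1 l (fun w => (B w t)%:R) pQ).
apply: le_trans (QB t); rewrite [leRHS]big_mkcond; apply: ler_sum => w _.
by case: (B w t); rewrite ?mulr1 ?mulr0.
Qed.

(** Split by the common value [k]: the hashes of two distinct codewords are independent and
    uniform. *)
Lemma uniform_collision (w w' : W) : w != w' ->
  \sum_(b : {ffun W -> 'I_M}) iid (fun=> M%:R^-1 : R) b * (b w == b w')%:R = M%:R^-1.
Proof.
move=> ww'.
have nzM : M%:R != 0 :> R by rewrite pnatr_eq0 -lt0n.
have pu : is_pmf (fun _ : 'I_M => M%:R^-1 : R).
  by have := @uniform_pmf R 'I_M; rewrite card_ord; apply.
transitivity (\sum_(k < M) \sum_(b : {ffun W -> 'I_M}) iid (fun=> M%:R^-1 : R) b *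
    ((b w == k)%:R * (b w' == k)%:R)).
  rewrite exchange_big; apply: eq_bigr => b _ /=; rewrite -mulr_sumr; congr (_ * _).
  rewrite (bigD1 (b w)) //= eqxx mul1r [b w' == _]eq_sym big1 ?addr0 // => k /negPf kn.
  by rewrite eq_sym kn mul0r.
under eq_bigr => k _ do rewrite (iid_expect2 (fun o => (o == k)%:R) (fun o => (o == k)%:R) pu ww').
have E (k : 'I_M) : \sum_(o : 'I_M) M%:R^-1 * (o == k)%:R = M%:R^-1 :> R.
  rewrite (bigD1 k) //= eqxx mulr1 big1 ?addr0 // => o /negPf ->; exact: mulr0.
by under eq_bigr do rewrite !E; rewrite sumr_const card_ord -[LHS]mulr_natl mulrA divff // mul1r.
Qed.

(* The hash [b] is independent of the codebook, hence of the chosen codeword: each other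
   codeword falls in the same bin with probability [1 / M]. *)
Lemma exists_binned_code : exists (C : {ffun 'I_L -> W}) (b : {ffun W -> 'I_M}),
  \sum_s \sum_t nu s t * (if chosen C s is Some w then (confusable C b w t)%:R else 1)
  <= \sum_s \sum_t nu s t * ((1 - \sum_(w | G s w) Q w) ^+ L + L%:R * c / M%:R).
Proof.
have [C HC] := exists_codebook; exists C.
have nzM : M%:R != 0 :> R by rewrite pnatr_eq0 -lt0n.
have pu : is_pmf (fun _ : 'I_M => M%:R^-1 : R).
  by have := @uniform_pmf R 'I_M; rewrite card_ord; apply.
have [b Hb] := exists_le_average (fun b : {ffun W -> 'I_M} =>
  \sum_s \sum_t nu s t * (if chosen C s is Some w then (confusable C b w t)%:R else 1))
  (iid_pmf pu).1 (iid_pmf pu).2.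
exists b; apply: le_trans Hb _; apply: le_trans HC.
under eq_bigr do rewrite mulr_sumr; rewrite exchange_big /=; apply: ler_sum => s _.
under eq_bigr do rewrite mulr_sumr; rewrite exchange_big /=; apply: ler_sum => t _.
under eq_bigr do rewrite mulrCA; rewrite -mulr_sumr ler_wpM2l //.
case: (chosen C s) => [w|] /=; last first.
  rewrite -mulr_suml (iid_pmf pu).2 mul1r lerDl mulr_ge0 ?invr_ge0 ?ler0n //.
  by apply: sumr_ge0 => l _; rewrite ler0n.
rewrite add0r.
(* Union bound over the entries different from [w]. *)
apply: (@le_trans _ _ (\sum_(b : {ffun W -> 'I_M}) \sum_l
    (C l != w)%:R * (B (C l) t)%:R * (iid (fun=> M%:R^-1 : R) b * (b (C l) == b w)%:R))).
  apply: ler_sum => b' _.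
  have -> : \sum_l (C l != w)%:R * (B (C l) t)%:R * (iid (fun=> M%:R^-1 : R) b' * (b' (C l) == b' w)%:R)
    = iid (fun=> M%:R^-1) b' * \sum_l ((C l != w) && (b' (C l) == b' w) && B (C l) t)%:R.
    rewrite mulr_sumr; apply: eq_bigr => l _; rewrite mulrCA; congr (_ * _).
    by rewrite -!mulnb !natrM mulrAC.
  rewrite ler_wpM2l ?(iid_pmf pu).1 // /confusable.
  case: existsP => [[l Hl]|_]; last by apply: sumr_ge0 => l _; rewrite ler0n.
  rewrite (bigD1 l) //= -andbA Hl lerDl; apply: sumr_ge0 => k _; exact: ler0n.
rewrite exchange_big mulr_sumr; apply: ler_sum => l _ /=; rewrite -mulr_sumr.
have [->|nw] := eqVneq (C l) w.
  by rewrite !mul0r mulr_ge0 ?invr_ge0 ?ler0n.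
by rewrite uniform_collision // mul1r mulrC.
Qed.

End Binning.

(** Change of measure from [k] to [Q]. If the complement of [G] has [k]-mass at least 1/2, the first
    term already exceeds 1. Otherwise [G] has [k]-mass above 1/2, hence [Q]-mass above
    [1 / (2 * a)], and [1 - q <= expR (- q)] applies. *)
Lemma covering_bound (R : realType) (W : finType) (Q k : W -> R) (G : pred W) (a : R) (L : nat) :
  is_pmf Q -> is_pmf k -> 0 < a -> (forall w, G w -> k w <= a * Q w) ->
  (1 - \sum_(w | G w) Q w) ^+ L <= 2 * (\sum_(w | ~~ G w) k w) + expR (- (L%:R / (2 * a))).
Proof.
move=> pQ pk a0 kQ.
set q := \sum_(w | G w) Q w; set kc := \sum_(w | ~~ G w) k w.
have kc0 : 0 <= kc by apply: sumr_ge0 => w _; apply: pk.1.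
have k1 : \sum_(w | G w) k w = 1 - kc by rewrite -pk.2 [X in _ = X - _](bigID G) /= addrK.
have q1 : q <= 1.
  rewrite -pQ.2 [leRHS](bigID G) /= lerDl; apply: sumr_ge0 => w _; exact: pQ.1.
have kq : 1 - kc <= a * q.
  by rewrite -k1 mulr_sumr; apply: ler_sum => w Gw; apply: kQ.
have q0 : 0 <= q by apply: sumr_ge0 => w _; apply: pQ.1.
have [big|small] := lerP (1 / 2) kc.
  apply: (@le_trans _ _ 1).
    by rewrite exprn_ile1 ?subr_ge0 // lerBlDr lerDl.
  by have := expR_gt0 (- (L%:R / (2 * a))); lra.
apply: (@le_trans _ _ (expR (- q) ^+ L)).
  by rewrite lerXn2r ?nnegrE ?expR_ge0 ?subr_ge0 // expR_ge1Dx.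
rewrite -expRM_natl -[leLHS]add0r lerD ?mulr_ge0 // ler_expR mulrN lerN2.
rewrite ler_pdivrMr ?mulr_gt0 // -mulrA ler_peMr ?ler0n //; nra.
Qed.

(** * Two-stage coding: the helper's code followed by the encoder's code *)

Section TwoStage.
Variable R : realType.
Variables X Y Z U W : finType.
Variables (pXY : X * Y -> R) (pZ : X -> Z -> R) (pU : Y -> U -> R) (pW : X * U -> W -> R).
Hypothesis hXY : is_pmf pXY.
Hypothesis hZ : forall x, is_pmf (pZ x).
Hypothesis hU : forall y, is_pmf (pU y).
Hypothesis hW : forall xu, is_pmf (pW xu).

Lemma joint5_expect (F : X -> Y -> Z -> U -> W -> R) :
  \sum_o joint5 pXY pZ pU pW o * F o.1.1.1.1 o.1.1.1.2 o.1.1.2 o.1.2 o.2 =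
  \sum_y \sum_x pXY (x, y) * \sum_u pU y u * \sum_w pW (x, u) w * \sum_z pZ x z * F x y z u w.
Proof.
rewrite !sum_pair.
rewrite /= exchange_big /=; apply: eq_bigr => y _; apply: eq_bigr => x _.
rewrite exchange_big mulr_sumr; apply: eq_bigr => u _.
rewrite exchange_big mulr_sumr mulr_sumr; apply: eq_bigr => w _.
rewrite !mulr_sumr; apply: eq_bigr => z _; rewrite /joint5 /=; ring.
Qed.

Lemma joint5_ge0 o : 0 <= joint5 pXY pZ pU pW o.
Proof. by rewrite !mulr_ge0 ?hXY.1 ?(hZ _).1 ?(hU _).1 ?(hW _).1. Qed.

Lemma joint5_pmf : is_pmf (joint5 pXY pZ pU pW).
Proof.
split=> [q|]; first exact: joint5_ge0.
have := joint5_expect (fun _ _ _ _ _ => 1); under eq_bigr do rewrite mulr1.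
move=> E; rewrite E -[RHS]hXY.2 [RHS]sum_pair [RHS]exchange_big /=.
apply: eq_bigr => y _; apply: eq_bigr => x _.
rewrite -[RHS]mulr1; congr (_ * _); rewrite -[RHS](hU y).2; apply: eq_bigr => u _.
rewrite -[RHS]mulr1; congr (_ * _); rewrite -[RHS](hW (x, u)).2; apply: eq_bigr => w _.
rewrite -[RHS]mulr1; congr (_ * _); rewrite -[RHS](hZ x).2; apply: eq_bigr => z _.
by rewrite mulr1.
Qed.

Variables (QU : U -> R) (QW : W -> R).
Hypothesis hQU : is_pmf QU.
Hypothesis hQW : is_pmf QW.
Variables (E1 : Y -> U -> bool) (B1 : U -> Z -> bool) (E2 : X -> U -> W -> bool)
  (B2 : U -> W -> Z -> bool) (Gd : X -> U -> W -> Z -> bool).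
Variables (a1 a2 c1 c2 eta : R) (L1 M1 L2 M2 : nat).
Hypothesis a10 : 0 < a1.
Hypothesis a20 : 0 < a2.
Hypothesis eta0 : 0 < eta.
Hypothesis M10 : (0 < M1)%N.
Hypothesis M20 : (0 < M2)%N.
Hypothesis hE1 : forall y u, E1 y u -> pU y u <= a1 * QU u.
Hypothesis hE2 : forall x u w, E2 x u w -> pW (x, u) w <= a2 * QW w.
Hypothesis hB1 : forall z, \sum_(u | B1 u z) QU u <= c1.
Hypothesis hB2 : forall u z, \sum_(w | B2 u w z) QW w <= c2.

(** Failure probabilities of the decoder's tests as seen from [x]. By the chain Y - X - Z the
    helper's observation does not enter them. *)
Let miss1 x u := \sum_z pZ x z * (~~ B1 u z)%:R.
Let miss2 x u w := \sum_z pZ x z * (~~ (B2 u w z && Gd x u w z))%:R.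
(* The encoder sees [x] only; it accepts [u] when the decoder's test would pass for most [z].
   As [Z] is a degraded version of [X], this costs only constant factors. *)
Let BX u x := miss1 x u < 1 / 2.
Let G2 u x w := E2 x u w && (miss2 x u w <= eta).
Let gam x u := \sum_(w | ~~ G2 u x w) pW (x, u) w.
(** Cost of using [u] when the source word is [x]. Of the three units of [miss1], two bound by
    Markov's inequality the rejection of [u] by [BX] and one is its rejection by the decoder;
    [2 * gam] is the leading term of [covering_bound] in the second stage. *)
Let pen x u := 3 * miss1 x u + 2 * gam x u.
Let G1 y u := E1 y u && (\sum_x pXY (x, y) * pen x u <= eta * \sum_x pXY (x, y)).

Let miss1_ge0 x u : 0 <= miss1 x u.
Proof. by apply: sumr_ge0 => z _; rewrite mulr_ge0 ?(hZ _).1 ?ler0n. Qed.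

Let miss2_ge0 x u w : 0 <= miss2 x u w.
Proof. by apply: sumr_ge0 => z _; rewrite mulr_ge0 ?(hZ _).1 ?ler0n. Qed.

Let gam_ge0 x u : 0 <= gam x u.
Proof. by apply: sumr_ge0 => w _; apply: (hW _).1. Qed.

Let pen_ge0 x u : 0 <= pen x u.
Proof. by rewrite addr_ge0 ?mulr_ge0. Qed.

(** Encoder and decoder must both resolve the helper's hash. The disjunction of their tests lets one
    bound on confusable codewords serve both. *)
Let joint_test u (t : X * Z) := BX u t.1 || B1 u t.2.

(** If [BX u x] holds, the decoder's test accepts [u] for more than half of the mass of [pZ x], so
    the indicator is at most twice the acceptance probability. This gives [2 * c1], and the
    decoder's own test adds [c1]. *)
Let joint_testP t : \sum_(u | joint_test u t) QU u <= 3 * c1.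
Proof.
case: t => x z.
apply: (@le_trans _ _ (\sum_u (QU u * (2 * \sum_z' pZ x z' * (B1 u z')%:R) + QU u * (B1 u z)%:R))).
  rewrite big_mkcond; apply: ler_sum => u _; rewrite /joint_test /=.
  have s0 : 0 <= \sum_z' pZ x z' * (B1 u z')%:R.
    by apply: sumr_ge0 => z' _; rewrite mulr_ge0 ?(hZ _).1 ?ler0n.
  have sE : \sum_z' pZ x z' * (B1 u z')%:R = 1 - miss1 x u.
    rewrite -[X in X - _](hZ x).2 -sumrB; apply: eq_bigr => z' _.
    by case: (B1 u z'); rewrite /= ?mulr1 ?mulr0 ?subrr ?subr0.
  have Qu := hQU.1 u.
  rewrite -mulrDr; case: ifP => [/orP[|->]|_]; last 2 first.
  - by rewrite ler_peMr // lerDr mulr_ge0.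
  - by rewrite mulr_ge0 // addr_ge0 ?ler0n // mulr_ge0.
  rewrite /BX => b; rewrite ler_peMr // sE.
  have : 0 <= (B1 u z)%:R :> R by exact: ler0n.
  lra.
rewrite big_split /= (_ : 3 * c1 = 2 * c1 + c1); last by ring.
apply: lerD; last first.
  apply: le_trans (hB1 z); rewrite [leRHS]big_mkcond; apply: ler_sum => u _.
  by case: (B1 u z); rewrite ?mulr1 ?mulr0.
rewrite (eq_bigr (fun u => 2 * \sum_z' pZ x z' * (QU u * (B1 u z')%:R))); last first.
  by move=> u _; rewrite mulrCA; congr (_ * _); rewrite mulr_sumr; apply: eq_bigr => z' _; rewrite mulrCA.
rewrite -mulr_sumr ler_pM2l // exchange_big /= -[leRHS]mul1r -[X in _ <= X * _](hZ x).2 mulr_suml.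
apply: ler_sum => z' _; rewrite -mulr_sumr ler_wpM2l ?(hZ x).1 //.
apply: le_trans (hB1 z'); rewrite [leRHS]big_mkcond; apply: ler_sum => u _.
by case: (B1 u z'); rewrite ?mulr1 ?mulr0.
Qed.

(* Markov's inequality, once for [G2] and once for [G1]. *)
Let badG1 :
  \sum_y \sum_x pXY (x, y) * \sum_(u | ~~ G1 y u) pU y u <=
  prob (joint5 pXY pZ pU pW) [pred o | ~~ E1 o.1.1.1.2 o.1.2] +
  eta^-1 * (3 * prob (joint5 pXY pZ pU pW) [pred o | ~~ B1 o.1.2 o.1.1.2] +
            2 * (prob (joint5 pXY pZ pU pW) [pred o | ~~ E2 o.1.1.1.1 o.1.2 o.2] +
    eta^-1 * prob (joint5 pXY pZ pU pW)
      [pred o | ~~ (B2 o.1.2 o.2 o.1.1.2 && Gd o.1.1.1.1 o.1.2 o.2 o.1.1.2)])).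
Proof.
rewrite !probE /=.
rewrite (joint5_expect (fun x y z u w => (~~ E1 y u)%:R)).
rewrite (joint5_expect (fun x y z u w => (~~ B1 u z)%:R)).
rewrite (joint5_expect (fun x y z u w => (~~ E2 x u w)%:R)).
rewrite (joint5_expect (fun x y z u w => (~~ (B2 u w z && Gd x u w z))%:R)).
rewrite !mulrDr !mulr_sumr -!big_split; apply: ler_sum => y _ /=.
rewrite !mulr_sumr -!big_split /=.
have p0 x : 0 <= pXY (x, y) := hXY.1 _.
apply: (@le_trans _ _ (\sum_x (pXY (x, y) * \sum_u pU y u * (~~ E1 y u)%:R +
   eta^-1 * (pXY (x, y) * \sum_u pU y u * pen x u)))).
  rewrite big_split /= -mulr_sumr.
  have -> : \sum_x pXY (x, y) * (\sum_u pU y u * pen x u) =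
     \sum_u pU y u * \sum_x pXY (x, y) * pen x u.
    under eq_bigr do rewrite mulr_sumr; rewrite exchange_big; apply: eq_bigr => u _ /=.
    by rewrite mulr_sumr; apply: eq_bigr => x _; rewrite mulrCA.
  rewrite -!mulr_suml [leLHS]mulr_sumr [X in _ <= X + _]mulr_sumr [X in _ <= _ + X]mulr_sumr -big_split /=.
  rewrite big_mkcond; apply: ler_sum => u _.
  have u0 := (hU y).1 u.
  have s0 : 0 <= \sum_x pXY (x, y) by apply: sumr_ge0.
  have t0 : 0 <= \sum_x pXY (x, y) * pen x u by apply: sumr_ge0 => x _; rewrite mulr_ge0.
  have r0 : 0 <= eta^-1 * (pU y u * \sum_x pXY (x, y) * pen x u).
    by apply: mulr_ge0; [rewrite invr_ge0 ltW | apply: mulr_ge0].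
  case: ifP => [|_]; last by rewrite addr_ge0 // mulr_ge0 // mulr_ge0 // ler0n.
  rewrite negb_and => /orP[->|]; first by rewrite mulr1 lerDl.
  rewrite -ltNge => h; rewrite -[leLHS]add0r; apply: lerD; first by rewrite !mulr_ge0 ?ler0n.
  rewrite mulrC mulrCA ler_wpM2l // mulrC ler_pdivlMr // mulrC; exact: ltW.
apply: ler_sum => x _.
have e0 : 0 <= eta^-1 by rewrite invr_ge0 ltW.
rewrite [leRHS](_ : _ = pXY (x, y) * \sum_u (pU y u * \sum_w pW (x, u) w * \sum_z pZ x z *
   ((~~ E1 y u)%:R + eta^-1 * (3 * (~~ B1 u z)%:R + 2 * ((~~ E2 x u w)%:R +
     eta^-1 * (~~ (B2 u w z && Gd x u w z))%:R))))); last first.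
  rewrite !mulr_sumr -!big_split /=; apply: eq_bigr => u _.
  rewrite !mulr_sumr -!big_split /=; apply: eq_bigr => w _.
  rewrite !mulr_sumr -!big_split /=; apply: eq_bigr => z _; ring.
rewrite mulrCA -mulrDr ler_wpM2l // mulr_sumr -big_split /=; apply: ler_sum => u _.
rewrite mulrCA -mulrDr ler_wpM2l ?(hU y).1 //.
rewrite [leRHS](_ : _ = (~~ E1 y u)%:R + eta^-1 * (3 * miss1 x u +
   2 * \sum_w pW (x, u) w * ((~~ E2 x u w)%:R + eta^-1 * miss2 x u w))); last first.
  transitivity (\sum_w pW (x, u) w * ((~~ E1 y u)%:R + eta^-1 * (3 * miss1 x u +
     2 * ((~~ E2 x u w)%:R + eta^-1 * miss2 x u w)))).
    apply: eq_bigr => w _; congr (_ * _).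
    transitivity (\sum_z (pZ x z * ((~~ E1 y u)%:R + eta^-1 * (2 * (~~ E2 x u w)%:R)) +
      (eta^-1 * 3 * (pZ x z * (~~ B1 u z)%:R) + eta^-1 * 2 * eta^-1 *
       (pZ x z * (~~ (B2 u w z && Gd x u w z))%:R)))).
      by apply: eq_bigr => z _; ring.
    rewrite big_split /= -mulr_suml (hZ x).2 big_split /= -!mulr_sumr /miss1 /miss2; ring.
  transitivity (\sum_w (pW (x, u) w * ((~~ E1 y u)%:R + eta^-1 * (3 * miss1 x u)) +
     eta^-1 * 2 * (pW (x, u) w * ((~~ E2 x u w)%:R + eta^-1 * miss2 x u w)))).
    by apply: eq_bigr => w _; ring.
  rewrite big_split /= -mulr_suml (hW _).2 -mulr_sumr; ring.
rewrite lerD2l ler_wpM2l // lerD2l ler_pM2l // /gam big_mkcond; apply: ler_sum => w _.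
have w0 := (hW (x, u)).1 w.
have m0 : 0 <= eta^-1 * miss2 x u w by rewrite mulr_ge0.
case: ifP => [|_]; last by rewrite mulr_ge0 // addr_ge0 ?ler0n.
rewrite negb_and => h; rewrite ler_peMr //; case/orP: h => [->|]; first by rewrite lerDl.
rewrite -ltNge => h; rewrite -[leLHS]add0r lerD ?ler0n //.
by rewrite mulrC ler_pdivlMr // mul1r ltW.
Qed.

Hypothesis c20 : 0 <= c2.
Hypothesis eta1 : eta <= 1.
Hypothesis small_E1 : prob (joint5 pXY pZ pU pW) [pred o | ~~ E1 o.1.1.1.2 o.1.2] <= eta ^+ 3.
Hypothesis small_B1 : prob (joint5 pXY pZ pU pW) [pred o | ~~ B1 o.1.2 o.1.1.2] <= eta ^+ 3.
Hypothesis small_E2 :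
  prob (joint5 pXY pZ pU pW) [pred o | ~~ E2 o.1.1.1.1 o.1.2 o.2] <= eta ^+ 3.
Hypothesis small_B2 : prob (joint5 pXY pZ pU pW)
  [pred o | ~~ (B2 o.1.2 o.2 o.1.1.2 && Gd o.1.1.1.1 o.1.2 o.2 o.1.1.2)] <= eta ^+ 3.

(** After the two divisions by [eta] the bound is eta^3 + 5 eta^2 + 2 eta, and [eta <= 1]. *)
Let badG1_eta : \sum_y \sum_x pXY (x, y) * \sum_(u | ~~ G1 y u) pU y u <= 8 * eta.
Proof.
apply: le_trans badG1 _.
have i0 : 0 < eta^-1 by rewrite invr_gt0.
have ie : eta^-1 * eta ^+ 3 = eta ^+ 2 by rewrite exprS mulrA mulVf ?mul1r ?gt_eqF.
have ie2 : eta^-1 * eta ^+ 2 = eta by rewrite exprS mulrA mulVf ?mul1r ?gt_eqF.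
apply: (@le_trans _ _ (eta ^+ 3 + eta^-1 * (3 * eta ^+ 3 + 2 * (eta ^+ 3 + eta^-1 * eta ^+ 3)))).
  apply: lerD => //; rewrite ler_pM2l //; apply: lerD; first by rewrite ler_pM2l.
  by rewrite ler_pM2l //; apply: lerD => //; rewrite ler_pM2l.
rewrite ie (_ : eta^-1 * _ = 3 * (eta^-1 * eta ^+ 3) + 2 * (eta^-1 * eta ^+ 3 + eta^-1 * eta ^+ 2));
  last by ring.
rewrite ie ie2; have e2 : eta ^+ 2 <= eta by rewrite expr2 ler_piMr // ltW.
have e3 : eta ^+ 3 <= eta by rewrite exprS ler_piMr ?(ltW eta0) // (le_trans e2).
lra.
Qed.

Let decode (A V : finType) (L M : nat) (C : {ffun 'I_L -> V}) (b : {ffun V -> 'I_M})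
    (T : A -> V -> bool) (m : 'I_M) (s : A) : option V :=
  [pick v | [&& [exists l, C l == v], b v == m & T s v]].

(** The transmitted codeword is a candidate, and any other candidate would witness confusability.
    The decoding test [T] only has to imply [B], so that the encoder and the decoder can both be
    measured against [joint_test]. *)
Let decode_unique (A V A' : finType) (L M : nat) (C : {ffun 'I_L -> V}) (b : {ffun V -> 'I_M})
    (T : A -> V -> bool) (s : A) (v : V) (B : V -> A' -> bool) (t : A') :
  (exists l, C l = v) -> T s v -> ~~ confusable B C b v t ->
  (forall v', T s v' -> B v' t) -> decode C b T (b v) s = Some v.
Proof.
move=> [l Cl] Tv nconf TB; rewrite /decode; case: pickP => [v'|/(_ v)]; last first.
  by rewrite eqxx Tv /= andbT => /negbT/negP[]; apply/existsP; exists l; rewrite Cl.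
move=> /and3P[/existsP[l' /eqP Cl'] bv' Tv']; congr Some.
apply/eqP; move: nconf; apply: contraNT => nv; apply/existsP; exists l'.
by rewrite Cl' nv bv' TB.
Qed.

Let chosenP (A V : finType) (G : A -> pred V) (L : nat) (C : {ffun 'I_L -> V}) s v :
  chosen G C s = Some v -> G s v /\ exists l, C l = v.
Proof. by rewrite /chosen; case: pickP => //= l Gl [<-]; split=> //; exists l. Qed.

Let opt_sum (s : option U) (h : U -> R) :
  (if s is Some u then h u else 0) = \sum_v (s == Some v)%:R * h v.
Proof.
case: s => [u|]; last by rewrite big1 // => v _; rewrite mul0r.
rewrite (bigD1 u) //= eqxx mul1r big1 ?addr0 // => v /negPf vu.
by rewrite (inj_eq Some_inj) eq_sym vu mul0r.
Qed.

(** Of the 18 units of [eta], 16 come from the helper's covering (twice the 8 of [badG1_eta]), one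
    from the averaged penalty in [G1], and one from the bound on [miss2] in [G2]. *)
Theorem two_stage_code : exists (f1 : Y -> 'I_M1) (f : X -> 'I_M1 -> 'I_M2)
    (g : 'I_M2 -> 'I_M1 -> Z -> U * W),
  \sum_y \sum_x \sum_z pXY (x, y) * pZ x z *
     (let uw := g (f x (f1 y)) (f1 y) z in ~~ Gd x uw.1 uw.2 z)%:R <=
  18 * eta + expR (- (L1%:R / (2 * a1))) + L1%:R * (3 * c1) / M1%:R
           + expR (- (L2%:R / (2 * a2))) + L2%:R * c2 / M2%:R.
Proof.
have [u0 _] := exists_le_average (fun=> 0) hQU.1 hQU.2.
have [w0 _] := exists_le_average (fun=> 0) hQW.1 hQW.2.
pose nu1 y (t : X * Z) := pXY (t.1, y) * pZ t.1 t.2.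
have nu10 y t : 0 <= nu1 y t by rewrite mulr_ge0 ?hXY.1 ?(hZ _).1.
have [C1 [b1 H1]] := @exists_binned_code R Y U (X * Z)%type nu1 QU G1 joint_test L1 M1 (3 * c1)
  nu10 hQU M10 joint_testP.
pose ch := chosen G1 C1.
(* Unnormalized law of the source word on the event that the helper chooses [v]; the second code is
   selected for each [v] under this weight. *)
pose q v x := \sum_y (ch y == Some v)%:R * pXY (x, y).
have q0 v x : 0 <= q v x by apply: sumr_ge0 => y _; rewrite mulr_ge0 ?ler0n ?hXY.1.
have nu20 v x z : 0 <= q v x * pZ x z by rewrite mulr_ge0 ?(hZ _).1.
have /choice[CB H2] : forall v, exists cb : {ffun 'I_L2 -> W} * {ffun W -> 'I_M2},
    \sum_x \sum_z q v x * pZ x z *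
      (if chosen (G2 v) cb.1 x is Some w then (confusable (B2 v) cb.1 cb.2 w z)%:R else 1)
    <= \sum_x \sum_z q v x * pZ x z * ((1 - \sum_(w | G2 v x w) QW w) ^+ L2 + L2%:R * c2 / M2%:R).
  move=> v.
  have [C [b H]] := @exists_binned_code R X W Z (fun x z => q v x * pZ x z) QW (G2 v) (B2 v) L2 M2 c2
    (nu20 v) hQW M20 (hB2 v).
  by exists (C, b).
pose ch2 v x := chosen (G2 v) (CB v).1 x.
(* The default messages are harmless: the events on which they are sent are counted as failures
   below. *)
pose f1 y : 'I_M1 := if ch y is Some u then b1 u else Ordinal M10.
pose decX := decode C1 b1 (fun x u => BX u x).
pose decZ := decode C1 b1 (fun z u => B1 u z).
pose f x t1 : 'I_M2 := if decX t1 x is Some u then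
  if ch2 u x is Some w then (CB u).2 w else Ordinal M20 else Ordinal M20.
pose g t t1 z : U * W := if decZ t1 z is Some u then
  (u, odflt w0 (decode (CB u).1 (CB u).2 (fun z w => B2 u w z) t z)) else (u0, w0).
(* Failure budget: [F1] and [F2] for a missing or confusable codeword in each stage, [F3] for the
   correct codewords being rejected by a test or giving a bad reconstruction. *)
pose F1 y x z : R := if ch y is Some w then (confusable joint_test C1 b1 w (x, z))%:R else 1.
pose F2 v x z : R :=
  if ch2 v x is Some w then (confusable (B2 v) (CB v).1 (CB v).2 w z)%:R else 1.
pose F3 v x z : R := (~~ BX v x)%:R + (~~ B1 v z)%:R +
  (if ch2 v x is Some w then (~~ (B2 v w z && Gd x v w z))%:R else 0).
have F20 v x z : 0 <= F2 v x z by rewrite /F2; case: (ch2 v x) => [w|]; rewrite ?ler0n.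
have F30 v x z : 0 <= F3 v x z.
  by rewrite /F3; case: (ch2 v x) => [w|]; rewrite ?addr_ge0 ?ler0n.
exists f1, f, g.
have pointwise y x z :
   (let uw := g (f x (f1 y)) (f1 y) z in ~~ Gd x uw.1 uw.2 z)%:R <=
   F1 y x z + (if ch y is Some u then F2 u x z + F3 u x z else 0).
  rewrite /F1; case Ech: (ch y) => [u|]; last by rewrite addr0; case: (~~ _); rewrite ?ler01.
  have [_ Cu] := chosenP Ech.
  have [conf|nconf] := boolP (confusable joint_test C1 b1 u (x, z)).
    apply: (@le_trans _ _ 1); last by rewrite lerDl addr_ge0.
    by case: (~~ _); rewrite ?ler01.
  rewrite add0r.
  have [bx|] := boolP (BX u x); last first.
    move=> nbx; apply: (@le_trans _ _ 1); first by case: (~~ _); rewrite ?ler01.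
    rewrite /F3 nbx; case: (ch2 u x) => [w|]; rewrite -[leLHS]add0r lerD // -?addrA lerDl ?addr_ge0 ?ler0n //.
  have [bz|] := boolP (B1 u z); last first.
    move=> nbx; apply: (@le_trans _ _ 1); first by case: (~~ _); rewrite ?ler01.
    rewrite /F3 nbx [_ + 1]addrC; case: (ch2 u x) => [w|];
      rewrite -[leLHS]add0r lerD // -?addrA lerDl ?addr_ge0 ?ler0n //.
  have f1E : f1 y = b1 u by rewrite /f1 Ech.
  have dX : decX (f1 y) x = Some u.
    rewrite f1E; apply: (@decode_unique _ _ _ _ _ _ _ (fun x u => BX u x) x u joint_test (x, z)) => //.
    by move=> v' h; rewrite /joint_test h.
  have dZ : decZ (f1 y) z = Some u.
    rewrite f1E; apply: (@decode_unique _ _ _ _ _ _ _ (fun z u => B1 u z) z u joint_test (x, z)) => //.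
    by move=> v' h; rewrite /joint_test /= h orbT.
  rewrite /f dX /g dZ /= /F2 /F3; case Ech2 : (ch2 u x) => [w|]; last first.
    rewrite -[leLHS]addr0; apply: lerD; last by rewrite !addr_ge0 ?ler0n.
    by case: (~~ _); rewrite ?ler01.
  have [_ Cw] := chosenP Ech2.
  have [conf2|nconf2] := boolP (confusable (B2 u) (CB u).1 (CB u).2 w z).
    rewrite -[leLHS]addr0; apply: lerD; last by rewrite !addr_ge0 ?ler0n.
    by case: (~~ _); rewrite ?ler01.
  have [bb|nbb] := boolP (B2 u w z && _); last first.
    rewrite add0r -[leLHS]add0r; apply: lerD; first by rewrite addr_ge0 ?ler0n.
    by case: (~~ _); rewrite ?ler01.
  have [bw gd] := andP bb.
  rewrite (@decode_unique _ _ _ _ _ _ _ (fun z w => B2 u w z) z w (B2 u) z) //= gd.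
  by rewrite !addr_ge0 ?ler0n.
pose K2 := expR (- (L2%:R / (2 * a2))) + L2%:R * c2 / M2%:R.
have K20 : 0 <= K2 by rewrite addr_ge0 ?expR_ge0 // divr_ge0 ?mulr_ge0 ?ler0n.
have sumXY : \sum_y \sum_x pXY (x, y) = 1 by rewrite -[RHS]hXY.2 [RHS]sum_pair exchange_big.
have partA : \sum_y \sum_x \sum_z pXY (x, y) * pZ x z * F1 y x z <=
   16 * eta + expR (- (L1%:R / (2 * a1))) + L1%:R * (3 * c1) / M1%:R.
  have -> : \sum_y \sum_x \sum_z pXY (x, y) * pZ x z * F1 y x z =
    \sum_y \sum_t nu1 y t * (if ch y is Some w then (confusable joint_test C1 b1 w t)%:R else 1).
    by apply: eq_bigr => y _; rewrite sum_pair.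
  apply: le_trans H1 _.
  apply: (@le_trans _ _ (\sum_y \sum_x (2 * (pXY (x, y) * \sum_(u | ~~ G1 y u) pU y u) +
     pXY (x, y) * (expR (- (L1%:R / (2 * a1))) + L1%:R * (3 * c1) / M1%:R)))).
    apply: ler_sum => y _; rewrite sum_pair; apply: ler_sum => x _.
    rewrite /nu1 /= -mulr_suml -mulr_sumr (hZ x).2 mulr1 [2 * (pXY _ * _)]mulrCA -mulrDr ler_wpM2l ?hXY.1 //.
    rewrite addrA lerD2r; apply: covering_bound => // u /andP[e1 _]; exact: hE1.
  set K1 := expR _ + _.
  have -> : \sum_y \sum_x (2 * (pXY (x, y) * \sum_(u | ~~ G1 y u) pU y u) + pXY (x, y) * K1) =
     2 * (\sum_y \sum_x pXY (x, y) * \sum_(u | ~~ G1 y u) pU y u) + 1 * K1.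
    rewrite -sumXY mulr_suml mulr_sumr -big_split; apply: eq_bigr => y _ /=.
    by rewrite mulr_suml mulr_sumr -big_split.
  rewrite mul1r -addrA lerD2r.
  have := badG1_eta; lra.
(* Regrouping the sum by the value of the helper's codeword brings the bound for each second code
   into play. *)
have partB : \sum_y \sum_x \sum_z pXY (x, y) * pZ x z * (if ch y is Some u then F2 u x z else 0) <=
   \sum_y \sum_x pXY (x, y) * (if ch y is Some u then 2 * gam x u + K2 else 0).
  have -> : \sum_y \sum_x \sum_z pXY (x, y) * pZ x z * (if ch y is Some u then F2 u x z else 0) =
    \sum_v \sum_x \sum_z q v x * pZ x z * F2 v x z.
    rewrite exchange_big [RHS]exchange_big; apply: eq_bigr => x _ /=.
    rewrite exchange_big [RHS]exchange_big; apply: eq_bigr => z _ /=.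
    under eq_bigr do rewrite opt_sum mulr_sumr.
    rewrite exchange_big; apply: eq_bigr => v _; rewrite /q !mulr_suml; apply: eq_bigr => y _; ring.
  have -> : \sum_y \sum_x pXY (x, y) * (if ch y is Some u then 2 * gam x u + K2 else 0) =
    \sum_v \sum_x q v x * (2 * gam x v + K2).
    rewrite exchange_big [RHS]exchange_big; apply: eq_bigr => x _ /=.
    under eq_bigr do rewrite (opt_sum _ (fun u => 2 * gam x u + K2)) mulr_sumr.
    rewrite exchange_big; apply: eq_bigr => v _; rewrite /q !mulr_suml; apply: eq_bigr => y _; ring.
  apply: ler_sum => v _; apply: le_trans (H2 v) _; apply: ler_sum => x _.
  rewrite -mulr_suml -mulr_sumr (hZ x).2 mulr1 ler_wpM2l // /K2 addrA lerD2r.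
  by apply: covering_bound => // w /andP[e2 _]; apply: hE2.
have partC y x : \sum_z pZ x z * (if ch y is Some u then F3 u x z else 0) <=
    if ch y is Some u then 3 * miss1 x u + eta else 0.
  case: (ch y) => [u|]; last by rewrite big1 // => z _; rewrite mulr0.
  rewrite /F3; under eq_bigr do rewrite !mulrDr.
  rewrite !big_split /= -mulr_suml (hZ x).2 mul1r; apply: lerD.
    rewrite (_ : 3 * _ = 2 * miss1 x u + miss1 x u); last by ring.
    rewrite lerD2r; have [b|nb] := boolP (BX u x); first by rewrite mulr_ge0.
    by move: nb; rewrite -leNgt /= mulr1n => nb; lra.
  case Ech2: (ch2 u x) => [w|]; last by rewrite big1 ?ltW // => z _; rewrite mulr0.
  by have [/andP[_ ] ] := chosenP Ech2.
apply: (@le_trans _ _ (\sum_y \sum_x \sum_z pXY (x, y) * pZ x z * F1 y x z +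
  (\sum_y \sum_x \sum_z pXY (x, y) * pZ x z * (if ch y is Some u then F2 u x z else 0) +
   \sum_y \sum_x pXY (x, y) * \sum_z pZ x z * (if ch y is Some u then F3 u x z else 0)))).
  rewrite -!big_split; apply: ler_sum => y _ /=; rewrite -!big_split; apply: ler_sum => x _ /=.
  rewrite mulr_sumr -!big_split; apply: ler_sum => z _ /=.
  rewrite [X in _ + (_ + X)]mulrA -!mulrDr ler_wpM2l ?mulr_ge0 ?hXY.1 ?(hZ _).1 //.
  by apply: le_trans (pointwise y x z) _; case: (ch y) => [u|] //; rewrite !addr0.
apply: (@le_trans _ _ (16 * eta + expR (- (L1%:R / (2 * a1))) + L1%:R * (3 * c1) / M1%:R +
   \sum_y \sum_x pXY (x, y) * (if ch y is Some u then pen x u + (K2 + eta) else 0))).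
  apply: lerD => //; apply: le_trans (lerD partB (lexx _)) _.
  rewrite -!big_split; apply: ler_sum => y _ /=; rewrite -!big_split; apply: ler_sum => x _ /=.
  rewrite -mulrDr ler_wpM2l ?hXY.1 //; apply: le_trans (lerD (lexx _) (partC y x)) _.
  by case: (ch y) => [u|]; rewrite ?addr0 // /pen le_eqVlt; apply/orP; left; apply/eqP; ring.
(* A chosen codeword lies in [G1 y], which controls its penalty averaged over [x] for this [y]. *)
have partD : \sum_y \sum_x pXY (x, y) * (if ch y is Some u then pen x u + (K2 + eta) else 0) <=
    eta + (K2 + eta).
  rewrite -[leRHS]mulr1 -sumXY mulr_sumr; apply: ler_sum => y _.
  have s0 : 0 <= \sum_x pXY (x, y) by apply: sumr_ge0 => x _; apply: hXY.1.
  case Ech: (ch y) => [u|]; last first.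
    have e0 := ltW eta0.
    rewrite big1 => [|x _]; last exact: mulr0.
    by apply: mulr_ge0 => //; apply: addr_ge0 => //; apply: addr_ge0.
  have [/andP[_ ple] _] := chosenP Ech.
  under eq_bigr do rewrite mulrDr; rewrite big_split /= -mulr_suml mulrDl; apply: lerD => //.
  by rewrite mulrC.
rewrite /K2 in partD; lra.
Qed.

End TwoStage.

(** * Marginals of the single-letter law *)

Section Marginals.
Variable R : realType.
Variables X Y Z U W : finType.
Variables (pXY : X * Y -> R) (pZ : X -> Z -> R) (pU : Y -> U -> R) (pW : X * U -> W -> R).
Hypothesis hZ : forall x, is_pmf (pZ x).
Hypothesis hU : forall y, is_pmf (pU y).
Hypothesis hW : forall xu, is_pmf (pW xu).
Local Notation P := (joint5 pXY pZ pU pW).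
Local Notation T := (X * Y * Z * U * W)%type.

Lemma sum_delta (A : finType) (F : A -> R) a : \sum_b F b * (b == a)%:R = F a.
Proof. by rewrite (bigD1 a) //= eqxx mulr1 big1 ?addr0 // => b /negPf ->; exact: mulr0. Qed.

Lemma sum_delta1 (A : finType) (a : A) : \sum_b (a == b)%:R = 1 :> R.
Proof. by rewrite (bigD1 a) //= eqxx big1 ?addr0 // => b; rewrite eq_sym => /negPf ->. Qed.

Lemma pmf_sum_const (A : finType) (p : A -> R) c : is_pmf p -> \sum_a p a * c = c.
Proof. by move=> pp; rewrite -mulr_suml pp.2 mul1r. Qed.

Lemma marg_YZ y z : prob P [pred o : T | (o.1.1.1.2, o.1.1.2) == (y, z)] = \sum_x pXY (x, y) * pZ x z.
Proof.
rewrite probE /= (joint5_expect _ _ _ _ (fun x' y' z' u' w' => ((y', z') == (y, z))%:R)).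
rewrite (bigD1 y) //= [X in _ + X]big1 ?addr0 => [|y' /negPf yy]; last first.
  apply: big1 => x _; rewrite big1 ?mulr0 // => u _; rewrite big1 ?mulr0 // => w _.
  by rewrite big1 ?mulr0 // => z' _; rewrite xpair_eqE yy mulr0.
apply: eq_bigr => x _; congr (_ * _).
under eq_bigr => u _ do under eq_bigr => w _ do
  under eq_bigr => z' _ do rewrite xpair_eqE eqxx.
under eq_bigr => u _ do under eq_bigr => w _ do rewrite sum_delta.
under eq_bigr => u _ do rewrite pmf_sum_const //.
by rewrite pmf_sum_const.
Qed.

Lemma marg_Z z : prob P [pred o : T | o.1.1.2 == z] = \sum_y \sum_x pXY (x, y) * pZ x z.
Proof.
rewrite probE /= (joint5_expect _ _ _ _ (fun x' y' z' u' w' => (z' == z)%:R)).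
apply: eq_bigr => y _; apply: eq_bigr => x _; congr (_ * _).
under eq_bigr => u _ do under eq_bigr => w _ do rewrite sum_delta.
under eq_bigr => u _ do rewrite pmf_sum_const //.
by rewrite pmf_sum_const.
Qed.

Lemma marg_UYZ u y z : prob P [pred o : T | (o.1.2, o.1.1.1.2, o.1.1.2) == (u, y, z)] =
  pU y u * \sum_x pXY (x, y) * pZ x z.
Proof.
rewrite probE /= (joint5_expect _ _ _ _ (fun x' y' z' u' w' => ((u', y', z') == (u, y, z))%:R)).
rewrite (bigD1 y) //= [X in _ + X]big1 ?addr0 => [|y' /negPf yy]; last first.
  apply: big1 => x _; rewrite big1 ?mulr0 // => u' _; rewrite big1 ?mulr0 // => w _.
  by rewrite big1 ?mulr0 // => z' _; rewrite !xpair_eqE yy andbF mulr0.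
rewrite mulr_sumr; apply: eq_bigr => x _; rewrite mulrCA; congr (_ * _).
under eq_bigr => u' _ do under eq_bigr => w _ do
  under eq_bigr => z' _ do rewrite !xpair_eqE eqxx andbT andbC -mulnb natrM mulrA.
under eq_bigr => u' _ do under eq_bigr => w _ do rewrite -mulr_suml sum_delta.
under eq_bigr => u' _ do rewrite pmf_sum_const // mulrA.
by rewrite sum_delta.
Qed.

Lemma marg_XUZ x u z : prob P [pred o : T | (o.1.1.1.1, (o.1.2, o.1.1.2)) == (x, (u, z))] =
  pZ x z * \sum_y pXY (x, y) * pU y u.
Proof.
rewrite probE /= (joint5_expect _ _ _ _ (fun x' y' z' u' w' => ((x', (u', z')) == (x, (u, z)))%:R)).
rewrite mulr_sumr; apply: eq_bigr => y _.
rewrite (bigD1 x) //= [X in _ + X]big1 ?addr0 => [|x' /negPf xx]; last first.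
  rewrite big1 ?mulr0 // => u' _; rewrite big1 ?mulr0 // => w _.
  by rewrite big1 ?mulr0 // => z' _; rewrite !xpair_eqE xx mulr0.
rewrite mulrCA; congr (_ * _).
under eq_bigr => u' _ do under eq_bigr => w _ do
  under eq_bigr => z' _ do rewrite !xpair_eqE eqxx /= andbC -mulnb natrM mulrA.
under eq_bigr => u' _ do under eq_bigr => w _ do rewrite -mulr_suml sum_delta.
under eq_bigr => u' _ do rewrite pmf_sum_const // mulrA.
by rewrite sum_delta mulrC.
Qed.

(** Only [y] is summed out, and [pW] does not depend on it: given (X,U,Z), the law of W is
    [pW (x, u)]. *)
Lemma marg_XWUZ x w u z : prob P [pred o : T | (o.1.1.1.1, o.2, (o.1.2, o.1.1.2)) == (x, w, (u, z))] =
  pW (x, u) w * (pZ x z * \sum_y pXY (x, y) * pU y u).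
Proof.
rewrite probE /= (joint5_expect _ _ _ _
  (fun x' y' z' u' w' => ((x', w', (u', z')) == (x, w, (u, z)))%:R)).
rewrite mulr_sumr mulr_sumr; apply: eq_bigr => y _.
rewrite (bigD1 x) //= [X in _ + X]big1 ?addr0 => [|x' /negPf xx]; last first.
  rewrite big1 ?mulr0 // => u' _; rewrite big1 ?mulr0 // => w' _.
  by rewrite big1 ?mulr0 // => z' _; rewrite !xpair_eqE xx mulr0.
transitivity (pXY (x, y) * (pU y u * (pW (x, u) w * pZ x z))); last by ring.
congr (_ * _).
transitivity (\sum_u' pU y u' * (u' == u)%:R * (pW (x, u) w * pZ x z)); last first.
  by rewrite -mulr_suml sum_delta.
apply: eq_bigr => u' _; rewrite -mulrA; congr (_ * _).
have [->|nu] := eqVneq u' u; last first.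
  rewrite mul0r big1 // => w' _; rewrite big1 ?mulr0 // => z' _.
  by rewrite !xpair_eqE (negPf nu) /= andbF mulr0.
rewrite mul1r.
transitivity (\sum_w' pW (x, u) w' * (w' == w)%:R * pZ x z); last by rewrite -mulr_suml sum_delta.
apply: eq_bigr => w' _; rewrite -mulrA; congr (_ * _).
under eq_bigr => z' _ do rewrite !xpair_eqE !eqxx /= andbC -mulnb natrM mulrA.
by rewrite -mulr_suml sum_delta mulrC.
Qed.

End Marginals.

(** * Block codes from information densities *)

Section Memoryless.
Variable R : realType.
Variable n : nat.
Local Notation "A ^n" := {ffun 'I_n -> A} (at level 8, format "A ^n").

Definition chan_ext (A B : finType) (k : A -> B -> R) (a : A^n) (b : B^n) : R :=
  \prod_i k (a i) (b i).

Definition pair_ext (A B : finType) (p : A * B -> R) (q : A^n * B^n) : R :=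
  \prod_i p (q.1 i, q.2 i).

(** The input is a pair of words instead of a word of pairs, so that the block law is again an
    instance of [joint5] and [two_stage_code] applies to it. *)
Definition chan2_ext (A A' B : finType) (k : A * A' -> B -> R) (q : A^n * A'^n) (b : B^n) : R :=
  \prod_i k (q.1 i, q.2 i) (b i).

Lemma chan_ext_pmf (A B : finType) (k : A -> B -> R) :
  (forall a, is_pmf (k a)) -> forall a, is_pmf (chan_ext k a).
Proof.
move=> kp a; split=> [b|]; first by apply: prodr_ge0 => i _; apply: (kp _).1.
by rewrite -(bigA_distr_bigA (fun i b => k (a i) b)) big1 // => i _; apply: (kp _).2.
Qed.

Lemma chan2_ext_pmf (A A' B : finType) (k : A * A' -> B -> R) :
  (forall a, is_pmf (k a)) -> forall a, is_pmf (chan2_ext k a).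
Proof.
move=> kp a; split=> [b|]; first by apply: prodr_ge0 => i _; apply: (kp _).1.
by rewrite -(bigA_distr_bigA (fun i b => k (a.1 i, a.2 i) b)) big1 // => i _; apply: (kp _).2.
Qed.

Lemma pair_ext_pmf (A B : finType) (p : A * B -> R) : is_pmf p -> is_pmf (pair_ext p).
Proof.
move=> pp; split=> [q|]; first by apply: prodr_ge0 => i _; apply: pp.1.
rewrite -(iid_pmf (I := 'I_n) pp).2.
rewrite (reindex (fun t : (A * B)^n => ([ffun i => (t i).1], [ffun i => (t i).2]))) /=.
  by apply: eq_bigr => t _; apply: eq_bigr => i _; rewrite /= !ffunE -surjective_pairing.
exists (fun q : A^n * B^n => [ffun i => (q.1 i, q.2 i)]) => [t|[a b]] _ /=.
  by apply/ffunP => i; rewrite !ffunE -surjective_pairing.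
by congr (_, _); apply/ffunP => i; rewrite !ffunE.
Qed.

Variables X Y Z : finType.

Lemma sum_source (pXY : X * Y -> R) (pZ : X -> Z -> R) (F : X^n -> Y^n -> Z^n -> R) :
  \sum_(t : (X * Y * Z)^n) (\prod_i source_pmf pXY pZ (t i)) *
     F [ffun i => (t i).1.1] [ffun i => (t i).1.2] [ffun i => (t i).2] =
  \sum_y \sum_x \sum_z pair_ext pXY (x, y) * chan_ext pZ x z * F x y z.
Proof.
rewrite [RHS]exchange_big /=.
transitivity (\sum_(q : X^n * Y^n * Z^n)
    pair_ext pXY (q.1.1, q.1.2) * chan_ext pZ q.1.1 q.2 * F q.1.1 q.1.2 q.2); last first.
  by rewrite !sum_pair.
rewrite [RHS](reindex (fun t : (X * Y * Z)^n =>
  ([ffun i => (t i).1.1], [ffun i => (t i).1.2], [ffun i => (t i).2]))) /=.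
  apply: eq_bigr => t _; congr (_ * _); rewrite -big_split; apply: eq_bigr => i _ /=.
  by rewrite !ffunE.
exists (fun q : X^n * Y^n * Z^n => [ffun i => (q.1.1 i, q.1.2 i, q.2 i)]) => [t|[[x y] z]] _ /=.
  by apply/ffunP => i; rewrite !ffunE; case: (t i) => [[]].
by congr (_, _, _); apply/ffunP => i; rewrite !ffunE.
Qed.

Variables U W : finType.
Local Notation T := (X * Y * Z * U * W)%type.

Definition unzip5 (t : T^n) : X^n * Y^n * Z^n * U^n * W^n :=
  ([ffun i => (t i).1.1.1.1], [ffun i => (t i).1.1.1.2], [ffun i => (t i).1.1.2],
   [ffun i => (t i).1.2], [ffun i => (t i).2]).

Variables (pXY : X * Y -> R) (pZ : X -> Z -> R) (pU : Y -> U -> R) (pW : X * U -> W -> R).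
Local Notation Pn := (joint5 (pair_ext pXY) (chan_ext pZ) (chan_ext pU) (chan2_ext pW)).

(** [unzip5] is a bijection that carries the product measure to the block law, so Chebyshev's bound
    for i.i.d. letters applies to events on words. *)
Lemma prob_joint5_ext (E : pred (X^n * Y^n * Z^n * U^n * W^n)) :
  prob Pn E = prob (iid (joint5 pXY pZ pU pW)) [pred t : T^n | E (unzip5 t)].
Proof.
rewrite !probE (reindex unzip5) /=.
  apply: eq_bigr => t _; congr (_ * _); rewrite /joint5 /iid -!big_split.
  by apply: eq_bigr => i _ /=; rewrite !ffunE.
exists (fun q : X^n * Y^n * Z^n * U^n * W^n =>
  [ffun i => (q.1.1.1.1 i, q.1.1.1.2 i, q.1.1.2 i, q.1.2 i, q.2 i)]) => [t|[[[[x y] z] u] w]] _ /=.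
  by apply/ffunP => i; rewrite !ffunE; case: (t i) => [[[[]]]].
by congr (_, _, _, _, _); apply/ffunP => i; rewrite !ffunE.
Qed.

End Memoryless.

(** * Concentration of information densities and choice of code sizes *)

Section Densities.
Variable R : realType.
Variable O : finType.
Variables (P : O -> R).
Hypothesis pP : is_pmf P.
Variables (k q : O -> R).
Hypothesis k_gt0 : forall o, 0 < P o -> 0 < k o.
Hypothesis q_gt0 : forall o, 0 < q o.

Let phi o := ln (k o / q o).
Let m := \sum_o P o * phi o.

Definition density_variance := \sum_o P o * (phi o - m) ^+ 2.

Lemma iid_density n (t : {ffun 'I_n -> O}) : 0 < iid P t ->
  \prod_i k (t i) = expR (\sum_i phi (t i)) * \prod_i q (t i).
Proof.
move=> Pt; rewrite expR_sum -big_split; apply: eq_bigr => i _ /=.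
have ki : 0 < k (t i).
  apply: k_gt0; rewrite lt_neqAle pP.1 andbT eq_sym; apply/negP => /eqP P0.
  by move: Pt; rewrite /iid (bigD1 i) //= P0 mul0r ltxx.
by rewrite /phi lnK ?posrE ?divr_gt0 // divfK // gt_eqF.
Qed.

(** On the support of the product law the failure says that the sum of the log ratios exceeds its
    mean by more than [n * delta]. *)
Lemma density_upper n (delta : R) : 0 < delta -> (0 < n)%N ->
  prob (iid P) [pred t : {ffun 'I_n -> O} |
     ~~ (\prod_i k (t i) <= expR (n%:R * (m + delta)) * \prod_i q (t i))]
  <= density_variance / (n%:R * delta ^+ 2).
Proof.
move=> d0 n0; have := @iid_chebyshev R 'I_n O P phi m delta pP d0.
rewrite card_ord => /(_ n0 erefl); apply: le_trans.
apply: le_prob => [t|t Pt /=]; first exact: iid_ge0 pP.1.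
rewrite -ltNge iid_density // ltr_pM2r ?ltr_expR; last by apply: prodr_gt0.
by rewrite mulrDr addrC -ltrBrDr => /ltW h; apply: le_trans h (ler_norm _).
Qed.

Lemma density_lower n (delta : R) : 0 < delta -> (0 < n)%N ->
  prob (iid P) [pred t : {ffun 'I_n -> O} |
     ~~ (expR (n%:R * (m - delta)) * \prod_i q (t i) <= \prod_i k (t i))]
  <= density_variance / (n%:R * delta ^+ 2).
Proof.
move=> d0 n0; have := @iid_chebyshev R 'I_n O P phi m delta pP d0.
rewrite card_ord => /(_ n0 erefl); apply: le_trans.
apply: le_prob => [t|t Pt /=]; first exact: iid_ge0 pP.1.
rewrite -ltNge iid_density // ltr_pM2r ?ltr_expR; last by apply: prodr_gt0.
rewrite mulrBr ltrBrDr addrC -ltrBrDr => /ltW h; rewrite distrC.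
exact: le_trans h (ler_norm _).
Qed.

End Densities.

Section Rates.
Variable R : realType.

Lemma expRN_le_inv (x : R) : 0 < x -> expR (- x) <= x^-1.
Proof.
move=> x0; rewrite expRN lef_pV2 ?posrE ?expR_gt0 //.
by apply: le_trans (expR_ge1Dx x); rewrite lerDr.
Qed.

(** [L] is about exp(n (m + 2 delta)), a factor exp(n delta) above the covering cost, and [M] about
    exp(n (rho + 4 delta)). The exponent in the last bound is then at most m + 2 delta - m' + delta
    - rho - 4 delta <= - delta. As [m] and [rho] are nonnegative both numbers are at least 1 before
    rounding, so each rounding costs a factor 2, whence the 4. *)
Lemma codebook_rates (n : nat) (m m' rho delta : R) :
  0 <= m -> 0 <= rho -> m - m' <= rho -> 0 < delta ->
  exists L M : nat, [/\ (0 < M)%N, M%:R <= expR (n%:R * (rho + 4 * delta)),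
    expR (- (L%:R / (2 * expR (n%:R * (m + delta))))) <= expR (- (n%:R * delta / 2)) &
    L%:R * (expR (n%:R * (m' - delta)))^-1 / M%:R <= 4 * expR (- (n%:R * delta)) ].
Proof.
move=> m0 r0 mr d0.
have n0 : 0 <= n%:R :> R by exact: ler0n.
pose l := expR (n%:R * (m + 2 * delta)).
pose k := expR (n%:R * (rho + 4 * delta)).
have l1 : 1 <= l by rewrite -expR0 ler_expR mulr_ge0 //; lra.
have k1 : 1 <= k by rewrite -expR0 ler_expR mulr_ge0 //; lra.
have kM := truncnS_gt k.
have M0 : (0 < Num.truncn k)%N by rewrite truncn_gt0.
have lL := truncnS_gt l.
have lL' : (Num.truncn l)%:R <= l by rewrite truncn_le; lra.
exists (Num.truncn l).+1, (Num.truncn k); split => //.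
- by rewrite truncn_le; lra.
- rewrite ler_expR lerN2 ler_pdivlMr ?mulr_gt0 ?expR_gt0 //.
  rewrite (_ : _ * (2 * _) = n%:R * delta * expR (n%:R * (m + delta))); last by field.
  apply: le_trans (ltW lL); rewrite /l (_ : n%:R * (m + 2 * delta) = n%:R * delta + n%:R * (m + delta)).
    rewrite expRD ler_pM2r ?expR_gt0 //; apply: le_trans (expR_ge1Dx _); lra.
  by ring.
- have Mk : k / 2 <= (Num.truncn k)%:R.
    by move: kM; rewrite -natr1; have : 1 <= (Num.truncn k)%:R :> R by [rewrite ler1n]; lra.
  rewrite ler_pdivrMr ?ltr0n //.
  apply: (@le_trans _ _ (2 * l * (expR (n%:R * (m' - delta)))^-1)).
    rewrite ler_pM2r ?invr_gt0 ?expR_gt0 // -natr1; lra.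
  apply: (@le_trans _ _ (4 * expR (- (n%:R * delta)) * (k / 2))); last first.
    by rewrite ler_pM2l // mulr_gt0 ?expR_gt0.
  rewrite (_ : 4 * _ * _ = 2 * (expR (- (n%:R * delta)) * k)); last by field.
  rewrite -mulrA ler_pM2l // /l /k -expRN -!expRD ler_expR.
  rewrite -mulrN -mulrN -!mulrDr ler_wpM2l //; lra.
Qed.

End Rates.

Section SingleLetterDensities.
Variable R : realType.
Variables X Y Z U W : finType.
Variables (pXY : X * Y -> R) (pZ : X -> Z -> R) (pU : Y -> U -> R) (pW : X * U -> W -> R).
Hypothesis hXY : is_pmf pXY.
Hypothesis hZ : forall x, is_pmf (pZ x).
Hypothesis hU : forall y, is_pmf (pU y).
Hypothesis hW : forall xu, is_pmf (pW xu).
Local Notation P := (joint5 pXY pZ pU pW).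
Local Notation T := (X * Y * Z * U * W)%type.
Local Notation vX := (fun o : T => o.1.1.1.1).
Local Notation vY := (fun o : T => o.1.1.1.2).
Local Notation vZ := (fun o : T => o.1.1.2).
Local Notation vU := (fun o : T => o.1.2).
Local Notation vW := (fun o : T => o.2).

Let P0 : forall o, 0 <= P o := joint5_ge0 hXY hZ hU hW.

Lemma joint5_gt0 x y z u w : 0 < P (x, y, z, u, w) ->
  [/\ 0 < pXY (x, y), 0 < pZ x z, 0 < pU y u & 0 < pW (x, u) w].
Proof.
rewrite /joint5 /= => h.
have := hXY.1 (x, y); have := (hZ x).1 z; have := (hU y).1 u; have := (hW (x, u)).1 w.
rewrite !le_eqVlt => /orP[/eqP E|->]; first by move: h; rewrite -E mulr0 ltxx.
move=> /orP[/eqP E|->]; first by move: h; rewrite -E mulr0 mul0r ltxx.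
move=> /orP[/eqP E|->]; first by move: h; rewrite -E mulr0 !mul0r ltxx.
by move=> /orP[/eqP E|->] //; move: h; rewrite -E !mul0r ltxx.
Qed.

(** The law of U given Z. It vanishes at null [z], hence it is only a subprobability, which is all
    that packing requires. *)
Definition post_UZ u z := prob P [pred o : T | (o.1.2, o.1.1.2) == (u, z)] / prob P [pred o : T | o.1.1.2 == z].

Definition post_WUZ u z w :=
  prob P [pred o : T | (o.2, (o.1.2, o.1.1.2)) == (w, (u, z))] / prob P [pred o : T | (o.1.2, o.1.1.2) == (u, z)].

Lemma post_UZ_ge0 u z : 0 <= post_UZ u z.
Proof. by rewrite divr_ge0 ?prob_ge0. Qed.

Lemma post_WUZ_ge0 u z w : 0 <= post_WUZ u z w.
Proof. by rewrite divr_ge0 ?prob_ge0. Qed.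

Lemma post_UZ_sum z : \sum_u post_UZ u z <= 1.
Proof.
rewrite -mulr_suml (eq_bigr (fun u => prob P [pred o | (vU o == u) && (vZ o == z)])); last first.
  by move=> u _; apply: eq_prob => o /=; rewrite xpair_eqE.
rewrite (sum_prob_pair P vU vZ z).
by have [->|nz] := eqVneq (prob P [pred o : T | o.1.1.2 == z]) 0; rewrite ?mul0r ?ler01 ?divff.
Qed.

Lemma post_WUZ_sum u z : \sum_w post_WUZ u z w <= 1.
Proof.
rewrite -mulr_suml (eq_bigr (fun w => prob P [pred o | (vW o == w) && ((vU o, vZ o) == (u, z))])); last first.
  by move=> w _; apply: eq_prob => o /=; rewrite xpair_eqE.
rewrite (sum_prob_pair P vW (fun o => (vU o, vZ o)) (u, z)).
by have [->|nz] := eqVneq (prob P [pred o : T | (o.1.2, o.1.1.2) == (u, z)]) 0; rewrite ?mul0r ?ler01 ?divff.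
Qed.

Lemma post_UZ_gt0 o : 0 < P o -> 0 < post_UZ (vU o) (vZ o).
Proof.
move=> Po; apply: divr_gt0; last exact: (prob_self_gt0 vZ).
exact: (prob_self_gt0 (fun o => (vU o, vZ o))).
Qed.

Lemma post_WUZ_gt0 o : 0 < P o -> 0 < post_WUZ (vU o) (vZ o) (vW o).
Proof.
move=> Po; apply: divr_gt0; last exact: (prob_self_gt0 (fun o => (vU o, vZ o))).
exact: (prob_self_gt0 (fun o => (vW o, (vU o, vZ o)))).
Qed.

(** Pointwise identity of densities: U depends on Y alone, so p(u|y,z) is [pU y u]. *)
Lemma condMI_UYZ_density (q : R) : 0 < q ->
  ln 2 * condMI P vU vY vZ =
  \sum_o P o * ln (pU (vY o) (vU o) / q) - \sum_o P o * ln (post_UZ (vU o) (vZ o) / q).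
Proof.
move=> q0; rewrite condMI_sumE // -sumrB; apply: eq_bigr => o _.
have := P0 o; rewrite le_eqVlt => /orP[/eqP<-|Po]; first by rewrite !mul0r subrr.
have hUZ := post_UZ_gt0 Po.
rewrite -mulrBr; congr (_ * _).
have hYZ := prob_self_gt0 (fun o => (vY o, vZ o)) P0 Po.
have hz := prob_self_gt0 vZ P0 Po.
have huz := prob_self_gt0 (fun o => (vU o, vZ o)) P0 Po.
move: o Po hUZ hYZ hz huz => [[[[x y] z] u] w] Po hUZ /=.
have [_ _ u0 _] := joint5_gt0 Po.
rewrite -ln_div ?posrE; [|exact: divr_gt0|exact: divr_gt0].
rewrite /post_UZ marg_UYZ // -(marg_YZ pXY pZ hU hW).
set a := prob _ _; set b := prob _ _; set c := prob _ _ => a0 b0 c0.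
by congr ln; field; rewrite !gt_eqF.
Qed.

(** The same identity with p(w|x,u,z) equal to [pW (x, u) w]. *)
Lemma condMI_XWUZ_density (q : R) : 0 < q ->
  ln 2 * condMI P vX vW (fun o => (vU o, vZ o)) =
  \sum_o P o * ln (pW (vX o, vU o) (vW o) / q) -
  \sum_o P o * ln (post_WUZ (vU o) (vZ o) (vW o) / q).
Proof.
move=> q0; rewrite condMI_sumE // -sumrB; apply: eq_bigr => o _.
have := P0 o; rewrite le_eqVlt => /orP[/eqP<-|Po]; first by rewrite !mul0r subrr.
have hp := post_WUZ_gt0 Po.
rewrite -mulrBr; congr (_ * _).
have hXUZ := prob_self_gt0 (fun o => (vX o, (vU o, vZ o))) P0 Po.
have hWUZ := prob_self_gt0 (fun o => (vW o, (vU o, vZ o))) P0 Po.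
have huz := prob_self_gt0 (fun o => (vU o, vZ o)) P0 Po.
move: o Po hp hXUZ hWUZ huz => [[[[x y] z] u] w] Po hp /=.
have [_ _ _ w0] := joint5_gt0 Po.
rewrite -ln_div ?posrE; [|exact: divr_gt0|exact: divr_gt0].
rewrite /post_WUZ marg_XWUZ // -(marg_XUZ pXY pZ pU hW).
set a := prob _ _; set b := prob _ _; set c := prob _ _ => a0 b0 c0.
by congr ln; field; rewrite !gt_eqF.
Qed.

End SingleLetterDensities.

(** [P'] is [P] with its factor [k] replaced by [q], so the sum is the relative entropy of [P] with
    respect to [P']. It makes the covering exponents nonnegative, as [codebook_rates] requires. *)
Lemma relative_entropy_ge0 (R : realType) (O : finType) (P P' k q : O -> R) :
  is_pmf P -> is_pmf P' -> (forall o, 0 < P o -> 0 < k o) -> (forall o, 0 < q o) ->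
  (forall o, P o * q o = P' o * k o) -> 0 <= \sum_o P o * ln (k o / q o).
Proof.
move=> pP pP' k0 q0 E.
apply: (@le_trans _ _ (\sum_o (P o - P' o))); first by rewrite sumrB pP.2 pP'.2 subrr.
apply: ler_sum => o _.
have := pP.1 o; rewrite le_eqVlt => /orP[/eqP<-|Po]; first by rewrite mul0r sub0r oppr_le0 pP'.1.
have ko := k0 o Po.
have -> : P o - P' o = P o * (1 - q o / k o).
  by rewrite mulrBr mulr1 mulrA E mulfK // gt_eqF.
rewrite ler_pM2l // -[k o / q o]invrK invf_div lnV ?posrE ?divr_gt0 //.
by have := ln_le_sub1 (divr_gt0 (q0 o) ko); lra.
Qed.

(** On the event, [Q] is at most [k / b]. With [k] the posterior given the side information, this
    bounds the probability that an independent codeword passes the decoder's test. *)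
Lemma packing_bound (R : realType) (V : finType) (Q k : V -> R) (b : R) :
  0 < b -> (forall v, 0 <= k v) -> \sum_v k v <= 1 -> \sum_(v | b * Q v <= k v) Q v <= b^-1.
Proof.
move=> b0 k0 k1; rewrite -(ler_pM2l b0) divff ?gt_eqF //; apply: le_trans k1.
rewrite mulr_sumr [leRHS](bigID (fun v => b * Q v <= k v)) /= -[leLHS]addr0 lerD //.
  exact: ler_sum.
exact: sumr_ge0.
Qed.

Lemma le_sum6_parts (R : realDomainType) (a b c e f g N : R) :
  0 <= a -> 0 <= b -> 0 <= c -> 0 <= e -> 0 <= f -> 0 <= g -> a + b + c + e + f + g + 1 <= N ->
  [/\ 1 <= N, a <= N, b <= N & c <= N] /\ [/\ e <= N, f <= N & g <= N].
Proof. by move=> *; do !split; lra. Qed.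

Lemma excess_bound (R : realFieldType) (dmax eta eps : R) : 0 <= dmax -> 0 <= eta ->
  eta * (38 * (dmax + 1)) <= eps -> dmax * (19 * eta) <= eps / 2.
Proof. by move=> *; nra. Qed.

(** The four error terms add up to at most (2 + 12 + 2 + 4) / nd, which is the origin of the
    threshold 20 / nd. *)
Lemma failure_bound (R : realFieldType) (eta e1 e2 t1 t2 x y nd : R) :
  e1 <= x -> e2 <= x -> x <= 2 / nd -> t1 <= 12 * y -> t2 <= 4 * y -> y <= nd^-1 ->
  20 / nd <= eta -> 18 * eta + e1 + t1 + e2 + t2 <= 19 * eta.
Proof. by move=> *; lra. Qed.

Lemma sum3_affine (R : realType) (A B C : finType) (F G : A -> B -> C -> R) (p q : R) :
  \sum_a \sum_b \sum_c (F a b c * p + q * G a b c) =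
  (\sum_a \sum_b \sum_c F a b c) * p + q * (\sum_a \sum_b \sum_c G a b c).
Proof.
rewrite mulr_suml mulr_sumr -big_split; apply: eq_bigr => a _ /=.
rewrite mulr_suml mulr_sumr -big_split; apply: eq_bigr => b _ /=.
by rewrite mulr_suml mulr_sumr -big_split.
Qed.

(** * Achievability of every single-letter point up to a slack *)

Section Achievability.
Variable R : realType.
Variables X Y Z U W Xh : finType.
Variables (pXY : X * Y -> R) (pZ : X -> Z -> R) (pU : Y -> U -> R) (pW : X * U -> W -> R).
Variables (d : X -> Xh -> R) (xhat : U -> W -> Z -> Xh).
Hypothesis hXY : is_pmf pXY.
Hypothesis hZ : forall x, is_pmf (pZ x).
Hypothesis hU : forall y, is_pmf (pU y).
Hypothesis hW : forall xu, is_pmf (pW xu).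
Hypothesis d0 : forall x xh, 0 <= d x xh.
Local Notation P := (joint5 pXY pZ pU pW).
Local Notation T := (X * Y * Z * U * W)%type.
Local Notation vX := (fun o : T => o.1.1.1.1).
Local Notation vY := (fun o : T => o.1.1.1.2).
Local Notation vZ := (fun o : T => o.1.1.2).
Local Notation vU := (fun o : T => o.1.2).
Local Notation vW := (fun o : T => o.2).

Theorem single_letter_achievable (D Rr R1 slack : R) :
  condMI P vU vY vZ <= R1 -> condMI P vX vW (fun o => (vU o, vZ o)) <= Rr ->
  \sum_(o : T) P o * d (vX o) (xhat (vU o) (vW o) (vZ o)) <= D -> 0 < slack ->
  achievable pXY pZ d D (Rr + slack) (R1 + slack).
Proof.
move=> I1 I2 ED s0 eps eps0.
have pP : is_pmf P by apply: joint5_pmf.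
have [[x0 y0] _] := exists_le_average (fun=> 0) hXY.1 hXY.2.
have [u0 _] := exists_le_average (fun=> 0) (hU y0).1 (hU y0).2.
have [w0 _] := exists_le_average (fun=> 0) (hW (x0, u0)).1 (hW (x0, u0)).2.
have cU : (0 < #|U|)%N by apply/card_gt0P; exists u0.
have cW : (0 < #|W|)%N by apply/card_gt0P; exists w0.
(* The reference laws cancel in [m1 - m2] and [m3 - m4]; uniform ones avoid zero denominators. *)
pose qU : R := #|U|%:R^-1; pose qW : R := #|W|%:R^-1.
have qU0 : 0 < qU by rewrite invr_gt0 ltr0n.
have qW0 : 0 < qW by rewrite invr_gt0 ltr0n.
have ln2 := ln2_gt0 R.
(* The code sizes exceed the information rates by [4 * delta] nats, that is, by [slack] bits. *)
pose delta := slack * ln 2 / 4.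
have delta0 : 0 < delta by rewrite divr_gt0 ?mulr_gt0.
pose k1 (o : T) := pU (vY o) (vU o).
pose k2 (o : T) := post_UZ pXY pZ pU pW (vU o) (vZ o).
pose k3 (o : T) := pW (vX o, vU o) (vW o).
pose k4 (o : T) := post_WUZ pXY pZ pU pW (vU o) (vZ o) (vW o).
have k1_gt0 o : 0 < P o -> 0 < k1 o by case: o => [[[[x y] z] u] w] /(joint5_gt0 hXY hZ hU hW)[].
have k2_gt0 o : 0 < P o -> 0 < k2 o by move/(post_UZ_gt0 hXY hZ hU hW).
have k3_gt0 o : 0 < P o -> 0 < k3 o by case: o => [[[[x y] z] u] w] /(joint5_gt0 hXY hZ hU hW)[].
have k4_gt0 o : 0 < P o -> 0 < k4 o by move/(post_WUZ_gt0 hXY hZ hU hW).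
pose m1 := \sum_o P o * ln (k1 o / qU).
pose m2 := \sum_o P o * ln (k2 o / qU).
pose m3 := \sum_o P o * ln (k3 o / qW).
pose m4 := \sum_o P o * ln (k4 o / qW).
have I1' : m1 - m2 <= R1 * ln 2.
  by rewrite -(condMI_UYZ_density hXY hZ hU hW qU0) mulrC ler_pM2r.
have I2' : m3 - m4 <= Rr * ln 2.
  by rewrite -(condMI_XWUZ_density hXY hZ hU hW qW0) mulrC ler_pM2r.
have R10 : 0 <= R1 * ln 2.
  by rewrite mulr_ge0 ?(ltW ln2) //; apply: le_trans I1; apply: condMI_ge0; apply: pP.1.
have Rr0 : 0 <= Rr * ln 2.
  by rewrite mulr_ge0 ?(ltW ln2) //; apply: le_trans I2; apply: condMI_ge0; apply: pP.1.
have m10 : 0 <= m1.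
  have pP' := joint5_pmf hXY hZ (fun _ : Y => uniform_pmf R cU) hW.
  apply: (relative_entropy_ge0 pP pP' k1_gt0 (fun=> qU0)) => -[[[[x y] z] u] w].
  by rewrite /k1 /joint5 /= /qU; ring.
have m30 : 0 <= m3.
  have pP' := joint5_pmf hXY hZ hU (fun _ : X * U => uniform_pmf R cW).
  apply: (relative_entropy_ge0 pP pP' k3_gt0 (fun=> qW0)) => -[[[[x y] z] u] w].
  by rewrite /k3 /joint5 /= /qW; ring.
(* A crude upper bound for the distortion; the sum avoids a maximum over a possibly empty type. *)
pose dmax := \sum_x \sum_xh d x xh.
have dmaxP x xh : d x xh <= dmax.
  rewrite /dmax (bigD1 x) //= (bigD1 xh) //= -addrA lerDl addr_ge0 ?sumr_ge0 // => x' _.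
  exact: sumr_ge0.
have dmax0 : 0 <= dmax by apply: sumr_ge0 => x _; apply: sumr_ge0.
have D0 : 0 <= D by apply: le_trans ED; apply: sumr_ge0 => o _; rewrite mulr_ge0 ?pP.1.
(* The total failure probability will be at most [19 * eta]; the constant 38 makes its contribution
   to the distortion at most [eps / 2], and [dmax + 1] keeps the denominator positive. *)
pose eta := Num.min 1 (eps / (38 * (dmax + 1))).
have dm1 : 0 < 38 * (dmax + 1) by rewrite mulr_gt0 // ltr_wpDl.
have eta0 : 0 < eta by rewrite lt_min ltr01 divr_gt0.
have eta1 : eta <= 1 by rewrite ge_min lexx.
have etaE : dmax * (19 * eta) <= eps / 2.
  have : eta <= eps / (38 * (dmax + 1)) by rewrite ge_min lexx orbT.
  rewrite ler_pdivlMr // => h.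
  exact: excess_bound dmax0 (ltW eta0) h.
pose phi (o : T) := d (vX o) (xhat (vU o) (vW o) (vZ o)).
pose V1 := density_variance P k1 (fun=> qU).
pose V2 := density_variance P k2 (fun=> qU).
pose V3 := density_variance P k3 (fun=> qW).
pose V4 := density_variance P k4 (fun=> qW).
pose mD := \sum_o P o * phi o.
pose V5 := \sum_o P o * (phi o - mD) ^+ 2.
have V_ge0 (f : T -> R) c : 0 <= \sum_o P o * (f o - c) ^+ 2.
  by apply: sumr_ge0 => o _; rewrite mulr_ge0 ?sqr_ge0 ?pP.1.
(* Thresholds for Chebyshev's bounds: [V / c1 <= n] gives a probability of at most [eta ^+ 3 / 2].
   The half leaves room for the union of a density event and the distortion event. *)
pose c1 := delta ^+ 2 * (eta ^+ 3 / 2).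
pose c2 := (eps / 2) ^+ 2 * (eta ^+ 3 / 2).
have e30 : 0 < eta ^+ 3 by rewrite exprn_gt0.
have c10 : 0 < c1 by apply: mulr_gt0; [exact: exprn_gt0 | exact: divr_gt0].
have c20 : 0 < c2 by apply: mulr_gt0; [apply: exprn_gt0; exact: divr_gt0 | exact: divr_gt0].
pose K := V1 / c1 + V2 / c1 + V3 / c1 + V4 / c1 + V5 / c2 + 20 / (delta * eta) + 1.
have K1 : 0 <= V1 / c1 by apply: divr_ge0; [exact: V_ge0 | exact: ltW].
have K2 : 0 <= V2 / c1 by apply: divr_ge0; [exact: V_ge0 | exact: ltW].
have K3 : 0 <= V3 / c1 by apply: divr_ge0; [exact: V_ge0 | exact: ltW].
have K4 : 0 <= V4 / c1 by apply: divr_ge0; [exact: V_ge0 | exact: ltW].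
have K5 : 0 <= V5 / c2 by apply: divr_ge0; [exact: V_ge0 | exact: ltW].
have K6 : 0 <= 20 / (delta * eta) by rewrite divr_ge0 // mulr_ge0 // ltW.
exists (Num.truncn K).+1 => n Nn.
have Kn : K <= n%:R.
  apply: le_trans (ltW (truncnS_gt K)) _; by rewrite ler_nat.
have [[n1 KV1 KV2 KV3] [KV4 KV5 KV6]] := le_sum6_parts K1 K2 K3 K4 K5 K6 Kn.
have nn0 : (0 < n)%N by rewrite -(ler1n R).
have n0 : 0 < n%:R :> R by rewrite ltr0n.
have lln_small V : 0 <= V / c1 -> V / c1 <= n%:R -> V / (n%:R * delta ^+ 2) <= eta ^+ 3 / 2.
  move=> _; rewrite ler_pdivrMr // => h.
  rewrite ler_pdivrMr ?mulr_gt0 ?exprn_gt0 //; apply: le_trans h _.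
  by rewrite /c1 le_eqVlt; apply/orP; left; apply/eqP; ring.
have nd : 20 / (n%:R * delta) <= eta.
  move: KV6; rewrite !ler_pdivrMr ?mulr_gt0 // => h; apply: le_trans h _.
  by rewrite le_eqVlt; apply/orP; left; apply/eqP; ring.
have [L1 [M1 [M10 M1le L1exp L1M1]]] := codebook_rates n m10 R10 I1' delta0.
have [L2 [M2 [M20 M2le L2exp L2M2]]] := codebook_rates n m30 Rr0 I2' delta0.
have powE r : powR 2 (n%:R * (r + slack)) = expR (n%:R * (r * ln 2 + 4 * delta)).
  by rewrite /powR pnatr_eq0 /=; congr expR; rewrite /delta; field.
exists M1, M2; rewrite !powE; split => //; split => //.
pose QU : {ffun 'I_n -> U} -> R := iid (fun=> qU).
pose QW : {ffun 'I_n -> W} -> R := iid (fun=> qW).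
have hQU : is_pmf QU by apply: iid_pmf; apply: uniform_pmf.
have hQW : is_pmf QW by apply: iid_pmf; apply: uniform_pmf.
pose a1 := expR (n%:R * (m1 + delta)); pose b1 := expR (n%:R * (m2 - delta)).
pose a2 := expR (n%:R * (m3 + delta)); pose b2 := expR (n%:R * (m4 - delta)).
pose E1 (y : {ffun 'I_n -> Y}) u := chan_ext pU y u <= a1 * QU u.
pose B1 u (z : {ffun 'I_n -> Z}) := b1 * QU u <= \prod_i post_UZ pXY pZ pU pW (u i) (z i).
pose E2 (x : {ffun 'I_n -> X}) u w := chan2_ext pW (x, u) w <= a2 * QW w.
pose B2 (u : {ffun 'I_n -> U}) w (z : {ffun 'I_n -> Z}) :=
  b2 * QW w <= \prod_i post_WUZ pXY pZ pU pW (u i) (z i) (w i).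
pose Gd (x : {ffun 'I_n -> X}) (u : {ffun 'I_n -> U}) (w : {ffun 'I_n -> W}) (z : {ffun 'I_n -> Z}) :=
  \sum_i d (x i) (xhat (u i) (w i) (z i)) <= n%:R * (D + eps / 2).
have hB1 z : \sum_(u | B1 u z) QU u <= b1^-1.
  apply: packing_bound => [|u|]; first exact: expR_gt0.
    by apply: prodr_ge0 => i _; apply: post_UZ_ge0.
  rewrite -(bigA_distr_bigA (fun i u => post_UZ pXY pZ pU pW u (z i))).
  apply: prodr_ile1 => i _; rewrite post_UZ_sum // andbT; apply: sumr_ge0 => u _; exact: post_UZ_ge0.
have hB2 u z : \sum_(w | B2 u w z) QW w <= b2^-1.
  apply: packing_bound => [|w|]; first exact: expR_gt0.
    by apply: prodr_ge0 => i _; apply: post_WUZ_ge0.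
  rewrite -(bigA_distr_bigA (fun i w => post_WUZ pXY pZ pU pW (u i) (z i) w)).
  apply: prodr_ile1 => i _; rewrite post_WUZ_sum // andbT; apply: sumr_ge0 => w _; exact: post_WUZ_ge0.
have half : eta ^+ 3 / 2 <= eta ^+ 3 by rewrite ler_pdivrMr // ler_peMr ?ler1n // ltW.
have sE1 : prob (joint5 (pair_ext pXY) (chan_ext pZ) (chan_ext pU) (chan2_ext pW))
    [pred o | ~~ E1 o.1.1.1.2 o.1.2] <= eta ^+ 3.
  rewrite prob_joint5_ext; apply: le_trans half.
  apply: le_trans (lln_small V1 K1 KV1).
  apply: le_trans (density_upper pP k1_gt0 (fun=> qU0) delta0 nn0); rewrite le_eqVlt; apply/orP; left.
  apply/eqP/eq_prob => t /=; congr (~~ (_ <= _ * _)); apply: eq_bigr => i _; by rewrite !ffunE.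
have sB1 : prob (joint5 (pair_ext pXY) (chan_ext pZ) (chan_ext pU) (chan2_ext pW))
    [pred o | ~~ B1 o.1.2 o.1.1.2] <= eta ^+ 3.
  rewrite prob_joint5_ext; apply: le_trans half.
  apply: le_trans (lln_small V2 K2 KV2).
  apply: le_trans (density_lower pP k2_gt0 (fun=> qU0) delta0 nn0); rewrite le_eqVlt; apply/orP; left.
  apply/eqP/eq_prob => t /=; congr (~~ (_ * _ <= _)); apply: eq_bigr => i _; by rewrite !ffunE.
have sE2 : prob (joint5 (pair_ext pXY) (chan_ext pZ) (chan_ext pU) (chan2_ext pW))
    [pred o | ~~ E2 o.1.1.1.1 o.1.2 o.2] <= eta ^+ 3.
  rewrite prob_joint5_ext; apply: le_trans half.
  apply: le_trans (lln_small V3 K3 KV3).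
  apply: le_trans (density_upper pP k3_gt0 (fun=> qW0) delta0 nn0); rewrite le_eqVlt; apply/orP; left.
  apply/eqP/eq_prob => t /=; congr (~~ (_ <= _ * _)); apply: eq_bigr => i _; by rewrite !ffunE.
have sB2 : prob (joint5 (pair_ext pXY) (chan_ext pZ) (chan_ext pU) (chan2_ext pW))
    [pred o | ~~ (B2 o.1.2 o.2 o.1.1.2 && Gd o.1.1.1.1 o.1.2 o.2 o.1.1.2)] <= eta ^+ 3.
  rewrite prob_joint5_ext.
  have iP0 (t : {ffun 'I_n -> T}) : 0 <= iid P t by apply: iid_ge0 pP.1.
  have h1 := le_trans (density_lower pP k4_gt0 (fun=> qW0) delta0 nn0) (lln_small V4 K4 KV4).
  have ee : 0 < eps / 2 by exact: divr_gt0.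
  have h2 := @iid_chebyshev R 'I_n T P phi mD (eps / 2) pP ee; rewrite card_ord in h2.
  have {}h2 := h2 nn0 erefl.
  have h3 : V5 / (n%:R * (eps / 2) ^+ 2) <= eta ^+ 3 / 2.
    move: KV5; rewrite ler_pdivrMr // => h; rewrite ler_pdivrMr ?mulr_gt0 ?exprn_gt0 //; apply: le_trans h _.
    by rewrite /c2 le_eqVlt; apply/orP; left; apply/eqP; ring.
  have {}h2 := le_trans h2 h3.
  rewrite (_ : eta ^+ 3 = eta ^+ 3 / 2 + eta ^+ 3 / 2); last by field.
  apply: le_trans (lerD h1 h2); rewrite !probE -big_split; apply: ler_sum => t _ /=.
  rewrite -mulrDr ler_wpM2l // -natrD ler_nat negb_and.
  have -> : B2 (unzip5 t).1.2 (unzip5 t).2 (unzip5 t).1.1.2 =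
    (expR (n%:R * (m4 - delta)) * \prod_(i < n) qW <= \prod_i k4 (t i)).
    by rewrite /B2; congr (_ <= _); apply: eq_bigr => i _; rewrite !ffunE.
  have [_|nG] := boolP (Gd _ _ _ _); first by rewrite orbF leq_addr.
  rewrite orbT; apply: leq_trans (leq_addl _ _); rewrite lt0n eqb0 negbK.
  move: nG; rewrite /Gd -ltNge => h; apply: le_trans (ler_norm _).
  have -> : \sum_i phi (t i) = \sum_(i < n) d ((unzip5 t).1.1.1.1 i)
      (xhat ((unzip5 t).1.2 i) ((unzip5 t).2 i) ((unzip5 t).1.1.2 i)).
    by apply: eq_bigr => i _; rewrite !ffunE.
  have hD : n%:R * mD <= n%:R * D by rewrite ler_pM2l.
  by rewrite mulrDr in h; rewrite lerBrDr; apply: le_trans (ltW h); rewrite addrC lerD2r.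
have [f1 [f [g Hfail]]] := two_stage_code
  (pair_ext_pmf n hXY) (chan_ext_pmf (n := n) hZ) (chan_ext_pmf (n := n) hU) (chan2_ext_pmf (n := n) hW)
  hQU hQW L1 L2 (expR_gt0 _) (expR_gt0 _) eta0 M10 M20 (fun y u h => h) (fun x u w h => h) hB1 hB2
  (ltW (eq_ind _ (fun r => 0 < r) (expR_gt0 _) _ (expRN _))) eta1 sE1 sB1 sE2 sB2.
pose g' t t1 z : {ffun 'I_n -> Xh} := [ffun i => xhat ((g t t1 z).1 i) ((g t t1 z).2 i) (z i)].
exists f1, f, g'.
pose dist (x : {ffun 'I_n -> X}) y z := n%:R^-1 * \sum_i d (x i) (g' (f x (f1 y)) (f1 y) z i).
rewrite [expected_distortion _ _ _ _ _ _](sum_source pXY pZ dist).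
(* A good block costs at most [D + eps / 2], and any other block at most [dmax] more than
   nothing. *)
apply: (@le_trans _ _ (\sum_y \sum_x \sum_z
   (pair_ext pXY (x, y) * chan_ext pZ x z * (D + eps / 2) +
    dmax * (pair_ext pXY (x, y) * chan_ext pZ x z *
     (let uw := g (f x (f1 y)) (f1 y) z in ~~ Gd x uw.1 uw.2 z)%:R)))).
  apply: ler_sum => y _; apply: ler_sum => x _; apply: ler_sum => z _.
  rewrite [dmax * _]mulrCA -mulrDr ler_wpM2l //.
    by rewrite mulr_ge0 ?(pair_ext_pmf n hXY).1 ?(chan_ext_pmf hZ _).1.
  rewrite /dist; cbv zeta; set uw := g _ _ z.
  have -> : \sum_i d (x i) (g' (f x (f1 y)) (f1 y) z i) =
    \sum_i d (x i) (xhat (uw.1 i) (uw.2 i) (z i)) by apply: eq_bigr => i _; rewrite ffunE.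
  have [gd|_] := boolP (Gd _ _ _ _).
    by rewrite mulr0 addr0 mulrC ler_pdivrMr // mulrC.
  rewrite mulr1 -[leLHS]add0r; apply: lerD; first by rewrite addr_ge0 // divr_ge0 // ltW.
  rewrite mulrC ler_pdivrMr // mulr_natr -[X in _ *+ X]card_ord -sumr_const; exact: ler_sum.
have sum1 : \sum_y \sum_(x : {ffun 'I_n -> X}) \sum_z pair_ext pXY (x, y) * chan_ext pZ x z = 1.
  rewrite exchange_big -[RHS](pair_ext_pmf n hXY).2 [RHS]sum_pair.
  apply: eq_bigr => x _; apply: eq_bigr => y _ /=.
  by rewrite -mulr_sumr (chan_ext_pmf hZ _).2 mulr1.
rewrite sum3_affine sum1 mul1r.
have fail19 : 18 * eta + expR (- (L1%:R / (2 * a1))) + L1%:R * (3 * b1^-1) / M1%:R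
           + expR (- (L2%:R / (2 * a2))) + L2%:R * b2^-1 / M2%:R <= 19 * eta.
  have nd0 : 0 < n%:R * delta by rewrite mulr_gt0.
  have x1 : expR (- (n%:R * delta / 2)) <= 2 / (n%:R * delta).
    by rewrite -[2 / _]invf_div; apply: expRN_le_inv; rewrite divr_gt0.
  have x2 := expRN_le_inv nd0.
  have x3 : L1%:R * (3 * b1^-1) / M1%:R <= 12 * expR (- (n%:R * delta)).
    rewrite (_ : _ / _ = 3 * (L1%:R * b1^-1 / M1%:R)); last by ring.
    rewrite (_ : 12 * _ = 3 * (4 * expR (- (n%:R * delta)))); last by ring.
    by rewrite ler_pM2l.
  exact: failure_bound L1exp L2exp x1 x3 L2M2 x2 nd.
have := le_trans Hfail fail19 => {}Hfail.
have Hd := ler_wpM2l dmax0 Hfail.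
by rewrite [X in _ <= D + X]splitr addrA lerD2l; apply: le_trans Hd etaE.
Qed.

End Achievability.

(** * Single-letterization of a block code *)

Section Laws.
Variable R : realType.

Lemma prob_law (T A : finType) (P : T -> R) (f : T -> A) (E : pred A) :
  prob P [pred t | E (f t)] = \sum_(a | E a) prob P [pred t | f t == a].
Proof.
rewrite /prob [LHS](partition_big f E) //=; apply: eq_bigr => a Ea.
by apply: eq_bigl => t; case: eqP => [->|]; rewrite ?Ea ?andbF.
Qed.

Lemma expect_law (T A : finType) (P : T -> R) (f : T -> A) (phi : A -> R) :
  \sum_t P t * phi (f t) = \sum_a prob P [pred t | f t == a] * phi a.
Proof.
rewrite -(sum_fibers f (fun a t => P t * phi a)); apply: eq_bigr => a _.
by rewrite -mulr_suml.
Qed.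

Lemma condMI_law (T T' A B C D : finType) (P : T -> R) (P' : T' -> R)
    (f : T -> D) (f' : T' -> D) (fa : D -> A) (fb : D -> B) (fc : D -> C) :
  (forall a, prob P [pred t | f t == a] = prob P' [pred t | f' t == a]) ->
  condMI P (fun t => fa (f t)) (fun t => fb (f t)) (fun t => fc (f t)) =
  condMI P' (fun t => fa (f' t)) (fun t => fb (f' t)) (fun t => fc (f' t)).
Proof.
move=> law.
have E (p : pred D) : prob P [pred t | p (f t)] = prob P' [pred t | p (f' t)].
  by rewrite !prob_law; apply: eq_bigr => a _.
rewrite /condMI; apply: eq_bigr => a _; apply: eq_bigr => b _; apply: eq_bigr => c _.
rewrite (E [pred s | [&& fa s == a, fb s == b & fc s == c]]).
rewrite (E [pred s | (fa s == a) && (fc s == c)]).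
by rewrite (E [pred s | (fb s == b) && (fc s == c)]) (E [pred s | fc s == c]).
Qed.

Lemma negent_equiv (T A B : finType) (P : T -> R) (f : T -> A) (g : T -> B) :
  (forall t t', f t = f t' <-> g t = g t') -> negent P f = negent P g.
Proof. by move=> fg; apply: negent_congr => t t'; apply/eqP/eqP => /fg. Qed.

(** Entropy sees only the partition into fibers. Stating the four variables by their fibers allows
    tuples of any shape, and variables that are functions of others, to be matched. *)
Lemma negent_submod_equiv (T A B C S1 S2 S3 S4 : finType) (P : T -> R)
    (f : T -> A) (g : T -> B) (h : T -> C)
    (e1 : T -> S1) (e2 : T -> S2) (e3 : T -> S3) (e4 : T -> S4) :
  (forall t, 0 <= P t) ->
  (forall t t', e1 t = e1 t' <-> f t = f t' /\ h t = h t') ->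
  (forall t t', e2 t = e2 t' <-> g t = g t' /\ h t = h t') ->
  (forall t t', e3 t = e3 t' <-> [/\ f t = f t', g t = g t' & h t = h t']) ->
  (forall t t', e4 t = e4 t' <-> h t = h t') ->
  negent P e1 + negent P e2 <= negent P e3 + negent P e4.
Proof.
move=> P0 h1 h2 h3 h4.
rewrite (@negent_equiv _ _ _ P e1 (fun t => (f t, h t))); last first.
  by move=> t t'; split=> [/h1[-> ->]//|[? ?]]; apply/h1.
rewrite (@negent_equiv _ _ _ P e2 (fun t => (g t, h t))); last first.
  by move=> t t'; split=> [/h2[-> ->]//|[? ?]]; apply/h2.
rewrite (@negent_equiv _ _ _ P e3 (fun t => (f t, g t, h t))); last first.
  by move=> t t'; split=> [/h3[-> -> ->]//|[? ? ?]]; apply/h3.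
by rewrite (negent_equiv P h4); apply: negent_submod.
Qed.

Lemma negent_indep (T A B : finType) (P : T -> R) (f : T -> A) (g : T -> B) : is_pmf P ->
  (forall a b, prob P [pred t | (f t, g t) == (a, b)] =
     prob P [pred t | f t == a] * prob P [pred t | g t == b]) ->
  negent P (fun t => (f t, g t)) = negent P f + negent P g.
Proof.
move=> pP ind; rewrite !negentE -big_split; apply: eq_bigr => t _ /=.
have := pP.1 t; rewrite le_eqVlt => /orP[/eqP<-|Pt]; first by rewrite !mul0r addr0.
by rewrite ind lnM ?posrE ?prob_self_gt0 ?pP.1 ?mulrDr // => s; apply: pP.1.
Qed.

(** The left side is H(f|g), at most H(f) by submodularity with a constant third variable. *)
Lemma negent_cond_le_card (T A B S : finType) (P : T -> R) (f : T -> A) (g : T -> B) (e : T -> S) :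
  is_pmf P -> (forall t t', e t = e t' <-> f t = f t' /\ g t = g t') ->
  negent P g - negent P e <= ln #|A|%:R.
Proof.
move=> pP he.
have := @negent_submod_equiv _ _ _ _ _ _ _ _ P f g (fun=> tt) f g e (fun=> tt) pP.1.
have -> : negent P (fun=> tt) = 0.
  rewrite negentE big1 // => t _; rewrite (_ : prob _ _ = 1) ?ln1 ?mulr0 // -pP.2.
  by apply: eq_bigl => s; rewrite inE eqxx.
rewrite addr0 => H.
have {}H : negent P f + negent P g <= negent P e.
  apply: H => t t'; first by split=> [|[]].
  - by split=> [|[]].
  - by split=> [/he[]|[? ? _]] //; apply/he.
  - by split.
have := negent_ge_card f pP; lra.
Qed.

End Laws.

(** * A law of the required product form with two prescribed marginals *)

Section Realize.
Variable R : realType.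
Variables X Y Z U V : finType.
Variables (pXY : X * Y -> R) (pZ : X -> Z -> R) (k : Y -> U -> R) (N : X -> U -> V -> R) (v0 : V).
Hypothesis hXY : is_pmf pXY.
Hypothesis hZ : forall x, is_pmf (pZ x).
Hypothesis hk : forall y, is_pmf (k y).
Hypothesis N0 : forall x u v, 0 <= N x u v.
Hypothesis Nk : forall x u, \sum_v N x u v = \sum_y pXY (x, y) * k y u.

(** Disintegration of the mass [N] over its last variable; [v0] carries the kernel where (x,u) has
    no mass. *)
Definition cond_kernel (xu : X * U) (v : V) : R :=
  let M := \sum_v N xu.1 xu.2 v in if M == 0 then (v == v0)%:R else N xu.1 xu.2 v / M.

Lemma cond_kernel_pmf xu : is_pmf (cond_kernel xu).
Proof.
rewrite /cond_kernel; have [E|nz] := eqVneq (\sum_v N xu.1 xu.2 v) 0.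
  split=> [v|]; first exact: ler0n.
  by under eq_bigr do rewrite eq_sym; exact: sum_delta1.
split=> [v|]; first by rewrite divr_ge0 ?sumr_ge0.
by rewrite -mulr_suml divff.
Qed.

Lemma cond_kernelE x u v : cond_kernel (x, u) v * (\sum_y pXY (x, y) * k y u) = N x u v.
Proof.
rewrite -Nk /cond_kernel /=; have [E|nz] := eqVneq (\sum_v N x u v) 0; last by rewrite divfK.
by rewrite E mulr0; move/psumr_eq0P: E => /(_ (fun v _ => N0 x u v)) ->.
Qed.

Variables (T : finType) (P : T -> R).
Variables (vX : T -> X) (vY : T -> Y) (vZ : T -> Z) (vU : T -> U) (vV : T -> V).
Hypothesis law_UYZ : forall u y z,
  prob P [pred t | (vU t, vY t, vZ t) == (u, y, z)] = k y u * \sum_x pXY (x, y) * pZ x z.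
Hypothesis law_XVUZ : forall x v u z,
  prob P [pred t | (vX t, vV t, (vU t, vZ t)) == (x, v, (u, z))] = N x u v * pZ x z.

Let J := joint5 pXY pZ k cond_kernel.
Let J_UYZ (o : X * Y * Z * U * V) := (o.1.2, o.1.1.1.2, o.1.1.2).
Let J_XVUZ (o : X * Y * Z * U * V) := (o.1.1.1.1, o.2, (o.1.2, o.1.1.2)).

Let eq_law_UYZ a :
  prob J [pred o | J_UYZ o == a] = prob P [pred t | (vU t, vY t, vZ t) == a].
Proof.
case: a => [[u y] z]; rewrite law_UYZ; apply: marg_UYZ; exact: cond_kernel_pmf.
Qed.

Let eq_law_XVUZ a :
  prob J [pred o | J_XVUZ o == a] = prob P [pred t | (vX t, vV t, (vU t, vZ t)) == a].
Proof.
case: a => [[x v] [u z]]; rewrite law_XVUZ -cond_kernelE mulrAC -mulrA.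
apply: marg_XWUZ.
Qed.

(** [P] itself need not have the product form; agreement of the (U,Y,Z) marginals suffices here. *)
Lemma realize_UYZ :
  condMI J (fun o => o.1.2) (fun o => o.1.1.1.2) (fun o => o.1.1.2) = condMI P vU vY vZ.
Proof.
exact: (condMI_law (fun s => s.1.1) (fun s => s.1.2) (fun s => s.2) eq_law_UYZ).
Qed.

Lemma realize_XVUZ :
  condMI J (fun o => o.1.1.1.1) (fun o => o.2) (fun o => (o.1.2, o.1.1.2)) =
  condMI P vX vV (fun t => (vU t, vZ t)).
Proof.
exact: (condMI_law (fun s => s.1.1) (fun s => s.1.2) (fun s => s.2) eq_law_XVUZ).
Qed.

Lemma realize_expect (phi : X -> V -> Z -> R) :
  \sum_o J o * phi o.1.1.1.1 o.2 o.1.1.2 = \sum_t P t * phi (vX t) (vV t) (vZ t).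
Proof.
rewrite (expect_law J J_XVUZ (fun s => phi s.1.1 s.1.2 s.2.2)).
rewrite (expect_law P (fun t => (vX t, vV t, (vU t, vZ t))) (fun s => phi s.1.1 s.1.2 s.2.2)).
by apply: eq_bigr => a _; rewrite eq_law_XVUZ.
Qed.

End Realize.

Lemma submod_combine (R : realDomainType) (my p' m' py uy m u o z yz p : R) :
  my + p' <= m' + py -> uy + m <= my + u -> py + (o + z) <= o + yz + p ->
  uy + z - (u + yz) <= p - m - (p' - m').
Proof. by move=> *; lra. Qed.

Lemma submod_combine2 (R : realDomainType) (xv t t' v u x : R) :
  xv + t <= t' + v -> xv + u - (x + v) <= u - t - (x - t').
Proof. by move=> *; lra. Qed.

(** * Auxiliary variables of a block code and their informations *)

Section BlockCode.
Variable R : realType.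
Variables X Y Z Xh : finType.
Variables (pXY : X * Y -> R) (pZ : X -> Z -> R).
Hypothesis hXY : is_pmf pXY.
Hypothesis hZ : forall x, is_pmf (pZ x).
Local Notation O := (X * Y * Z)%type.
Local Notation p := (source_pmf pXY pZ).

Lemma source_pmf_pmf : is_pmf p.
Proof.
split=> [q|]; first by rewrite mulr_ge0 ?hXY.1 ?(hZ _).1.
rewrite -[RHS]hXY.2 sum_pair; apply: eq_bigr => -[x y] _ /=.
by rewrite /source_pmf /= -mulr_sumr (hZ x).2 mulr1.
Qed.

Variables (n M1 M : nat).
Variables (f1 : {ffun 'I_n -> Y} -> 'I_M1) (f : {ffun 'I_n -> X} -> 'I_M1 -> 'I_M)
  (g : 'I_M -> 'I_M1 -> {ffun 'I_n -> Z} -> {ffun 'I_n -> Xh}).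
Local Notation Om := {ffun 'I_n -> O}.
Local Notation V := {ffun Z -> Xh}.

(** Padded with [None] to full length, so that its type does not depend on [k] and the uncertainties
    form a sequence that telescopes. *)
Definition prefix_of (A : finType) (phi : O -> A) (k : nat) (t : Om) : {ffun 'I_n -> option A} :=
  [ffun j : 'I_n => if (j < k)%N then Some (phi (t j)) else None].

Definition others (A : finType) (phi : O -> A) (i : 'I_n) (t : Om) : {ffun 'I_n -> option A} :=
  [ffun j => if j == i then None else Some (phi (t j))].

Lemma prefix_ofP (A : finType) (phi : O -> A) k t t' :
  prefix_of phi k t = prefix_of phi k t' <->
  (forall j : 'I_n, (j < k)%N -> phi (t j) = phi (t' j)).
Proof.
split=> [/ffunP H j jk|H]; first by have := H j; rewrite !ffunE jk => -[].
by apply/ffunP => j; rewrite !ffunE; case: ifP => // jk; rewrite H.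
Qed.

Lemma othersP (A : finType) (phi : O -> A) i t t' :
  others phi i t = others phi i t' <-> (forall j, j != i -> phi (t j) = phi (t' j)).
Proof.
split=> [/ffunP H j /negPf ji|H]; first by have := H j; rewrite !ffunE ji => -[].
by apply/ffunP => j; rewrite !ffunE; case: eqVneq => // ji; rewrite H.
Qed.

Definition xs (t : Om) : {ffun 'I_n -> X} := [ffun j => (t j).1.1].
Definition ys (t : Om) : {ffun 'I_n -> Y} := [ffun j => (t j).1.2].
Definition zs (t : Om) : {ffun 'I_n -> Z} := [ffun j => (t j).2].
Definition msg1 t := f1 (ys t).
Definition msg t := f (xs t) (msg1 t).

(** The index [i] is stored in the value: after time sharing, U contains the time-sharing
    variable. *)
Definition auxU (i : 'I_n) (t : Om) :=
  (i, prefix_of (fun o => o.1.1) i t, msg1 t, others (fun o => o.2) i t).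

(* The reconstruction of the [i]-th letter as a function of the missing side information [Z_i]. *)
Definition auxV (i : 'I_n) (t : Om) : V :=
  [ffun z => g (msg t) (msg1 t) [ffun j => if j == i then z else (t j).2] i].

Lemma zsP t t' : zs t = zs t' <-> forall j, (t j).2 = (t' j).2.
Proof.
split=> [/ffunP H j|H]; first by have := H j; rewrite !ffunE.
by apply/ffunP => j; rewrite !ffunE.
Qed.

(** Adding [Z_i] fills the hole in the side information: (U_i, Z_i) is equivalent to (X^{i-1}, T1,
    Z^n). *)
Lemma auxU_zP i t t' : (auxU i t, (t i).2) = (auxU i t', (t' i).2) <->
  [/\ prefix_of (fun o => o.1.1) i t = prefix_of (fun o => o.1.1) i t',
      msg1 t = msg1 t' & zs t = zs t'].
Proof.
split=> [[-> -> /othersP E Ei]|[Ep E1 /zsP E]].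
  by split=> //; apply/zsP => j; have [->|/E] := eqVneq j i.
by rewrite /auxU Ep E1 E (_ : others _ i t = others (fun o => o.2) i t') // ; apply/othersP.
Qed.

Local Notation P := (iid p : Om -> R).
Let pP : is_pmf P := iid_pmf source_pmf_pmf.

(* [uncert1 k] is H(T1 | first k letters, Z^n) and [uncert k] is H(T | X_0 .. X_(k-1), T1, Z^n). *)
Definition uncert1 (k : nat) : R :=
  negent P (fun t => (prefix_of id k t, zs t)) - negent P (fun t => (msg1 t, prefix_of id k t, zs t)).

Definition uncert (k : nat) : R :=
  negent P (fun t => (prefix_of (fun o => o.1.1) k t, msg1 t, zs t)) -
  negent P (fun t => (msg t, prefix_of (fun o => o.1.1) k t, msg1 t, zs t)).

Lemma telescope_bound (u : nat -> R) (B : R) : u 0%N <= B -> 0 <= u n ->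
  \sum_(i < n) (u i - u i.+1) <= B.
Proof.
move=> u0 un; rewrite -(big_mkord xpredT (fun i => u i - u i.+1)).
rewrite (eq_big_nat _ _ (F2 := fun i => - u i.+1 - - u i)) => [|i _]; last by rewrite opprK addrC.
by rewrite telescope_sumr // opprK; lra.
Qed.

Lemma uncert1_sum : \sum_(i < n) (uncert1 i - uncert1 i.+1) <= ln M1%:R.
Proof.
apply: telescope_bound.
  have := @negent_cond_le_card R _ _ _ _ P msg1 (fun t => (prefix_of id 0%N t, zs t))
    (fun t => (msg1 t, prefix_of id 0%N t, zs t)) pP; rewrite card_ord; apply=> t t'.
  by split=> [[-> ->]|[-> [->]]].
by rewrite subr_ge0; apply: negent_mono => [|t t' [_ -> ->]]; first exact: pP.1.
Qed.

Lemma uncert_sum : \sum_(i < n) (uncert i - uncert i.+1) <= ln M%:R.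
Proof.
apply: telescope_bound.
  have := @negent_cond_le_card R _ _ _ _ P msg
    (fun t => (prefix_of (fun o => o.1.1) 0%N t, msg1 t, zs t))
    (fun t => (msg t, prefix_of (fun o => o.1.1) 0%N t, msg1 t, zs t)) pP; rewrite card_ord; apply=> t t'.
  by split=> [[-> -> ->]|[-> [-> ->]]].
by rewrite subr_ge0; apply: negent_mono => [|t t' [_ -> -> ->]]; first exact: pP.1.
Qed.

Lemma others_upd (A : finType) (phi : O -> A) i (t : Om) o : others phi i (upd t i o) = others phi i t.
Proof. by apply/othersP => j /negPf ji; rewrite ffunE ji. Qed.

(** Resampling letter [i] leaves the other letters unchanged and makes the [i]-th one fresh. *)
Lemma others_indep (A : finType) (phi : O -> A) i :
  negent P (fun t => (others id i t, phi (t i))) =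
  negent P (others id i) + negent P (fun t => phi (t i)).
Proof.
apply: negent_indep => // c a; rewrite !probE.
rewrite -(iid_resample i _ source_pmf_pmf) -(iid_resample i (fun t => _ : R) source_pmf_pmf) /=.
rewrite -[X in _ = _ * X](iid_resample i (fun t => (phi (t i) == a)%:R) source_pmf_pmf) /=.
have E (t : Om) : \sum_o iid p t * p o * (phi (upd t i o i) == a)%:R =
  iid p t * \sum_o p o * (phi o == a)%:R.
  by rewrite mulr_sumr; apply: eq_bigr => o _; rewrite upd_same mulrA.
under [X in _ = _ * X]eq_bigr do rewrite E; rewrite -[X in _ = _ * X]mulr_suml pP.2 mul1r.
rewrite mulr_suml; apply: eq_bigr => t _.
under eq_bigr do rewrite upd_same others_upd xpair_eqE.
under [X in _ = X * _]eq_bigr do rewrite others_upd.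
rewrite -[X in _ = X * _]mulr_suml -mulr_sumr source_pmf_pmf.2 mulr1 mulr_sumr.
by apply: eq_bigr => o _; rewrite -mulnb natrM; ring.
Qed.

(** The right side is I(T1; O_i | O^{i-1}, Z^n) for the triples O = (X,Y,Z), which is at least I(T1;
    Y_i | O^{i-1}, Z^n). Writing the latter as a difference of entropies of Y_i, its first term is
    at least H(Y_i | Z_i) and its second at most H(Y_i | U_i, Z_i). *)
Lemma uncert1_step i :
  negent P (fun t => (auxU i t, (t i).1.2, (t i).2)) + negent P (fun t => (t i).2) -
  (negent P (fun t => (auxU i t, (t i).2)) + negent P (fun t => ((t i).1.2, (t i).2)))
  <= uncert1 i - uncert1 i.+1.
Proof.
(* I(T1; O_i | O^{i-1}, Y_i, Z^n) >= 0: keep only Y_i from the letter O_i. *)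
have s1 := @negent_submod_equiv R _ _ _ _ _ _ _ _ P msg1 (prefix_of id i.+1)
  (fun t => (prefix_of id i t, (t i).1.2, zs t))
  (fun t => (msg1 t, prefix_of id i t, (t i).1.2, zs t)) (fun t => (prefix_of id i.+1 t, zs t))
  (fun t => (msg1 t, prefix_of id i.+1 t, zs t)) (fun t => (prefix_of id i t, (t i).1.2, zs t)) pP.1.
have pre_step t t' : prefix_of id i.+1 t = prefix_of id i.+1 t' ->
    prefix_of id i t = prefix_of id i t' /\ t i = t' i.
  move=> /prefix_ofP H; split; last exact: H.
  by apply/prefix_ofP => j ji; apply: H; rewrite ltnS ltnW.
have {}s1 : negent P (fun t => (msg1 t, prefix_of id i t, (t i).1.2, zs t)) +
    negent P (fun t => (prefix_of id i.+1 t, zs t)) <=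
    negent P (fun t => (msg1 t, prefix_of id i.+1 t, zs t)) +
    negent P (fun t => (prefix_of id i t, (t i).1.2, zs t)).
  apply: s1 => t t'.
  - by split=> [[-> -> -> ->]|[-> [-> -> ->]]].
  - by split=> [[Ep Ez]|[-> [_ _ ->]] //]; split=> //; have [-> ->] := pre_step _ _ Ep; rewrite Ez.
  - by split=> [[Em Ep Ez]|[-> -> [_ _ ->]] //]; split=> //; have [-> ->] := pre_step _ _ Ep; rewrite Ez.
  - by [].
(* H(Y_i | T1, O^{i-1}, Z^n) <= H(Y_i | U_i, Z_i), since U_i and Z_i are functions of the former
   condition. *)
have s2 : negent P (fun t => (auxU i t, (t i).1.2, (t i).2)) +
    negent P (fun t => (msg1 t, prefix_of id i t, zs t)) <=
    negent P (fun t => (msg1 t, prefix_of id i t, (t i).1.2, zs t)) +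
    negent P (fun t => (auxU i t, (t i).2)).
  have sub t t' : prefix_of id i t = prefix_of id i t' ->
    prefix_of (fun o => o.1.1) i t = prefix_of (fun o => o.1.1) i t'.
    by move=> /prefix_ofP H; apply/prefix_ofP => j ji; have /= -> := H j ji.
  apply: (@negent_submod_equiv R _ _ _ _ _ _ _ _ P (fun t => (t i).1.2) (prefix_of id i)
    (fun t => (auxU i t, (t i).2))) => [|t t'|t t'|t t'|t t']; first exact: pP.1.
  - by split=> [[E1 E2 E3 E4 E5]|[E4 [E1 E2 E3 E5]]]; rewrite /auxU E1 E2 E3 E4 E5.
  - split=> [[Em Ep Ez]|[-> /auxU_zP[_ -> ->]] //]; split=> //; apply/auxU_zP; split=> //; exact: sub.
  - split=> [[Em Ep Ey Ez]|[-> -> /auxU_zP[_ -> ->]] //].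
    by split=> //; apply/auxU_zP; split=> //; exact: sub.
  - by [].
(* H(Y_i | O^{i-1}, Z^n) is at least the entropy of Y_i given Z_i and all other letters;
   independence then removes the other letters. *)
have s3 : negent P (fun t => (prefix_of id i t, (t i).1.2, zs t)) +
    negent P (fun t => (others id i t, (t i).2)) <=
    negent P (fun t => (others id i t, ((t i).1.2, (t i).2))) +
    negent P (fun t => (prefix_of id i t, zs t)).
  have sub t t' : others id i t = others id i t' -> (t i).2 = (t' i).2 ->
      prefix_of id i t = prefix_of id i t' /\ zs t = zs t'.
    move=> /othersP H Ez; split; last by apply/zsP => j; have [->|/H /= ->] := eqVneq j i.
    by apply/prefix_ofP => j ji; apply: H; apply: contraTneq ji => ->; rewrite ltnn.
  apply: (@negent_submod_equiv R _ _ _ _ _ _ _ _ P (fun t => (t i).1.2) (others id i)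
    (fun t => (prefix_of id i t, zs t))) => [|t t'|t t'|t t'|t t']; first exact: pP.1.
  - by split=> [[-> -> ->]|[-> [-> ->]]].
  - split=> [[Eo Ez]|[-> [_ /zsP ->]] //]; split=> //.
    by have [-> ->] := sub _ _ Eo Ez.
  - split=> [[Eo Ey Ez]|[-> -> [_ /zsP ->]] //]; split=> //.
    by have [-> ->] := sub _ _ Eo Ez.
  - by [].
rewrite (others_indep (fun o => o.2)) (others_indep (fun o => (o.1.2, o.2))) in s3.
exact: submod_combine s1 s2 s3.
Qed.

(** The right side is I(T; X_i | U_i, Z_i), and the reconstruction function is determined by T given
    (U_i, Z_i): data processing. *)
Lemma uncert_step i :
  negent P (fun t => ((t i).1.1, auxV i t, (auxU i t, (t i).2))) +
  negent P (fun t => (auxU i t, (t i).2)) -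
  (negent P (fun t => ((t i).1.1, (auxU i t, (t i).2))) +
   negent P (fun t => (auxV i t, (auxU i t, (t i).2))))
  <= uncert i - uncert i.+1.
Proof.
have pre_step t t' : prefix_of (fun o => o.1.1) i.+1 t = prefix_of (fun o => o.1.1) i.+1 t' <->
    (t i).1.1 = (t' i).1.1 /\ prefix_of (fun o => o.1.1) i t = prefix_of (fun o => o.1.1) i t'.
  split=> [/prefix_ofP H|[E /prefix_ofP H]].
    by split; [exact: H | apply/prefix_ofP => j ji; apply: H; rewrite ltnS ltnW].
  by apply/prefix_ofP => j; rewrite ltnS leq_eqVlt => /orP[/eqP/val_inj -> //|]; apply: H.
have auxV_fun t t' : msg t = msg t' -> (auxU i t, (t i).2) = (auxU i t', (t' i).2) ->
    auxV i t = auxV i t'.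
  move=> Em /auxU_zP[_ E1 /zsP Ez]; apply/ffunP => z; rewrite !ffunE Em E1.
  by congr (g _ _ _ _); apply/ffunP => j; rewrite !ffunE Ez.
rewrite /uncert.
rewrite (@negent_equiv _ _ _ _ P (fun t => (prefix_of (fun o => o.1.1) i t, msg1 t, zs t))
  (fun t => (auxU i t, (t i).2))); last first.
  by move=> t t'; split=> [[Ep Em Ez]|/auxU_zP[-> -> ->] //]; apply/auxU_zP.
rewrite (@negent_equiv _ _ _ _ P (fun t => (prefix_of (fun o => o.1.1) i.+1 t, msg1 t, zs t))
  (fun t => ((t i).1.1, (auxU i t, (t i).2)))); last first.
  move=> t t'; split=> [[/pre_step[Ex Ep] Em Ez]|[Ex E1 E2 E3 E4]].
    by rewrite Ex; congr (_, _); apply/auxU_zP.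
  have /auxU_zP[Ep -> ->] : (auxU i t, (t i).2) = (auxU i t', (t' i).2) by rewrite /auxU E1 E2 E3 E4.
  by have /pre_step -> : (t i).1.1 = (t' i).1.1 /\ _ := conj Ex Ep.
have s : negent P (fun t => ((t i).1.1, auxV i t, (auxU i t, (t i).2))) +
   negent P (fun t => (msg t, prefix_of (fun o => o.1.1) i t, msg1 t, zs t)) <=
   negent P (fun t => (msg t, prefix_of (fun o => o.1.1) i.+1 t, msg1 t, zs t)) +
   negent P (fun t => (auxV i t, (auxU i t, (t i).2))).
  apply: (@negent_submod_equiv R _ _ _ _ _ _ _ _ P (fun t => (t i).1.1) msg
    (fun t => (auxV i t, (auxU i t, (t i).2)))) => [|t t'|t t'|t t'|t t']; first exact: pP.1.
  - by split=> [[-> -> E1 E2 E3 E4]|[-> [-> E1 E2 E3 E4]]]; rewrite /auxU E1 E2 E3 E4.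
  - split=> [[Em Ep E1 Ez]|[-> [_ E1 E2 E3 E4]]].
      have E : (auxU i t, (t i).2) = (auxU i t', (t' i).2) by apply/auxU_zP.
      by split=> //; rewrite E (auxV_fun t t').
    have /auxU_zP[-> -> ->] // : (auxU i t, (t i).2) = (auxU i t', (t' i).2) by rewrite /auxU E1 E2 E3 E4.
  - split=> [[Em /pre_step[Ex Ep] E1 Ez]|[Ex -> [_ E1 E2 E3 E4]]].
      have E : (auxU i t, (t i).2) = (auxU i t', (t' i).2) by apply/auxU_zP.
      by split=> //; rewrite E (auxV_fun t t').
    have /auxU_zP[Ep -> ->] // : (auxU i t, (t i).2) = (auxU i t', (t' i).2) by rewrite /auxU E1 E2 E3 E4.
    by have /pre_step -> : (t i).1.1 = (t' i).1.1 /\ _ := conj Ex Ep.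
  - by [].
exact: submod_combine2 s.
Qed.

Definition timeshare (q : 'I_n * Om) : R := n%:R^-1 * iid p q.2.

Hypothesis n_gt0 : (0 < n)%N.

Let nn : n%:R != 0 :> R.
Proof. by rewrite pnatr_eq0 -lt0n. Qed.

Let avg_const (c : R) : n%:R^-1 * \sum_(i < n) c = c.
Proof. by rewrite sumr_const card_ord -[c *+ n]mulr_natl mulrA mulVf // mul1r. Qed.

Lemma timeshare_ge0 q : 0 <= timeshare q.
Proof. by rewrite mulr_ge0 ?invr_ge0 ?ler0n ?pP.1. Qed.

Lemma timeshare_expect (Phi : 'I_n -> Om -> R) :
  \sum_q timeshare q * Phi q.1 q.2 = n%:R^-1 * \sum_i \sum_t iid p t * Phi i t.
Proof.
rewrite sum_pair mulr_sumr; apply: eq_bigr => i _; rewrite mulr_sumr.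
by apply: eq_bigr => t _; rewrite /timeshare mulrA.
Qed.

Lemma timeshare_resample (Phi : 'I_n -> Om -> R) :
  \sum_q timeshare q * Phi q.1 q.2 =
  n%:R^-1 * \sum_i \sum_t iid p t * \sum_o p o * Phi i (upd t i o).
Proof.
rewrite timeshare_expect; congr (_ * _); apply: eq_bigr => i _.
rewrite -(iid_resample i (Phi i) source_pmf_pmf); apply: eq_bigr => t _.
by rewrite mulr_sumr; apply: eq_bigr => o _; rewrite mulrA.
Qed.

(** Chain rule with the uniform index. The terms [ln n] cancel in both informations, where the index
    occurs in as many positive as negative entropies. *)
Lemma negent_timeshare (A B : finType) (h : 'I_n -> Om -> A) (e : 'I_n * Om -> B) :
  (forall q q', e q = e q' <-> q.1 = q'.1 /\ h q.1 q.2 = h q'.1 q'.2) ->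
  negent timeshare e = n%:R^-1 * \sum_i negent P (h i) - ln n%:R.
Proof.
move=> he.
have fib i t : prob timeshare [pred q | e q == e (i, t)] =
    n%:R^-1 * prob P [pred t' | h i t' == h i t].
  transitivity (\sum_q timeshare q * ((q.1 == i) && (h q.1 q.2 == h i t))%:R).
    rewrite probE; apply: eq_bigr => q _; congr (_ * _%:R); congr nat_of_bool.
    by apply/eqP/andP => [/he /= [-> ->]|[/eqP E1 /eqP E2]]; [rewrite !eqxx | apply/he].
  rewrite (timeshare_expect (fun j s => ((j == i) && (h j s == h i t))%:R)); congr (_ * _).
  rewrite (bigD1 i) //= [X in _ + X]big1 ?addr0 => [|j /negPf ji]; last first.
    by apply: big1 => s _; rewrite ji mulr0.
  by rewrite probE; apply: eq_bigr => s _; rewrite eqxx.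
rewrite negentE.
transitivity (\sum_q timeshare q * (ln (prob P [pred t' | h q.1 t' == h q.1 q.2]) - ln n%:R)).
  apply: eq_bigr => -[i t] _; rewrite fib /=.
  have := pP.1 t; rewrite /timeshare /= le_eqVlt => /orP[/eqP<-|Pt]; first by rewrite mulr0 !mul0r.
  rewrite lnM ?posrE ?invr_gt0 ?ltr0n ?prob_self_gt0 //; last exact: pP.1.
  by rewrite lnV ?posrE ?ltr0n // addrC.
under eq_bigr do rewrite mulrBr; rewrite sumrB; congr (_ - _).
  rewrite (timeshare_expect (fun i t => ln (prob P [pred t' | h i t' == h i t]))).
  by congr (_ * _); apply: eq_bigr => i _; rewrite negentE.
rewrite (timeshare_expect (fun _ _ => ln n%:R)).
under eq_bigr do rewrite -mulr_suml pP.2 mul1r.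
exact: avg_const.
Qed.

Lemma law_letter (A : finType) (phi : O -> A) i a :
  prob P [pred t : Om | phi (t i) == a] = prob p [pred o | phi o == a].
Proof. by rewrite !probE; apply: (iid_expect1 i (fun o => (phi o == a)%:R) source_pmf_pmf). Qed.

(** Letters are identically distributed, so the letter at a random index has the law of each of
    them. *)
Lemma negent_timeshare_letter (A : finType) (phi : O -> A) :
  negent timeshare (fun q => phi (q.2 q.1)) = n%:R^-1 * \sum_i negent P (fun t => phi (t i)).
Proof.
have E i : negent P (fun t => phi (t i)) = negent p phi.
  by apply: eq_bigr => a _; rewrite law_letter.
under [in RHS]eq_bigr do rewrite E.
rewrite avg_const.
apply: eq_bigr => a _; congr xlnx; rewrite probE.
rewrite (timeshare_expect (fun i t => (phi (t i) == a)%:R)).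
under eq_bigr do rewrite (iid_expect1 _ (fun o => (phi o == a)%:R) source_pmf_pmf).
by rewrite avg_const probE.
Qed.

Let sX (q : 'I_n * Om) := (q.2 q.1).1.1.
Let sY (q : 'I_n * Om) := (q.2 q.1).1.2.
Let sZ (q : 'I_n * Om) := (q.2 q.1).2.
Let sU (q : 'I_n * Om) := auxU q.1 q.2.
Let sV (q : 'I_n * Om) := auxV q.1 q.2.

Lemma timeshare_rate1 : ln 2 * condMI timeshare sU sY sZ <= n%:R^-1 * ln M1%:R.
Proof.
rewrite condMI_negent; last exact: timeshare_ge0.
rewrite (@negent_timeshare _ _ (fun i t => (auxU i t, (t i).1.2, (t i).2))
  (fun q => (sU q, sY q, sZ q))); last first.
  by move=> [i t] [i' t']; rewrite /sU /sY /sZ /auxU /=; split=> [[-> -> -> -> -> ->]|[-> [-> -> -> -> ->]]].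
rewrite (@negent_timeshare _ _ (fun i t => (auxU i t, (t i).2)) (fun q => (sU q, sZ q))); last first.
  by move=> [i t] [i' t']; rewrite /sU /sY /sZ /auxU /=; split=> [[-> -> -> -> ->]|[-> [-> -> -> ->]]].
rewrite (negent_timeshare_letter (fun o => o.2)) (negent_timeshare_letter (fun o => (o.1.2, o.2))).
have E (k a b c e l : R) : k * a - l + k * b - (k * c - l + k * e) = k * (a + b - (c + e)) by ring.
rewrite {}E -!big_split -sumrB ler_pM2l ?invr_gt0 ?ltr0n //; apply: le_trans uncert1_sum.
by apply: ler_sum => i _; apply: uncert1_step.
Qed.

Lemma timeshare_rate : ln 2 * condMI timeshare sX sV (fun q => (sU q, sZ q)) <= n%:R^-1 * ln M%:R.
Proof.
rewrite condMI_negent; last exact: timeshare_ge0.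
rewrite (@negent_timeshare _ _ (fun i t => ((t i).1.1, auxV i t, (auxU i t, (t i).2)))
  (fun q => (sX q, sV q, (sU q, sZ q)))); last first.
  move=> [i t] [i' t']; rewrite /sX /sV /sU /sZ /=.
  by split=> [[-> -> -> E1 E2 E3 ->]|[-> [-> -> E1 E2 E3 ->]]]; rewrite /auxU E1 E2 E3.
rewrite (@negent_timeshare _ _ (fun i t => (auxU i t, (t i).2)) (fun q => (sU q, sZ q))); last first.
  by move=> [i t] [i' t']; rewrite /sU /sZ /auxU /=; split=> [[-> -> -> -> ->]|[-> [-> -> -> ->]]].
rewrite (@negent_timeshare _ _ (fun i t => ((t i).1.1, (auxU i t, (t i).2)))
  (fun q => (sX q, (sU q, sZ q)))); last first.
  by move=> [i t] [i' t']; rewrite /sX /sU /sZ /auxU /=; split=> [[-> -> -> -> -> ->]|[-> [-> -> -> -> ->]]].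
rewrite (@negent_timeshare _ _ (fun i t => (auxV i t, (auxU i t, (t i).2)))
  (fun q => (sV q, (sU q, sZ q)))); last first.
  by move=> [i t] [i' t']; rewrite /sV /sU /sZ /auxU /=; split=> [[-> -> -> -> -> ->]|[-> [-> -> -> -> ->]]].
have E (k a b c e l : R) : k * a - l + (k * b - l) - (k * c - l + (k * e - l)) = k * (a + b - (c + e)).
  by ring.
rewrite {}E -!big_split -sumrB ler_pM2l ?invr_gt0 ?ltr0n //; apply: le_trans uncert_sum.
by apply: ler_sum => i _; apply: uncert_step.
Qed.

Variables (x0 : X) (z0 : Z).

(** The law of U given Y = y: the other letters stay random. [x0] and [z0] are placeholders, as U_i
    depends on its own letter only through Y_i. *)
Definition kernelU (y : Y) u : R :=
  n%:R^-1 * \sum_i \sum_t iid p t * (auxU i (upd t i (x0, y, z0)) == u)%:R.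

(** The mass of (X,U,V). Here [y] is averaged because [T1], and through it V_i, depends on Y_i; [z0]
    is a placeholder. *)
Definition massXUV (x : X) u (v : V) : R := \sum_y pXY (x, y) *
  (n%:R^-1 * \sum_i \sum_t iid p t *
     ((auxU i (upd t i (x0, y, z0)) == u) && (auxV i (upd t i (x, y, z0)) == v))%:R).

(** The prefix stops before [i], the side information has a hole at [i], and [T1] reads Y only. This
    is the chain U - Y - (X,Z). *)
Lemma auxU_upd i (t : Om) x y z : auxU i (upd t i (x, y, z)) = auxU i (upd t i (x0, y, z0)).
Proof.
rewrite /auxU !others_upd (_ : msg1 (upd t i (x, y, z)) = msg1 (upd t i (x0, y, z0))); last first.
  by congr f1; apply/ffunP => j; rewrite !ffunE; case: eqP.
congr (_, _, _, _); apply/prefix_ofP => j ji; rewrite !ffunE.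
by case: eqP ji => // ->; rewrite ltnn.
Qed.

(** Messages do not read Z, and [auxV] overwrites the letter Z_i. With [auxU_upd] this gives (U,V) -
    X - Z. *)
Lemma auxV_upd i (t : Om) x y z : auxV i (upd t i (x, y, z)) = auxV i (upd t i (x, y, z0)).
Proof.
have E1 : msg1 (upd t i (x, y, z)) = msg1 (upd t i (x, y, z0)).
  by congr f1; apply/ffunP => j; rewrite !ffunE; case: eqP.
have E2 : xs (upd t i (x, y, z)) = xs (upd t i (x, y, z0)).
  by apply/ffunP => j; rewrite !ffunE; case: eqP.
apply/ffunP => z'; rewrite !ffunE /msg E1 E2; congr (g _ _ _ _).
by apply/ffunP => j; rewrite !ffunE; case: eqP.
Qed.

Lemma kernelU_pmf y : is_pmf (kernelU y).
Proof.
split=> [u|].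
  rewrite mulr_ge0 ?invr_ge0 ?ler0n // sumr_ge0 // => i _; apply: sumr_ge0 => t _.
  by rewrite mulr_ge0 ?pP.1 ?ler0n.
rewrite -mulr_sumr exchange_big /= -[RHS](avg_const 1); congr (_ * _); apply: eq_bigr => i _.
rewrite exchange_big /= -[RHS]pP.2; apply: eq_bigr => t _; by rewrite -mulr_sumr sum_delta1 mulr1.
Qed.

Lemma massXUV_ge0 x u v : 0 <= massXUV x u v.
Proof.
apply: sumr_ge0 => y _; rewrite mulr_ge0 ?hXY.1 // mulr_ge0 ?invr_ge0 ?ler0n //.
by apply: sumr_ge0 => i _; apply: sumr_ge0 => t _; rewrite mulr_ge0 ?pP.1 ?ler0n.
Qed.

Lemma massXUV_sum x u : \sum_v massXUV x u v = \sum_y pXY (x, y) * kernelU y u.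
Proof.
rewrite exchange_big; apply: eq_bigr => y _; rewrite -mulr_sumr -mulr_sumr; congr (_ * (_ * _)).
rewrite exchange_big; apply: eq_bigr => i _; rewrite exchange_big; apply: eq_bigr => t _ /=.
rewrite -mulr_sumr; congr (_ * _); under eq_bigr do rewrite -mulnb natrM.
by rewrite -mulr_sumr sum_delta1 mulr1.
Qed.

Lemma law_timeshare_UYZ u y z : prob timeshare [pred q | (sU q, sY q, sZ q) == (u, y, z)] =
  kernelU y u * \sum_x pXY (x, y) * pZ x z.
Proof.
rewrite probE (timeshare_resample (fun i t => ((auxU i t, (t i).1.2, (t i).2) == (u, y, z))%:R)).
rewrite /kernelU -mulrA; congr (_ * _); rewrite mulr_suml; apply: eq_bigr => i _.
rewrite mulr_suml; apply: eq_bigr => t _; rewrite -mulrA; congr (_ * _).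
rewrite sum_pair sum_pair /= mulr_sumr; apply: eq_bigr => x _ /=.
transitivity (\sum_y' (\sum_z' p (x, y', z') * (auxU i (upd t i (x0, y', z0)) == u)%:R * (z' == z)%:R)
   * (y' == y)%:R).
  apply: eq_bigr => y' _; rewrite mulr_suml; apply: eq_bigr => z' _.
  by rewrite upd_same auxU_upd !xpair_eqE -!mulnb !natrM /=; ring.
by rewrite sum_delta sum_delta mulrC.
Qed.

Lemma law_timeshare_XVUZ x v u z :
  prob timeshare [pred q | (sX q, sV q, (sU q, sZ q)) == (x, v, (u, z))] = massXUV x u v * pZ x z.
Proof.
rewrite probE (timeshare_resample
  (fun i t => (((t i).1.1, auxV i t, (auxU i t, (t i).2)) == (x, v, (u, z)))%:R)).
transitivity (\sum_y n%:R^-1 * \sum_i \sum_t iid p t * (p (x, y, z) *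
  ((auxU i (upd t i (x0, y, z0)) == u) && (auxV i (upd t i (x, y, z0)) == v))%:R)); last first.
  rewrite /massXUV mulr_suml; apply: eq_bigr => y _; rewrite [RHS]mulrAC [RHS]mulrCA; congr (_ * _).
  rewrite mulr_sumr; apply: eq_bigr => i _; rewrite mulr_sumr; apply: eq_bigr => t _.
  by rewrite /source_pmf /=; ring.
rewrite -mulr_sumr; congr (_ * _).
rewrite [RHS]exchange_big; apply: eq_bigr => i _; rewrite [RHS]exchange_big; apply: eq_bigr => t _ /=.
rewrite -[RHS]mulr_sumr; congr (_ * _).
rewrite sum_pair sum_pair /=.
transitivity (\sum_x' (\sum_y \sum_z' p (x', y, z') *
   ((auxU i (upd t i (x0, y, z0)) == u) && (auxV i (upd t i (x', y, z0)) == v))%:R * (z' == z)%:R)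
   * (x' == x)%:R).
  apply: eq_bigr => x' _; rewrite mulr_suml; apply: eq_bigr => y' _.
  rewrite mulr_suml; apply: eq_bigr => z' _.
  by rewrite upd_same auxU_upd auxV_upd !xpair_eqE -!mulnb !natrM /=; ring.
by rewrite sum_delta; apply: eq_bigr => y _; rewrite sum_delta.
Qed.

Lemma timeshare_distortion (d : X -> Xh -> R) :
  \sum_q timeshare q * d (sX q) (sV q (sZ q)) = expected_distortion pXY pZ d f1 f g.
Proof.
rewrite (timeshare_expect (fun i t => d (t i).1.1 (auxV i t (t i).2))).
rewrite exchange_big /= mulr_sumr; apply: eq_bigr => t _.
rewrite -mulr_sumr mulrCA; congr (_ * (_ * _)); apply: eq_bigr => i _.
rewrite !ffunE; congr (d _ (g _ _ _ _)).
by apply/ffunP => j; rewrite !ffunE; case: eqP => // ->.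
Qed.

End BlockCode.

(** The alphabet of U still grows with [n] at this stage; that of W is already [{ffun Z -> Xh}]. *)
Theorem block_code_single_letter (R : realType) (X Y Z Xh : finType)
  (pXY : X * Y -> R) (pZ : X -> Z -> R) (d : X -> Xh -> R) (n M1 M : nat)
  (f1 : {ffun 'I_n -> Y} -> 'I_M1) (f : {ffun 'I_n -> X} -> 'I_M1 -> 'I_M)
  (g : 'I_M -> 'I_M1 -> {ffun 'I_n -> Z} -> {ffun 'I_n -> Xh}) :
  is_pmf pXY -> (forall x, is_pmf (pZ x)) -> (0 < n)%N ->
  exists (U : finType) (pU : Y -> U -> R) (pW : X * U -> {ffun Z -> Xh} -> R),
  [/\ forall y, is_pmf (pU y), forall xu, is_pmf (pW xu) &
  let P := joint5 pXY pZ pU pW in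
  [/\ ln 2 * condMI P (fun o => o.1.2) (fun o => o.1.1.1.2) (fun o => o.1.1.2) <= n%:R^-1 * ln M1%:R,
      ln 2 * condMI P (fun o => o.1.1.1.1) (fun o => o.2) (fun o => (o.1.2, o.1.1.2)) <=
        n%:R^-1 * ln M%:R &
      \sum_o P o * d o.1.1.1.1 (o.2 o.1.1.2) = expected_distortion pXY pZ d f1 f g]].
Proof.
move=> hXY hZ n0.
have [[[x0 y0] z0] _] := exists_le_average (fun=> 0) (source_pmf_pmf hXY hZ).1 (source_pmf_pmf hXY hZ).2.
pose v0 := auxV f1 f g (Ordinal n0) [ffun=> (x0, y0, z0)].
pose k := kernelU pXY pZ f1 x0 z0.
pose N := massXUV pXY pZ f1 f g x0 z0.
have hk y : is_pmf (k y) by apply: kernelU_pmf.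
have N0 x u v : 0 <= N x u v by apply: massXUV_ge0.
have Nk x u : \sum_v N x u v = \sum_y pXY (x, y) * k y u by apply: massXUV_sum.
exists _, k, (cond_kernel N v0); split=> // [xu|P]; first exact: cond_kernel_pmf.
have lUYZ := law_timeshare_UYZ hXY hZ f1 x0 z0.
have lXVUZ := law_timeshare_XVUZ hXY hZ f1 f g x0 z0.
split.
- by rewrite (realize_UYZ v0 N0 lUYZ); apply: timeshare_rate1.
- by rewrite (realize_XVUZ v0 N0 Nk lXVUZ); apply: timeshare_rate.
- rewrite (realize_expect v0 N0 Nk lXVUZ (fun x v z => d x (v z))); exact: timeshare_distortion.
Qed.

(** * Cardinality bound on the helper's auxiliary variable *)

Section Caratheodory.
Variable R : realType.
Variables U I : finType.
Variable a : U -> I -> R.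

(** A matrix with more rows than columns has a nonzero left kernel vector; it is extended by zero
    outside [S]. *)
Lemma linear_relation (S : {pred U}) : (#|I| < #|S|)%N ->
  exists c : U -> R, [/\ forall u, u \notin S -> c u = 0, exists u, c u != 0 &
    forall i, \sum_u c u * a u i = 0].
Proof.
move=> IS.
pose A := \matrix_(k < #|S|, j < #|I|) a (enum_val k) (enum_val j).
have nzK : kermx A != 0.
  rewrite kermx_eq0 /row_free neq_ltn; apply/orP; left.
  exact: leq_ltn_trans (rank_leq_col A) IS.
have [k [l nz]] : exists k l, kermx A k l != 0 by apply/matrix0Pn.
pose r := row k (kermx A).
have rA : r *m A = 0 by rewrite -row_mul mulmx_ker row0.
pose c u := \sum_m r 0 m * (enum_val m == u)%:R.
have cE m : c (enum_val m) = r 0 m.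
  rewrite /c (bigD1 m) //= eqxx mulr1 big1 ?addr0 // => m' /negPf mm.
  by rewrite (inj_eq enum_val_inj) mm mulr0.
exists c; split.
- move=> u uS; rewrite /c big1 // => m _; case: eqP => [E|]; last by rewrite mulr0.
  by move: uS; rewrite -E enum_valP.
- by exists (enum_val l); rewrite cE /r mxE.
- move=> i.
  have E : \sum_m r 0 m * a (enum_val m) i = 0.
    have := congr1 (fun B : 'rV[R]_#|I| => B 0 (enum_rank i)) rA.
    rewrite mxE [RHS]mxE => E; rewrite -[RHS]E; apply: eq_bigr => m _.
    by rewrite [A _ _]mxE enum_rankK.
  rewrite -[RHS]E (eq_bigr (fun u => \sum_m r 0 m * (enum_val m == u)%:R * a u i)); last first.
    by move=> u _; rewrite /c mulr_suml.
  rewrite exchange_big; apply: eq_bigr => m _ /=.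
  rewrite (bigD1 (enum_val m)) //= eqxx mulr1 [X in _ + X]big1 ?addr0 // => u /negPf um.
  by rewrite eq_sym um mulr0 mul0r.
Qed.

Definition supp (t : U -> R) : {pred U} := [pred u | t u != 0].

(** Subtract from [t] the largest multiple of a linear relation that preserves nonnegativity: a
    coordinate of the support becomes zero. *)
Lemma shrink_support (t : U -> R) : (forall u, 0 <= t u) -> (#|I| < #|supp t|)%N ->
  exists t' : U -> R, [/\ forall u, 0 <= t' u, (#|supp t'| < #|supp t|)%N &
    forall i, \sum_u t' u * a u i = \sum_u t u * a u i].
Proof.
move=> t0 It.
(* Up to a sign the relation has a positive entry, which makes that multiple finite. *)
have [c [c0 [u1 pos] cA]] : exists c : U -> R, [/\ forall u, u \notin supp t -> c u = 0,
    exists u, 0 < c u & forall i, \sum_u c u * a u i = 0].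
  have [c [c0 [u nz] cA]] := linear_relation It.
  have [pos|neg|/eqP] := ltgtP 0 (c u); last by rewrite eq_sym (negPf nz).
    by exists c; split => //; exists u.
  exists (fun u => - c u); split; first by move=> v /c0 ->; rewrite oppr0.
    by exists u; rewrite oppr_gt0.
  by move=> i; under eq_bigr do rewrite mulNr; rewrite sumrN cA oppr0.
pose u0 := [arg min_(u < u1 | 0 < c u) (t u / c u)]%O.
have [cu0 min0] : 0 < c u0 /\ forall u, 0 < c u -> t u0 / c u0 <= t u / c u.
  by rewrite /u0; case: arg_minP => // u cu H; split.
pose s := t u0 / c u0.
have s0 : 0 <= s by rewrite divr_ge0 // ltW.
have tu0 : t u0 != 0.
  by apply: contraTT cu0 => h; rewrite -leNgt c0 // inE h.
exists (fun u => t u - s * c u); split.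
- move=> u; rewrite subr_ge0; have [cu|cu] := ltP 0 (c u).
    by rewrite -ler_pdivlMr // min0.
  by apply: le_trans (t0 u); rewrite mulr_ge0_le0.
- apply: proper_card; apply/properP; split.
    apply/fintype.subsetP => u; rewrite !inE; apply: contraNN => /eqP tu.
    by rewrite tu c0 ?mulr0 ?subrr // inE tu eqxx.
  exists u0; first by rewrite inE.
  by rewrite inE negbK /s divfK ?subrr // gt_eqF.
- move=> i; under eq_bigr do rewrite mulrBl -mulrA.
  by rewrite sumrB -mulr_sumr cA mulr0 subr0.
Qed.

(** Conic form, starting from the constant weight 1 and shrinking the support while it is too
    large. *)
Theorem caratheodory : exists t : U -> R, [/\ forall u, 0 <= t u, (#|supp t| <= #|I|)%N &
  forall i, \sum_u t u * a u i = \sum_u a u i].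
Proof.
have H m : forall t : U -> R, (forall u, 0 <= t u) -> (#|supp t| <= m)%N ->
    exists t' : U -> R, [/\ forall u, 0 <= t' u, (#|supp t'| <= #|I|)%N &
    forall i, \sum_u t' u * a u i = \sum_u t u * a u i].
  elim: m => [|m IH] t t0 tm.
    by exists t; split=> //; apply: leq_trans tm _.
  have [le|lt] := leqP #|supp t| #|I|; first by exists t.
  have [t' [t'0 t't E]] := shrink_support t0 lt.
  have [t'' [? ? E']] := IH t' t'0 (leq_trans t't tm).
  by exists t''; split=> // i; rewrite E' E.
have [t [t0 tI E]] := H #|U| (fun=> 1) (fun=> ler01) (max_card _).
by exists t; split=> // i; rewrite E; apply: eq_bigr => u _; rewrite mul1r.
Qed.

End Caratheodory.

(** * Reweighting the values of the helper's auxiliary variable *)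

Section Reweight.
Variable R : realType.
Variables X Y Z W : finType.
Variables (pXY : X * Y -> R) (pZ : X -> Z -> R).
Hypothesis hXY : is_pmf pXY.
Hypothesis hZ : forall x, is_pmf (pZ x).

Lemma prob_aux (U B : finType) (P : X * Y * Z * U * W -> R) (h : X * Y * Z -> W -> B) u b :
  prob P [pred o | (o.1.2, h o.1.1 o.2) == (u, b)] = \sum_s \sum_w P (s, u, w) * (h s w == b)%:R.
Proof.
rewrite probE sum_pair sum_pair; apply: eq_bigr => s _ /=.
rewrite (bigD1 u) //= [X in _ + X]big1 ?addr0 => [|u' /negPf uu].
  by apply: eq_bigr => w _; rewrite xpair_eqE eqxx.
by apply: big1 => w _; rewrite xpair_eqE uu mulr0.
Qed.

Lemma xlnxM (c x : R) : 0 <= c -> 0 <= x -> xlnx (c * x) = c * xlnx x + xlnx c * x.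
Proof.
rewrite /xlnx !le_eqVlt => /orP[/eqP <-|c0]; first by move=> _; rewrite !mul0r addr0.
move=> /orP[/eqP <-|x0]; first by rewrite !(mulr0, mul0r) addr0.
by rewrite lnM ?posrE //; ring.
Qed.

Variables (U J : finType) (pU : Y -> U -> R) (pW : X * U -> W -> R).
Hypothesis hU : forall y, is_pmf (pU y).
Hypothesis hW : forall xu, is_pmf (pW xu).
Variables (e : J -> U) (c : J -> R).
Hypothesis c0 : forall j, 0 <= c j.

Definition rwU (y : Y) (j : J) : R := c j * pU y (e j).
Definition rwW (xj : X * J) (w : W) : R := pW (xj.1, e xj.2) w.

Local Notation P := (joint5 pXY pZ pU pW).
Local Notation P' := (joint5 pXY pZ rwU rwW).

Let P0 : forall o, 0 <= P o := joint5_ge0 hXY hZ hU hW.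

(** The share of the value [u] in the minus entropy of U paired with [h]. *)
Definition aux_negent (B : finType) (h : X * Y * Z -> W -> B) (u : U) : R :=
  \sum_b xlnx (prob P [pred o | (o.1.2, h o.1.1 o.2) == (u, b)]).

Lemma negent_aux (B : finType) (h : X * Y * Z -> W -> B) :
  negent P (fun o => (o.1.2, h o.1.1 o.2)) = \sum_u aux_negent h u.
Proof. by rewrite /negent sum_pair. Qed.

(** Linear in the weights except for the second sum. That sum does not involve [h], so it cancels
    between entropies of opposite sign. *)
Lemma negent_reweight (B : finType) (h : X * Y * Z -> W -> B) :
  negent P' (fun o => (o.1.2, h o.1.1 o.2)) =
  \sum_j c j * aux_negent h (e j) + \sum_j xlnx (c j) * prob P [pred o | o.1.2 == e j].
Proof.
rewrite /negent sum_pair -big_split; apply: eq_bigr => j _ /=.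
rewrite -(sum_prob_pair P (fun o => h o.1.1 o.2) (fun o => o.1.2) (e j)).
rewrite /aux_negent !mulr_sumr -big_split; apply: eq_bigr => b _ /=.
have -> : prob P [pred o | (h o.1.1 o.2 == b) && (o.1.2 == e j)] =
  prob P [pred o | (o.1.2, h o.1.1 o.2) == (e j, b)].
  by apply: eq_prob => o /=; rewrite xpair_eqE andbC.
rewrite -xlnxM ?prob_ge0 //; congr xlnx; rewrite !prob_aux mulr_sumr.
apply: eq_bigr => s _; rewrite mulr_sumr; apply: eq_bigr => w _.
by rewrite /joint5 /rwU /rwW /=; ring.
Qed.

Hypothesis rwU_pmf : forall y, is_pmf (rwU y).

Lemma rwW_pmf xj : is_pmf (rwW xj).
Proof. exact: hW. Qed.

Let P'0 : forall o, 0 <= P' o := joint5_ge0 hXY hZ rwU_pmf rwW_pmf.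

Let hYZ (s : X * Y * Z) (w : W) := (s.1.2, s.2).
Let hz (s : X * Y * Z) (w : W) := s.2.
Let hXWZ (s : X * Y * Z) (w : W) := (s.1.1, w, s.2).
Let hXZ (s : X * Y * Z) (w : W) := (s.1.1, s.2).
Let hWZ (s : X * Y * Z) (w : W) := (w, s.2).

(** The share of [u] in I(U;Y|Z), up to entropies of (Y,Z) and Z, which reweighting preserves.
    [info2] is its share in I(X;W|U,Z). *)
Definition info1 u := aux_negent hYZ u - aux_negent hz u.
Definition info2 u := aux_negent hXWZ u + aux_negent hz u - (aux_negent hXZ u + aux_negent hWZ u).

Lemma reweight_condMI1 : \sum_j c j * info1 (e j) = \sum_u info1 u ->
  condMI P' (fun o => o.1.2) (fun o => o.1.1.1.2) (fun o => o.1.1.2) =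
  condMI P (fun o => o.1.2) (fun o => o.1.1.1.2) (fun o => o.1.1.2).
Proof.
move=> E; apply: (mulfI (x := ln 2)); first by rewrite gt_eqF // ln2_gt0.
rewrite !condMI_negent //.
have -> : negent P' (fun o => o.1.1.2) = negent P (fun o => o.1.1.2).
  by apply: eq_bigr => z _; rewrite marg_Z // ?marg_Z // => xu; apply: rwW_pmf.
have -> : negent P' (fun o => (o.1.1.1.2, o.1.1.2)) = negent P (fun o => (o.1.1.1.2, o.1.1.2)).
  by apply: eq_bigr => -[y z] _; rewrite marg_YZ // ?marg_YZ // => xu; apply: rwW_pmf.
have relab (K : finType) (Q : X * Y * Z * K * W -> R) :
    negent Q (fun o => (o.1.2, o.1.1.1.2, o.1.1.2)) = negent Q (fun o => (o.1.2, hYZ o.1.1 o.2)).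
  by apply: negent_equiv => t t'; rewrite /hYZ /hXWZ /hXZ /hWZ; split=> -[-> -> ->].
rewrite !relab (negent_reweight hz) (negent_reweight hYZ) (negent_aux hz) (negent_aux hYZ).
move: E; rewrite /info1 sumrB.
under eq_bigr do rewrite mulrBr; rewrite sumrB => E.
rewrite [LHS](_ : _ = (\sum_j c j * aux_negent hYZ (e j) - \sum_j c j * aux_negent hz (e j)) +
  negent P (fun o => o.1.1.2) - negent P (fun o => (o.1.1.1.2, o.1.1.2))); last by ring.
by rewrite E; ring.
Qed.

Lemma reweight_condMI2 : \sum_j c j * info2 (e j) = \sum_u info2 u ->
  condMI P' (fun o => o.1.1.1.1) (fun o => o.2) (fun o => (o.1.2, o.1.1.2)) =
  condMI P (fun o => o.1.1.1.1) (fun o => o.2) (fun o => (o.1.2, o.1.1.2)).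
Proof.
move=> E; apply: (mulfI (x := ln 2)); first by rewrite gt_eqF // ln2_gt0.
rewrite !condMI_negent //.
have relab1 (K : finType) (Q : X * Y * Z * K * W -> R) :
    negent Q (fun o => (o.1.1.1.1, o.2, (o.1.2, o.1.1.2))) = negent Q (fun o => (o.1.2, hXWZ o.1.1 o.2)).
  by apply: negent_equiv => t t'; rewrite /hYZ /hXWZ /hXZ /hWZ; split=> -[-> -> -> ->].
have relab2 (K : finType) (Q : X * Y * Z * K * W -> R) :
    negent Q (fun o => (o.1.1.1.1, (o.1.2, o.1.1.2))) = negent Q (fun o => (o.1.2, hXZ o.1.1 o.2)).
  by apply: negent_equiv => t t'; rewrite /hYZ /hXWZ /hXZ /hWZ; split=> -[-> -> ->].
have relab3 (K : finType) (Q : X * Y * Z * K * W -> R) :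
    negent Q (fun o => (o.2, (o.1.2, o.1.1.2))) = negent Q (fun o => (o.1.2, hWZ o.1.1 o.2)).
  by apply: negent_equiv => t t'; rewrite /hYZ /hXWZ /hXZ /hWZ; split=> -[-> -> ->].
rewrite !relab1 !relab2 !relab3.
rewrite (negent_reweight hz) (negent_reweight hXWZ) (negent_reweight hXZ) (negent_reweight hWZ).
rewrite (negent_aux hz) (negent_aux hXWZ) (negent_aux hXZ) (negent_aux hWZ).
move: E; rewrite /info2 sumrB !big_split /=.
under eq_bigr do rewrite mulrBr !mulrDr; rewrite sumrB !big_split /= => E.
rewrite -{}E; ring.
Qed.

Definition cost (d : X -> Z -> W -> R) (u : U) : R :=
  \sum_s \sum_w P (s, u, w) * d s.1.1 s.2 w.

Lemma expect_cost (d : X -> Z -> W -> R) :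
  \sum_o P o * d o.1.1.1.1 o.1.1.2 o.2 = \sum_u cost d u.
Proof. by rewrite sum_pair sum_pair exchange_big. Qed.

Lemma reweight_cost (d : X -> Z -> W -> R) :
  \sum_o P' o * d o.1.1.1.1 o.1.1.2 o.2 = \sum_j c j * cost d (e j).
Proof.
rewrite sum_pair sum_pair exchange_big; apply: eq_bigr => j _ /=.
rewrite mulr_sumr; apply: eq_bigr => s _; rewrite mulr_sumr; apply: eq_bigr => w _.
by rewrite /joint5 /rwU /rwW /=; ring.
Qed.

End Reweight.

Theorem bounded_auxiliary (R : realType) (X Y Z U W : finType)
  (pXY : X * Y -> R) (pZ : X -> Z -> R) (pU : Y -> U -> R) (pW : X * U -> W -> R)
  (d : X -> Z -> W -> R) :
  is_pmf pXY -> (forall x, is_pmf (pZ x)) ->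
  (forall y, is_pmf (pU y)) -> (forall xu, is_pmf (pW xu)) ->
  exists (qU : Y -> 'I_(#|Y| + 3) -> R) (qW : X * 'I_(#|Y| + 3) -> W -> R),
  [/\ forall y, is_pmf (qU y), forall xu, is_pmf (qW xu) &
  let P := joint5 pXY pZ pU pW in let Q := joint5 pXY pZ qU qW in
  [/\ condMI Q (fun o => o.1.2) (fun o => o.1.1.1.2) (fun o => o.1.1.2) =
      condMI P (fun o => o.1.2) (fun o => o.1.1.1.2) (fun o => o.1.1.2),
      condMI Q (fun o => o.1.1.1.1) (fun o => o.2) (fun o => (o.1.2, o.1.1.2)) =
      condMI P (fun o => o.1.1.1.1) (fun o => o.2) (fun o => (o.1.2, o.1.1.2)) &
      \sum_o Q o * d o.1.1.1.1 o.1.1.2 o.2 = \sum_o P o * d o.1.1.1.1 o.1.1.2 o.2]].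
Proof.
move=> hXY hZ hU hW.
have [[x0 y0] _] := exists_le_average (fun=> 0) hXY.1 hXY.2.
have [u0 _] := exists_le_average (fun=> 0) (hU y0).1 (hU y0).2.
(* Linear functionals to preserve: [#|Y|] normalizations, which keep every row of the new kernel a
   pmf, the two informations and the cost. Their number is the size of the new alphabet. *)
pose a u (i : Y + 'I_3) : R := match i with
  | inl y => pU y u
  | inr k => if k == 0 :> nat then info1 pXY pZ pU pW u
             else if k == 1%N :> nat then info2 pXY pZ pU pW u else cost pXY pZ pU pW d u end.
have [t [t0 card_t tE]] := caratheodory a.
rewrite card_sum card_ord in card_t.
pose s := enum (supp t).
have s_size : (size s <= #|Y| + 3)%N by rewrite -cardE.
(* The new letters enumerate the support; surplus letters point to [u0] and get weight zero. *)
pose e (j : 'I_(#|Y| + 3)) := nth u0 s j.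
pose c (j : 'I_(#|Y| + 3)) : R := if (j < size s)%N then t (e j) else 0.
have c0 j : 0 <= c j by rewrite /c; case: ifP.
have push (phi : U -> R) : \sum_j c j * phi (e j) = \sum_u t u * phi u.
  transitivity (\sum_(u <- s) t u * phi u); last first.
    rewrite big_enum_cond /= big_mkcond; apply: eq_bigr => u _.
    by rewrite inE; case: eqP => [->|//]; rewrite mul0r.
  rewrite (big_nth u0) big_mkord (big_ord_widen _ (fun i => t (nth u0 s i) * phi (nth u0 s i)) s_size).
  rewrite [RHS]big_mkcond; apply: eq_bigr => j _; rewrite /c.
  by case: ifP; rewrite ?mul0r.
have rwp y : is_pmf (rwU pU e c y).
  split=> [j|]; first by rewrite mulr_ge0 ?(hU y).1.
  by rewrite (push (pU y)) (tE (inl y)) (hU y).2.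
exists (rwU pU e c), (rwW pW e); split=> //; first by move=> xu; apply: hW.
split.
- by apply: reweight_condMI1 => //; rewrite (push (info1 pXY pZ pU pW)); apply: (tE (inr 0)).
- apply: reweight_condMI2 => //; rewrite (push (info2 pXY pZ pU pW)).
  exact: (tE (inr 1)).
- rewrite reweight_cost (push (cost pXY pZ pU pW d)) expect_cost.
  exact: (tE (inr (@Ordinal 3 2 isT))).
Qed.

(** * Closedness of the single-letter region *)

Section Limits.
Variable R : realType.

Lemma ultra_fmap (T S : Type) (f : T -> S) (F : set_system T) :
  UltraFilter F -> UltraFilter (f @ F).
Proof.
move=> FU; apply: Build_UltraFilter.
move=> G GP FG; apply/seteqP; split => A GA; last exact: FG.
have [//|FnA] := in_ultra_setVsetC (f @^-1` A) FU.
have : G (A `&` ~` A) by apply: filterI => //; apply: FG.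
by rewrite setICr => G0; have := @filter_not_empty _ G GP.
Qed.

(** Compactness of the unit interval in ultrafilter form: a single ultrafilter makes all entries of
    the kernels converge, with no successive extraction of subsequences. *)
Lemma ultra_cvg01 (T : Type) (F : set_system T) (u : T -> R) : UltraFilter F ->
  (forall t, 0 <= u t <= 1) -> exists l : R, u @ F --> l.
Proof.
move=> FU u01.
have := @segment_compact R 0 1; rewrite compact_ultra => /(_ (u @ F) (ultra_fmap _ FU)).
case; last by move=> l [_ ul]; exists l.
by apply: (@filterS _ F _ setT _ _ filterT) => t _ /=; rewrite in_itv /= u01.
Qed.

(** With [s] the square root of [x], [- ln s <= s^-1 - 1] gives - x ln x <= 2 (s - s^2). It yields
    continuity at zero, where [ln] itself is not continuous. *)
Lemma xlnx_norm_le (x : R) : 0 <= x -> x <= 1 -> `|xlnx x| <= 2 * Num.sqrt x.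
Proof.
rewrite le_eqVlt => /orP[/eqP <- _|x0 x1]; first by rewrite /xlnx mul0r normr0 sqrtr0 mulr0.
set s := Num.sqrt x.
have s0 : 0 < s by rewrite sqrtr_gt0.
have xE : x = s * s by rewrite -expr2 sqr_sqrtr // ltW.
rewrite ler0_norm; last by rewrite /xlnx mulr_ge0_le0 ?(ltW x0) // ln_le0.
have iv : - ln s <= s^-1 - 1.
  by rewrite -lnV ?posrE //; apply: ln_le_sub1; rewrite invr_gt0.
rewrite /xlnx [in ln _]xE lnM ?posrE // xE.
have ss : s * s * s^-1 = s by rewrite mulfK // gt_eqF.
have := ler_wpM2l (ltW (mulr_gt0 s0 s0)) iv; rewrite mulrBr ss mulr1 => h.
have : 0 <= s * s by rewrite mulr_ge0 // ltW.
move: h; rewrite mulrN mulrDr; set a := s * s; set b := a * ln s => h a0; lra.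
Qed.

Variables (T : Type) (F : set_system T).
Context {FF : ProperFilter F}.

Lemma cvg_xlnx (f : T -> R) (l : R) : (forall t, 0 <= f t) -> 0 <= l ->
  f @ F --> l -> xlnx (f t) @[t --> F] --> xlnx l.
Proof.
move=> f0; rewrite le_eqVlt => /orP[/eqP <-|l0] fl; last first.
  by apply: cvgM => //; apply: continuous_cvg => //; apply: continuous_ln.
rewrite /xlnx mul0r; apply/cvgrPdist_le => eps eps0.
(* Below (eps / 2)^2 the square-root bound is at most [eps]; below 1 it is applicable. *)
have e0 : 0 < Num.min 1 ((eps / 2) ^+ 2) by rewrite lt_min ltr01 exprn_gt0 // divr_gt0.
move/cvgrPdist_le: fl => /(_ _ e0) h; apply: (@filterS _ F _ _ _ _ h) => t /=.
rewrite sub0r normrN ger0_norm // le_min => /andP[f1 fe].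
rewrite sub0r normrN; apply: le_trans (xlnx_norm_le (f0 t) f1) _.
rewrite mulrC -ler_pdivlMr // -[leRHS]ger0_norm ?divr_ge0 ?(ltW eps0) // -sqrtr_sqr.
by rewrite ler_sqrt ?exprn_ge0 ?divr_ge0 ?(ltW eps0).
Qed.

Lemma cvg_fsum (I : finType) (E : pred I) (f : I -> T -> R) (l : I -> R) :
  (forall i, f i @ F --> l i) -> \sum_(i | E i) f i t @[t --> F] --> \sum_(i | E i) l i.
Proof.
move=> fl; elim: (index_enum I) => [|i s IH].
  by under eq_fun do rewrite big_nil; rewrite big_nil; apply: cvg_cst.
under eq_fun do rewrite big_cons; rewrite big_cons; case: (E i) => //.
exact: cvgD.
Qed.

Variables X Y Z U W : finType.
Variables (pXY : X * Y -> R) (pZ : X -> Z -> R).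
Hypothesis hXY : is_pmf pXY.
Hypothesis hZ : forall x, is_pmf (pZ x).
Variables (qU : T -> Y -> U -> R) (qW : T -> X * U -> W -> R).
Hypothesis hqU : forall t y, is_pmf (qU t y).
Hypothesis hqW : forall t xu, is_pmf (qW t xu).
Variables (lU : Y -> U -> R) (lW : X * U -> W -> R).
Hypothesis cvgU : forall y u, qU t y u @[t --> F] --> lU y u.
Hypothesis cvgW : forall xu w, qW t xu w @[t --> F] --> lW xu w.

Lemma cvg_pmf (I : finType) (q : T -> I -> R) (l : I -> R) :
  (forall t, is_pmf (q t)) -> (forall i, q t i @[t --> F] --> l i) -> is_pmf l.
Proof.
move=> qp ql; split=> [i|].
  by apply: (cvgr_to_ge (ql i)); apply: filterS filterT => t _; apply: (qp t).1.
have h1 : \sum_i q t i @[t --> F] --> \sum_i l i by apply: cvg_fsum.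
have h2 : \sum_i q t i @[t --> F] --> (1 : R).
  by under eq_fun do rewrite (qp _).2; apply: cvg_cst.
exact: cvg_unique h1 h2.
Qed.

Lemma lU_pmf y : is_pmf (lU y).
Proof. exact: (cvg_pmf (fun t => hqU t y)). Qed.

Lemma lW_pmf xu : is_pmf (lW xu).
Proof. exact: (cvg_pmf (fun t => hqW t xu)). Qed.

Local Notation P t := (joint5 pXY pZ (qU t) (qW t)).
Local Notation L := (joint5 pXY pZ lU lW).

Lemma cvg_joint5 o : P t o @[t --> F] --> L o.
Proof. by apply: cvgM; [apply: cvgM; [exact: cvg_cst | exact: cvgU] | exact: cvgW]. Qed.

Lemma cvg_negent (A : finType) (f : X * Y * Z * U * W -> A) :
  negent (P t) f @[t --> F] --> negent L f.
Proof.
apply: cvg_fsum => a; apply: cvg_xlnx.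
- by move=> t; apply: prob_ge0; apply: joint5_ge0.
- by apply: prob_ge0; apply: joint5_ge0 => // *; [apply: lU_pmf | apply: lW_pmf].
- by apply: cvg_fsum => o; apply: cvg_joint5.
Qed.

Lemma cvg_condMI (A B C : finType) (f : X * Y * Z * U * W -> A) (g : X * Y * Z * U * W -> B)
    (h : X * Y * Z * U * W -> C) :
  condMI (P t) f g h @[t --> F] --> condMI L f g h.
Proof.
have nz : ln (2 : R) != 0 by rewrite gt_eqF // ln2_gt0.
have L0 o : 0 <= L o by apply: joint5_ge0 => // *; [apply: lU_pmf | apply: lW_pmf].
have E (Q : X * Y * Z * U * W -> R) : (forall o, 0 <= Q o) -> condMI Q f g h = (ln 2)^-1 *
    (negent Q (fun t => (f t, g t, h t)) + negent Q h
    - (negent Q (fun t => (f t, h t)) + negent Q (fun t => (g t, h t)))).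
  by move=> Q0; rewrite -condMI_negent // mulKf.
rewrite (E L L0) (_ : (fun t => condMI (P t) f g h) = fun t => (ln 2)^-1 *
    (negent (P t) (fun t => (f t, g t, h t)) + negent (P t) h
    - (negent (P t) (fun t => (f t, h t)) + negent (P t) (fun t => (g t, h t))))); last first.
  by apply/funext => t; apply: E; apply: joint5_ge0.
apply: cvgM; first exact: cvg_cst.
apply: cvgB; apply: cvgD; exact: cvg_negent.
Qed.

Lemma cvg_expect (phi : X * Y * Z * U * W -> R) :
  \sum_o P t o * phi o @[t --> F] --> \sum_o L o * phi o.
Proof. by apply: cvg_fsum => o; apply: cvgM; [exact: cvg_joint5 | exact: cvg_cst]. Qed.

End Limits.

Theorem single_letter_limit (R : realType) (X Y Z U W : finType)
  (pXY : X * Y -> R) (pZ : X -> Z -> R) (phi : X * Y * Z * U * W -> R) (r1 r D : R) :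
  is_pmf pXY -> (forall x, is_pmf (pZ x)) ->
  (forall eps, 0 < eps -> exists (qU : Y -> U -> R) (qW : X * U -> W -> R),
    [/\ forall y, is_pmf (qU y), forall xu, is_pmf (qW xu) &
     let P := joint5 pXY pZ qU qW in
     [/\ condMI P (fun o => o.1.2) (fun o => o.1.1.1.2) (fun o => o.1.1.2) <= r1 + eps,
         condMI P (fun o => o.1.1.1.1) (fun o => o.2) (fun o => (o.1.2, o.1.1.2)) <= r + eps &
         \sum_o P o * phi o <= D + eps]]) ->
  exists (qU : Y -> U -> R) (qW : X * U -> W -> R),
    [/\ forall y, is_pmf (qU y), forall xu, is_pmf (qW xu) &
     let P := joint5 pXY pZ qU qW in
     [/\ condMI P (fun o => o.1.2) (fun o => o.1.1.1.2) (fun o => o.1.1.2) <= r1,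
         condMI P (fun o => o.1.1.1.1) (fun o => o.2) (fun o => (o.1.2, o.1.1.2)) <= r &
         \sum_o P o * phi o <= D]].
Proof.
move=> hXY hZ H.
have /choice[q Hq] : forall m : nat, exists q : (Y -> U -> R) * (X * U -> W -> R),
    [/\ forall y, is_pmf (q.1 y), forall xu, is_pmf (q.2 xu) &
     let P := joint5 pXY pZ q.1 q.2 in
     [/\ condMI P (fun o => o.1.2) (fun o => o.1.1.1.2) (fun o => o.1.1.2) <= r1 + m.+1%:R^-1,
         condMI P (fun o => o.1.1.1.1) (fun o => o.2) (fun o => (o.1.2, o.1.1.2)) <= r + m.+1%:R^-1 &
         \sum_o P o * phi o <= D + m.+1%:R^-1]].
  move=> m; have e0 : 0 < m.+1%:R^-1 :> R by rewrite invr_gt0 ltr0n.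
  by have [qU [qW h]] := H _ e0; exists (qU, qW).
(* An ultrafilter refining the convergence to infinity, along which the excess [m.+1%:R^-1]
   vanishes. *)
have [F [FU ooF]] := @ultraFilterLemma nat \oo _.
have FF : ProperFilter F by exact: ultra_proper.
have pmf01 (I : finType) (p : I -> R) i : is_pmf p -> 0 <= p i <= 1.
  move=> pp; rewrite pp.1 -pp.2 (bigD1 i) //= lerDl sumr_ge0 // => j _; exact: pp.1.
have hqU m y : is_pmf ((q m).1 y) by have [] := Hq m.
have hqW m xu : is_pmf ((q m).2 xu) by have [] := Hq m.
have /choice[lU HU] : forall yu : Y * U, exists l : R, (q m).1 yu.1 yu.2 @[m --> F] --> l.
  by move=> yu; apply: (@ultra_cvg01 R _ _ _ FU) => m; apply: pmf01.
have /choice[lW HW] : forall xw : (X * U) * W, exists l : R, (q m).2 xw.1 xw.2 @[m --> F] --> l.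
  by move=> xw; apply: (@ultra_cvg01 R _ _ _ FU) => m; apply: pmf01.
pose kU y u := lU (y, u); pose kW xu w := lW (xu, w).
have cU y u : (q m).1 y u @[m --> F] --> kU y u by exact: (HU (y, u)).
have cW xu w : (q m).2 xu w @[m --> F] --> kW xu w by exact: (HW (xu, w)).
have small (eps : R) : 0 < eps -> \forall m \near F, m.+1%:R^-1 <= eps.
  move=> e0; apply: ooF; have := near_infty_natSinv_lt (PosNum e0).
  by apply: filterS => m /ltW.
have lim_le (f : nat -> R) l b : f m @[m --> F] --> l -> (forall m, f m <= b + m.+1%:R^-1) -> l <= b.
  move=> fl fb; apply/ler_addgt0Pr => eps e0; apply: (cvgr_to_le fl).
  by apply: filterS (small _ e0) => m me; apply: le_trans (fb m) _; rewrite lerD2l.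
exists kU, kW; split.
- by move=> y; apply: (@cvg_pmf R nat F FF U (fun m => (q m).1 y) (kU y) (hqU^~ y) (cU y)).
- by move=> xu; apply: (@cvg_pmf R nat F FF W (fun m => (q m).2 xu) (kW xu) (hqW^~ xu) (cW xu)).
split.
- apply: (lim_le (fun m => condMI (joint5 pXY pZ (q m).1 (q m).2)
    (fun o => o.1.2) (fun o => o.1.1.1.2) (fun o => o.1.1.2))) => [|m]; last by have [_ _ []] := Hq m.
  exact: (cvg_condMI hXY hZ hqU hqW cU cW).
- apply: (lim_le (fun m => condMI (joint5 pXY pZ (q m).1 (q m).2)
    (fun o => o.1.1.1.1) (fun o => o.2) (fun o => (o.1.2, o.1.1.2)))) => [|m].
    exact: (cvg_condMI hXY hZ hqU hqW cU cW).
  by have [_ _ []] := Hq m.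
- apply: (lim_le (fun m => \sum_o joint5 pXY pZ (q m).1 (q m).2 o * phi o)) => [|m].
    exact: (@cvg_expect R nat F FF X Y Z U W pXY pZ (fun m => (q m).1) (fun m => (q m).2) kU kW cU cW phi).
  by have [_ _ []] := Hq m.
Qed.

(** * Converse and equality of the two regions *)

Section Converse.
Variable R : realType.
Variables X Y Z Xh : finType.
Variables (pXY : X * Y -> R) (pZ : X -> Z -> R) (d : X -> Xh -> R) (D : R).
Hypothesis hXY : is_pmf pXY.
Hypothesis hZ : forall x, is_pmf (pZ x).

Lemma rate_of_size (n M : nat) (r : R) : (0 < n)%N -> (0 < M)%N -> M%:R <= powR 2 (n%:R * r) ->
  n%:R^-1 * ln M%:R <= ln 2 * r.
Proof.
move=> n0 M0 le; have nR : 0 < n%:R :> R by rewrite ltr0n.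
rewrite mulrC ler_pdivrMr // -mulrA [r * _]mulrC [ln 2 * _]mulrC -ln_powR.
by rewrite ler_ln ?posrE ?ltr0n // powR_gt0.
Qed.

Lemma achievable_bounded_auxiliary (Rr R1 eps : R) : 0 < eps -> achievable pXY pZ d D Rr R1 ->
  exists (qU : Y -> 'I_(#|Y| + 3) -> R) (qW : X * 'I_(#|Y| + 3) -> {ffun Z -> Xh} -> R),
    [/\ forall y, is_pmf (qU y), forall xu, is_pmf (qW xu) &
     let P := joint5 pXY pZ qU qW in
     [/\ condMI P (fun o => o.1.2) (fun o => o.1.1.1.2) (fun o => o.1.1.2) <= R1,
         condMI P (fun o => o.1.1.1.1) (fun o => o.2) (fun o => (o.1.2, o.1.1.2)) <= Rr &
         \sum_o P o * d o.1.1.1.1 (o.2 o.1.1.2) <= D + eps]].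
Proof.
(* A single block length suffices; [N.+1] ensures that it is positive. *)
move=> eps0 /(_ _ eps0)[N /(_ N.+1 (leqnSn N))].
move=> [M1 [M [M1le [Mle [f1 [f [g dist]]]]]]].
have [[x0 y0] _] := exists_le_average (fun=> 0) hXY.1 hXY.2.
(* Message sets are nonempty because the encoding maps take values in them. *)
have M10 : (0 < M1)%N by apply: leq_ltn_trans (ltn_ord (f1 [ffun=> y0])).
have M0 : (0 < M)%N.
  by apply: leq_ltn_trans (ltn_ord (f [ffun=> x0] (f1 [ffun=> y0]))).
have [U [pU [pW [hU hW [I1 I2 ED]]]]] := block_code_single_letter d f1 f g hXY hZ (ltn0Sn N).
have [qU [qW [hqU hqW [J1 J2 JD]]]] :=
  bounded_auxiliary (fun x z (w : {ffun Z -> Xh}) => d x (w z)) hXY hZ hU hW.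
exists qU, qW; split=> //; split.
- by rewrite J1 -(ler_pM2l (ln2_gt0 R)); apply: le_trans I1 (rate_of_size _ _ M1le).
- by rewrite J2 -(ler_pM2l (ln2_gt0 R)); apply: le_trans I2 (rate_of_size _ _ Mle).
- by rewrite JD ED.
Qed.

Lemma op_region_sub : op_region pXY pZ d D `<=` sl_region pXY pZ d D.
Proof.
move=> p clp.
have [|qU [qW [hqU hqW [I1 I2 ED]]]] := @single_letter_limit R X Y Z 'I_(#|Y| + 3) {ffun Z -> Xh}
    pXY pZ (fun o => d o.1.1.1.1 (o.2 o.1.1.2)) p.2 p.1 D hXY hZ; last first.
  (* The value of W is itself the reconstruction rule, so the decoder evaluates it at [z]. *)
  by exists 'I_(#|Y| + 3), {ffun Z -> Xh}, qU, qW, (fun _ (w : {ffun Z -> Xh}) z => w z).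
move=> eps eps0.
(* The same [eps] measures the distance to an achievable pair and the excess distortion of its
   code. *)
have [p' [ach [b1 b2]]] := clp _ (nbhsx_ballx p _ eps0).
have near (a a' : R) : ball a eps a' -> a' <= a + eps.
  by rewrite /ball /= distrC ltr_norml => /andP[_ /ltW]; rewrite lerBlDl.
have [qU [qW [hqU hqW [I1 I2 ED]]]] := achievable_bounded_auxiliary eps0 ach.
exists qU, qW; split=> //; split=> //.
- exact: le_trans I1 (near _ _ b2).
- exact: le_trans I2 (near _ _ b1).
Qed.

End Converse.

Theorem theorem2 (R : realType) (X Y Z Xh : finType)
  (pXY : X * Y -> R) (pZ : X -> Z -> R) (d : X -> Xh -> R) (D : R) :
  is_pmf pXY -> (forall x, is_pmf (pZ x)) -> (forall x xh, 0 <= d x xh) ->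
  op_region pXY pZ d D = sl_region pXY pZ d D.
Proof.
move=> hXY hZ d0; apply/seteqP; split; first exact: op_region_sub.
move=> p [U [W [pU [pW [xhat [hU [hW [I1 [I2 ED]]]]]]]]] B /nbhs_ballP[eps /= eps0 epsB].
have e2 : 0 < eps / 2 by rewrite divr_gt0.
(* Raising both rates by [eps / 2] gives an achievable pair inside the given neighbourhood. *)
exists (p.1 + eps / 2, p.2 + eps / 2); split; first exact: single_letter_achievable I1 I2 ED e2.
apply: epsB; split; rewrite /ball /= opprD addrA subrr sub0r normrN gtr0_norm //.
all: by rewrite ltr_pdivrMr // ltr_pMr // ltr1n.
Qed.
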